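(* Let $a\in[0,\pi/2)$ and let $\psi_1,\psi_2$ be even entire functions of exponential type $b_1,b_2$ respectively, where $b_j\in\left[0,\frac{1-\sin a}{2e}\right)$, $j=1,2$. For $x>0$ and $\varepsilon>0$ put $$f_\varepsilon(x,a)=\int_0^\infty e^{-\varepsilon\tau^2}\left[\psi_1(\tau)\cosh\left(\left(\frac{\pi}{2}+a\right)\tau\right)+\psi_2(\tau)\,\tau\,\sinh\left(\left(\frac{\pi}{2}+a\right)\tau\right)\right]K_{i\tau}(x)\,d\tau .$$ Then the limit $f(x,a)=\lim_{\varepsilon\to0+}f_\varepsilon(x,a)$ has the value $$f(x,a)=\frac{\pi}{2}\bigl[\psi_1(D_a)+D_a\psi_2(D_a)\bigr]\left\{e^{x\sin a}\right\},$$ where the convergence is understood in the sense of the generalized Mellin transform, i.e. for every complex $s$ with $\mathrm{Re}\,s>0$ $$\lim_{\varepsilon\to0+}\int_0^\infty f_\varepsilon(x,a)\,e^{-x}x^{s-1}\,dx=\frac{\pi}{2}\int_0^\infty\bigl[\psi_1(D_a)+D_a\psi_2(D_a)\bigr]\left\{e^{x\sin a}\right\}e^{-x}x^{s-1}\,dx .$$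
   Context: $K_{i\tau}(x)=\int_0^\infty e^{-x\cosh t}\cos(\tau t)\,dt$ ($x>0$) is the Macdonald function (modified Bessel function of the second kind) of imaginary index. An entire function $\psi$ is of exponential type $b\ge 0$ if for each $\eta>0$ there is $C$ with $|\psi(z)|\le Ce^{(b+\eta)|z|}$ for all $z\in\mathbb{C}$. $D_a=d/da$ is differentiation in the parameter $a$. For an even entire function $\psi(\tau)=\sum_{n\ge0}c_{2n}\tau^{2n}$, the operator $\psi(D_a)$ acts on a function $g$ of $a$ by $\psi(D_a)\{g\}=\sum_{n\ge0}c_{2n}\frac{d^{2n}g}{da^{2n}}$, and $D_a\psi(D_a)\{g\}=\sum_{n\ge0}c_{2n}\frac{d^{2n+1}g}{da^{2n+1}}$. The derivatives in $a$ of $e^{x\sin a}$ are taken with $x$ fixed. *)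

(* Defs.v *)
From HB Require Import structures.
From mathcomp Require Import all_boot all_order all_algebra.
From mathcomp Require Import complex.
From mathcomp Require Import all_classical all_reals all_analysis.
Set Implicit Arguments.
Unset Strict Implicit.
Unset Printing Implicit Defensive.
Import Order.TTheory GRing.Theory Num.Theory.
Import numFieldNormedType.Exports.

Local Open Scope classical_set_scope.
Local Open Scope ring_scope.
Local Open Scope complex_scope.

(* [R[i]] is not recognized as an instance of the generic numClosedFieldType
   topology and normed module structures, which are transported here. *)
Section complex_topology.
Variable R : realType.

#[export, non_forgetful_inheritance]
HB.instance Definition _ := PseudoPointedMetric.copy R[i] (R[i])^o.
#[export, non_forgetful_inheritance]
HB.instance Definition _ := GRing.ComAlgebra.copy R[i] (R[i])^o.
#[export, non_forgetful_inheritance]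
HB.instance Definition _ := Vector.copy R[i] (R[i])^o.
#[export, non_forgetful_inheritance]
HB.instance Definition _ := NormedModule.copy R[i] (R[i])^o.

End complex_topology.

Section complex_analysis.
Context {R : realType}.
Implicit Types (z s : R[i]) (psi : R[i] -> R[i]) (c : nat -> R[i]).

(* [`|z|] is itself an element of [R[i]]; [normc z : R] is the same modulus. *)
Local Notation normc := (@Normc.normc R).

Definition cexp z : R[i] :=
  (expR (complex.Re z) * cos (complex.Im z))
  +i* (expR (complex.Re z) * sin (complex.Im z)).

(* Meant for [0 < x], where it is the principal value. *)
Definition cpow (x : R) s : R[i] := cexp (s * (ln x)%:C).

Definition cintegrable (D : set R) (f : R -> R[i]) : Prop :=
  lebesgue_measure.-integrable D (EFin \o (fun x => complex.Re (f x))) /\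
  lebesgue_measure.-integrable D (EFin \o (fun x => complex.Im (f x))).

(* Only meaningful when [cintegrable D f] holds. *)
Definition cintegral (D : set R) (f : R -> R[i]) : R[i] :=
  (\int[lebesgue_measure]_(x in D) complex.Re (f x))
  +i* (\int[lebesgue_measure]_(x in D) complex.Im (f x)).

(* [derivable] over the field [R[i]] is complex differentiability. *)
Definition entire psi : Prop := forall z, derivable psi z 1.

Definition even_fct psi : Prop := forall z, psi (- z) = psi z.

Definition taylor_coefficients psi c : Prop :=
  forall z, series (fun n => c n * z ^+ n) @ \oo --> psi z.

Definition exponential_type (b : R) psi : Prop :=
  forall eta : R, 0 < eta ->
    exists C : R, forall z, normc (psi z) <= C * expR ((b + eta) * normc z).

End complex_analysis.

Section operators.
Context {R : realType}.
Implicit Types (c : nat -> R[i]) (g : R -> R) (a : R).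

(* Partial sums of psi(D_a){g} and D_a psi(D_a){g}, for psi even with Taylor
   coefficients [c] (so only the [c n.*2] occur); the limits below are only
   meaningful when these partial sums converge. *)
Definition psiD_partial c g a : nat -> R[i] :=
  series (fun n => c n.*2 * (derive1n n.*2 g a)%:C).

Definition DpsiD_partial c g a : nat -> R[i] :=
  series (fun n => c n.*2 * (derive1n n.*2.+1 g a)%:C).

Definition psiD c g a : R[i] := limn (psiD_partial c g a).

Definition DpsiD c g a : R[i] := limn (DpsiD_partial c g a).

End operators.

Section kernels.
Context {R : realType}.
Implicit Types (x t tau a eps : R).

Definition cosh t : R := (expR t + expR (- t)) / 2.
Definition sinh t : R := (expR t - expR (- t)) / 2.

(* K_{i tau}(x), for [0 < x] *)
Definition macdonald tau x : R :=
  \int[lebesgue_measure]_(t in `[0, +oo[) (expR (- x * cosh t) * cos (tau * t)).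

Definition f_integrand (psi1 psi2 : R[i] -> R[i]) a eps x tau : R[i] :=
  (expR (- eps * tau ^+ 2))%:C *
  (psi1 tau%:C * (cosh ((pi / 2 + a) * tau))%:C +
   psi2 tau%:C * tau%:C * (sinh ((pi / 2 + a) * tau))%:C) *
  (macdonald tau x)%:C.

Definition f_eps (psi1 psi2 : R[i] -> R[i]) a eps x : R[i] :=
  cintegral `[0, +oo[ (f_integrand psi1 psi2 a eps x).

(* Generalized Mellin transform at [s]: integrate [mellin_weighted s F] over
   the positive half-line. *)
Definition mellin_weighted (s : R[i]) (F : R -> R[i]) x : R[i] :=
  F x * (expR (- x))%:C * cpow x (s - 1).

End kernels.

(* Main.v *)
Require Import Defs.
From HB Require Import structures.
From mathcomp Require Import all_boot all_order all_algebra.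
From mathcomp Require Import complex.
From mathcomp Require Import all_classical all_reals all_analysis.
From mathcomp Require Import cyclic separable cyclotomic.
From mathcomp Require Import measurable_realfun.
From mathcomp Require Import ring lra zify.
Set Implicit Arguments.
Unset Strict Implicit.
Unset Printing Implicit Defensive.
Import Order.TTheory GRing.Theory Num.Theory.
Import numFieldNormedType.Exports.

Local Open Scope classical_set_scope.
Local Open Scope ring_scope.

(** Since [tau^n cosh((pi/2 + a) tau)], with [sinh] for odd [n], is the [n]-th
    derivative in [a] of [cosh ((pi/2 + a) tau)], both sides of the identity
    apply one operator [\sum_n e_n D_a^n], where [e_(2m)] and [e_(2m+1)] are the
    [2m]-th Taylor coefficients of [psi1] and [psi2], to [cosh ((pi/2 + a) tau)]
    and to [e^{x sin a}]. Let [H(tau)] be the integral of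
    [K_{i tau}(x) e^{-x} x^{s-1}]: up to the factor [Gamma(s)], it is the Fourier
    cosine transform of [(1 + cosh t)^{-s}]. Moving the contour to [t + i b]
    shows that [cosh (b tau) H(tau)] is the cosine transform of the even part of
    [(1 + cosh (t + i b))^{-s}]; hence [H] decays like [e^{-b tau}] for each
    [b < pi], and Fourier inversion at 0 through the Poisson kernel identifies
    the integral of [cosh (b tau) H(tau)] as [pi/2] times the transform of
    [e^{- x cos b}]. At [b = pi/2 + a] this is the case [psi1 = 1], [psi2 = 0],
    and differentiating in [a] gives every single power [D_a^n].

    Summation over [n] rests on two bounds. An entire function of exponential
    type less than [b] has Taylor coefficients at most [K r^{n+1} / (n+1)!] with
    [r = e b], and [\sum_n |D_a^n e^{x sin a}| r^n / n!] is at most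
    [e^{x (sin a + e^r - 1)}]; the hypothesis on the types makes
    [sin a + e^r - 1 < 1], which leaves room against the weight [e^{-x}]. The
    same inequality gives [pi/2 + a + r < pi], so [H] absorbs the growth in [tau]
    and dominated convergence removes the factor [e^{- eps tau^2}]. *)

(** * Integration over the positive half-line *)

(** Almost everything is real. With [s = sg + i nu], a phase [th] is carried along: the real part of
    e^{i th} z is Re z at [th = 0] and Im z at [th = - pi / 2], so one real statement for every [th]
    yields both parts of a complex integral. Contour integration is avoided. By the Cauchy-Riemann
    equations and an integration by parts, two real integrals satisfy a linear differential system
    in [b], which is solved explicitly. The obstacle is the growth in tau. For fixed x only a bound
    of K_{i tau}(x) uniform in tau is used, so before the integration in x the growth of the
    operator sum is paid for by the Gaussian; after it, by the decay of [H]. Hence Fubini is applied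
    at fixed [eps > 0], and [eps] tends to 0 only afterwards. The e in r = e b comes from Cauchy's
    estimate on the circle of radius (n + 1) / b. The 2 e in the hypothesis gives r < (1 - sin a) /
    2 <= 1/2, where e^r - 1 <= 2 r, whence sin a + e^r - 1 < 1. *)

Definition posline {R : realType} : set R := `]0, +oo[.

Lemma measurable_posline {R : realType} : measurable (@posline R : set (measurableTypeR R)).
Proof. exact: measurable_itv. Qed.
#[global] Hint Extern 0 (measurable _) => solve [exact: measurable_posline] : core.

Notation Itg f := (lebesgue_measure.-integrable posline (EFin \o f)).

Definition ip {R : realType} (f : R -> R) : R :=
  \int[lebesgue_measure]_(x in posline) f x.

(* [lebesgue_measure] lives on [measurableTypeR R], whose display differs from
   the default one of [R]. *)
Definition pmeas {R : realType} (f : R -> R) : Prop :=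
  measurable_fun (posline : set (measurableTypeR R)) (f : measurableTypeR R -> R).

Lemma poslineE {R : realType} (x : R) : posline x <-> 0 < x.
Proof. by rewrite /posline /= in_itv/= andbT. Qed.

Lemma pmeas_EFin {R : realType} (f : R -> R) : pmeas f ->
  measurable_fun (posline : set (measurableTypeR R)) (EFin \o f).
Proof. by rewrite /pmeas => mf; apply/measurable_EFinP. Qed.

Lemma eq_ip {R : realType} (f g : R -> R) :
  (forall x, 0 < x -> f x = g x) -> ip f = ip g.
Proof. by move=> h; apply: eq_Rintegral => x /set_mem/poslineE/h. Qed.

Lemma eq_Itg {R : realType} (f g : R -> R) :
  (forall x, 0 < x -> f x = g x) -> Itg f -> Itg g.
Proof.
move=> h; apply: eq_integrable => //.
by move=> x /set_mem/poslineE/h /= ->.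
Qed.

Lemma measurable_Itg {R : realType} (f : R -> R) :
  Itg f -> pmeas f.
Proof. by move=> /measurable_int/measurable_EFinP. Qed.

Lemma Itg_le {R : realType} (f g : R -> R) : pmeas f ->
  (forall x, 0 < x -> `|f x| <= g x) -> Itg g -> Itg f.
Proof.
move=> mf fg; apply: le_integrable => //; first exact: pmeas_EFin.
move=> x /poslineE x0 /=; rewrite lee_fin (le_trans (fg _ x0))//.
exact: ler_norm.
Qed.

Lemma ItgD {R : realType} (f g : R -> R) :
  Itg f -> Itg g -> Itg (fun x => f x + g x).
Proof. by move=> intf intg; exact: (integrableD measurable_posline intf intg). Qed.

Lemma ItgZ {R : realType} (k : R) (f : R -> R) :
  Itg f -> Itg (fun x => k * f x).
Proof. by move=> intf; exact: (integrableZl measurable_posline k intf). Qed.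

Lemma ItgB {R : realType} (f g : R -> R) :
  Itg f -> Itg g -> Itg (fun x => f x - g x).
Proof. by move=> intf intg; exact: (integrableB measurable_posline intf intg). Qed.

Lemma Itg_sum {R : realType} (f : nat -> R -> R) n :
  (forall k, Itg (f k)) -> Itg (fun x => \sum_(k < n) f k x).
Proof.
move=> h; elim: n => [|n ih].
  apply: (@eq_Itg _ (fun=> 0)); first by move=> x _; rewrite big_ord0.
  exact: integrable0.
apply: (@eq_Itg _ (fun x => \sum_(k < n) f k x + f n x)).
  by move=> x _; rewrite big_ord_recr.
exact: ItgD.
Qed.

Lemma ipD {R : realType} (f g : R -> R) : Itg f -> Itg g ->
  ip (fun x => f x + g x) = ip f + ip g.
Proof. by move=> *; exact: RintegralD. Qed.

Lemma ipB {R : realType} (f g : R -> R) : Itg f -> Itg g ->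
  ip (fun x => f x - g x) = ip f - ip g.
Proof. by move=> *; exact: RintegralB. Qed.

Lemma ipZ {R : realType} (k : R) (f : R -> R) : Itg f ->
  ip (fun x => k * f x) = k * ip f.
Proof. by move=> *; exact: RintegralZl. Qed.

Lemma ip_sum {R : realType} (f : nat -> R -> R) n :
  (forall k, Itg (f k)) ->
  ip (fun x => \sum_(k < n) f k x) = \sum_(k < n) ip (f k).
Proof.
move=> h; elim: n => [|n ih].
  rewrite big_ord0 (@eq_ip _ _ (fun=> 0)); last by move=> x _; rewrite big_ord0.
  by rewrite /ip /Rintegral integral0.
rewrite big_ord_recr/= -ih -ipD//; last exact: Itg_sum.
by apply: eq_ip => x _; rewrite big_ord_recr.
Qed.

Lemma ip_le {R : realType} (f g : R -> R) : Itg f -> Itg g ->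
  (forall x, 0 < x -> f x <= g x) -> ip f <= ip g.
Proof. by move=> *; apply: le_Rintegral => // x /poslineE; auto. Qed.

Lemma ip_norm {R : realType} (f g : R -> R) : Itg f -> Itg g ->
  (forall x, 0 < x -> `|f x| <= g x) -> `|ip f| <= ip g.
Proof.
move=> intf intg fg; apply: le_trans (le_normr_Rintegral _ intf) _ => //.
by apply: ip_le => //; exact: integrable_norm.
Qed.

Lemma dominated_ip {R : realType} (u : nat -> R -> R) (f g : R -> R) :
  (forall n, pmeas (u n)) ->
  (forall x, 0 < x -> u n x @[n --> \oo] --> f x) ->
  Itg g -> (forall n x, 0 < x -> `|u n x| <= g x) ->
  Itg f /\ ip (u n) @[n --> \oo] --> ip f.
Proof.
move=> mu_ uf intg ug.
have mf : measurable_fun (posline : set (measurableTypeR R)) (EFin \o f).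
  apply: pmeas_EFin.
  by apply: (measurable_fun_cvg mu_) => x /poslineE/uf.
have mu_E n : measurable_fun (posline : set (measurableTypeR R)) (EFin \o u n).
  exact: (pmeas_EFin (mu_ n)).
have ufE : {ae @lebesgue_measure R, forall x : measurableTypeR R,
    posline x -> (EFin \o u n) x @[n --> \oo] --> (EFin \o f) x}.
  by apply: aeW => x /poslineE/uf h; exact/cvg_EFin/h/nearW.
have ugE : {ae @lebesgue_measure R, forall (x : measurableTypeR R) n,
    posline x -> (`|(EFin \o u n) x| <= (EFin \o g) x)%E}.
  by apply: aeW => x n /poslineE /ug h; rewrite /= lee_fin.
have [intf _ h] := dominated_convergence measurable_posline mu_E mf ufE intg ugE.
split=> //; apply: fine_cvg; rewrite fineK//.
by have := integrable_fin_num measurable_posline intf.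
Qed.

Lemma pmeasW {R : realType} (f : R -> R) : measurable_fun setT f -> pmeas f.
Proof. by move=> mf; apply: (@measurable_funS _ _ (measurableTypeR R) R setT). Qed.

Lemma continuous_pmeas {R : realType} (f : R -> R) :
  (forall x, 0 < x -> {for x, continuous f}) -> pmeas f.
Proof.
move=> cf; apply: open_continuous_measurable_fun; first exact: interval_open.
by move=> x /set_mem/poslineE/cf.
Qed.

Lemma pmeasM {R : realType} (f g : R -> R) :
  pmeas f -> pmeas g -> pmeas (fun x => f x * g x).
Proof. by move=> mf mg; exact: measurable_funM. Qed.

Lemma pmeas_comp {R : realType} (f g : R -> R) :
  measurable_fun setT f -> pmeas g -> pmeas (fun x => f (g x)).
Proof. by move=> mf mg; exact: measurableT_comp. Qed.

Lemma is_derive_under_ip {R : realType} (f df : R -> R -> R) (g : R -> R)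
    (u v a : R) : u < a < v ->
  (forall y, u < y < v -> Itg (f y)) ->
  (forall y x, u < y < v -> 0 < x -> is_derive y 1 (f ^~ x) (df y x)) ->
  Itg g -> (forall y x, u < y < v -> 0 < x -> `|df y x| <= g x) ->
  is_derive a 1 (fun y => ip (f y)) (ip (df a)).
Proof.
move=> uav intf derf intg dfg.
have ia : `]u, v[%classic a by rewrite /= in_itv.
have intf' y : `]u, v[%classic y -> Itg (f y) by rewrite /= in_itv => /intf.
have derf' y x : `]u, v[%classic y -> posline x -> derivable (f ^~ x) y 1.
  by rewrite /= in_itv => uyv /poslineE x0; have [] := derf _ _ uyv x0.
have dE y x : u < y < v -> 0 < x -> partial1of2 f y x = df y x.
  by move=> uyv x0; rewrite partial1of2E; have [] := derf _ _ uyv x0.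
have intg' : Itg (fun x => `|g x|) by exact: integrable_norm.
have dfg' y x : `]u, v[%classic y -> posline x -> `|partial1of2 f y x| <= `|g x|.
  rewrite /= in_itv => uyv /poslineE x0; rewrite dE// (le_trans (dfg _ _ uyv x0))//.
  exact: ler_norm.
have g0 y : 0 <= `|g y| by [].
have D := derivable_under_integral measurable_posline ia intf' derf' g0 intg' dfg'.
have E := differentiation_under_integral measurable_posline ia intf' derf' g0 intg' dfg'.
apply: DeriveDef => //; rewrite -derive1E [LHS]E.
by apply: eq_ip => x x0; exact: dE.
Qed.

Lemma ip_ge0 {R : realType} (f : R -> R) : (forall x, 0 < x -> 0 <= f x) ->
  0 <= ip f.
Proof. by move=> f0; apply: Rintegral_ge0 => x /poslineE/f0. Qed.

(** Tonelli handles the positive and negative parts separately, so measurability holds even across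
    parameters where the integral diverges. The indicator carries the half-line into an integral
    over the whole line. *)
Lemma measurable_ip (d : measure_display) (T : measurableType d)
    (R : realType) (F : T -> R -> R) :
  measurable_fun setT (fun z : T * measurableTypeR R => F z.1 z.2) ->
  measurable_fun setT (fun z => ip (F z)).
Proof.
move=> mF; rewrite /ip /Rintegral.
pose G : T * measurableTypeR R -> \bar R :=
  fun z => (F z.1 z.2 * \1_(posline : set (measurableTypeR R)) z.2)%:E.
have mG : measurable_fun setT G.
  apply/measurable_EFinP; apply: measurable_funM => //.
  by apply: measurableT_comp => //; exact: measurable_indic.
have E z : (\int[lebesgue_measure]_(x in posline) (F z x)%:E)%E =
    (\int[lebesgue_measure]_x (G ^\+ (z, x)) -
     \int[lebesgue_measure]_x (G ^\- (z, x)))%E.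
  rewrite integral_mkcond (eq_integral (fun x => G (z, x))); last first.
    move=> x _; rewrite patchE /G /= indicE.
    by case: ifPn => _; rewrite ?mulr1 ?mulr0.
  rewrite integralE; congr (_ - _)%E; apply: eq_integral => x _.
    by rewrite !funeposE.
  by rewrite !funenegE.
apply: measurableT_comp => //; under eq_fun do rewrite E.
apply: emeasurable_funB.
  by apply: (@measurable_fun_fubini_tonelli_F _ _ _ _ _ lebesgue_measure
    (G ^\+)%E) => //; exact: measurable_funepos.
by apply: (@measurable_fun_fubini_tonelli_F _ _ _ _ _ lebesgue_measure
  (G ^\-)%E) => //; exact: measurable_funeneg.
Qed.

Lemma pmeas_mulI (R : realType) (f : R -> R) : pmeas f ->
  measurable_fun setT (fun x : measurableTypeR R =>
    f x * \1_(posline : set (measurableTypeR R)) x).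
Proof.
move=> mf.
rewrite (_ : (fun x => _) =
    (f : measurableTypeR R -> R) \_ (posline : set (measurableTypeR R))).
  by apply/(measurable_restrictT _ _).1.
by apply/funext => x; rewrite patchE indicE; case: ifPn => _; rewrite ?mulr1 ?mulr0.
Qed.

(** The product majorant bounds the double integral of |F| by a product of two finite integrals,
    which is the integrability that Fubini's theorem asks for. The indicators [I1] extend F by zero
    to the plane. *)
Lemma ip_fubini (R : realType) (F : R -> R -> R) (g h : R -> R) :
  measurable_fun setT (fun z : measurableTypeR R * measurableTypeR R => F z.1 z.2) ->
  Itg g -> Itg h -> (forall x y, 0 < x -> 0 < y -> `|F x y| <= g x * h y) ->
  ip (fun x => ip (F x)) = ip (fun y => ip (F ^~ y)).
Proof.
move=> mF intg inth Fgh.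
pose I1 : measurableTypeR R -> R := \1_(posline : set (measurableTypeR R)).
pose G : measurableTypeR R * measurableTypeR R -> \bar R :=
  fun z => (F z.1 z.2 * I1 z.1 * I1 z.2)%:E.
have mI : measurable_fun setT I1 by exact: measurable_indic.
have mG : measurable_fun setT G.
  apply/measurable_EFinP; apply: measurable_funM => //.
    by apply: measurable_funM => //; exact: measurableT_comp.
  exact: measurableT_comp.
have I1E x : I1 x = (x \in posline)%:R by rewrite /I1 indicE.
have ex (f : R -> R) : (\int[lebesgue_measure]_(x in posline) (f x)%:E)%E =
   (\int[lebesgue_measure]_x ((f x * I1 x)%:E))%E.
  rewrite integral_mkcond; apply: eq_integral => x _.
  by rewrite patchE I1E; case: ifPn => _; rewrite ?mulr1 ?mulr0.
have intFx x : 0 < x -> Itg (F x).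
  move=> x0; apply: (@Itg_le _ _ (fun y => g x * h y)).
  - by apply: pmeasW; exact: (measurableT_comp mF (pair1_measurable _)).
  - by move=> y y0; exact: Fgh.
  - exact: ItgZ.
have intFy y : 0 < y -> Itg (F^~ y).
  move=> y0; apply: (@Itg_le _ _ (fun x => h y * g x)).
  - by apply: pmeasW; exact: (measurableT_comp mF (pair2_measurable _)).
  - by move=> x x0; rewrite mulrC; exact: Fgh.
  - exact: ItgZ.
pose g1 x := `|g x| * I1 x; pose h1 x := `|h x| * I1 x.
have mg1 : measurable_fun (setT : set (measurableTypeR R)) g1.
  apply: (@pmeas_mulI _ (fun x => `|g x|)); apply: pmeas_comp => //.
  exact: measurable_Itg.
have mh1 : measurable_fun (setT : set (measurableTypeR R)) h1.
  apply: (@pmeas_mulI _ (fun x => `|h x|)); apply: pmeas_comp => //.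
  exact: measurable_Itg.
have g10 x : 0 <= g1 x by rewrite mulr_ge0// I1E.
have h10 x : 0 <= h1 x by rewrite mulr_ge0// I1E.
have fin1 (f : R -> R) : Itg f ->
    (\int[lebesgue_measure]_x ((`|f x| * I1 x)%:E) < +oo)%E.
  move=> /integrableP[_]; rewrite -ex; exact: le_lt_trans.
have intG : (lebesgue_measure \x lebesgue_measure)%E.-integrable setT G.
  apply/integrable12ltyP => //.
  apply: (@le_lt_trans _ _
      (\int[lebesgue_measure]_x \int[lebesgue_measure]_y
        ((g1 x)%:E * (h1 y)%:E))%E).
    apply: ge0_le_integral => //.
    - by move=> x _; exact: integral_ge0.
    - apply: (@measurable_fun_fubini_tonelli_F _ _ _ _ _ lebesgue_measure
        (abse \o G)); first exact: measurableT_comp.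
      by move=> z; exact: abse_ge0.
    - apply: (@measurable_fun_fubini_tonelli_F _ _ _ _ _ lebesgue_measure
        (fun z => (g1 z.1)%:E * (h1 z.2)%:E)%E).
      + apply: emeasurable_funM; apply/measurable_EFinP.
          exact: (measurableT_comp mg1 measurable_fst).
        exact: (measurableT_comp mh1 measurable_snd).
      + by move=> z; rewrite lee_fin mulr_ge0.
    - move=> x _; apply: ge0_le_integral => //.
      + apply: measurableT_comp => //.
        exact: (measurableT_comp mG (pair1_measurable _)).
      + by apply: emeasurable_funM => //; exact/measurable_EFinP.
      + move=> y _; rewrite /G /= lee_fin /g1 /h1 !I1E.
        case: (boolP (x \in posline)) => [/set_mem/poslineE x0|_]; last first.
          by rewrite !mulr0 !mul0r normr0.
        case: (boolP (y \in posline)) => [/set_mem/poslineE y0|_]; last first.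
          by rewrite !mulr0 normr0.
        rewrite !mulr1 (le_trans (Fgh _ _ x0 y0))// -normrM; exact: ler_norm.
  have mg1E : measurable_fun (setT : set (measurableTypeR R)) (EFin \o g1).
    exact/measurable_EFinP.
  have mh1E : measurable_fun (setT : set (measurableTypeR R)) (EFin \o h1).
    exact/measurable_EFinP.
  have g1E x : setT x -> (0 <= (EFin \o g1) x)%E by rewrite lee_fin.
  have h1E x : setT x -> (0 <= (EFin \o h1) x)%E by rewrite lee_fin.
  have h1i : (0 <= \int[lebesgue_measure]_x (EFin \o h1) x)%E by exact: integral_ge0.
  have g1i : (0 <= \int[lebesgue_measure]_x (EFin \o g1) x)%E by exact: integral_ge0.
  under eq_integral => x _.
    rewrite (ge0_integralZl _ measurableT mh1E h1E); last by rewrite lee_fin.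
  over.
  rewrite (ge0_integralZr _ measurableT mg1E g1E h1i).
  apply: lte_mul_pinfty => //; last exact: fin1.
  by rewrite ge0_fin_numE//; exact: fin1.
have E1 x : (\int[lebesgue_measure]_y G (x, y))%E = (ip (F x) * I1 x)%:E.
  rewrite I1E; case: (boolP (x \in posline)) => [/set_mem/poslineE x0|xn].
    rewrite mulr1 /ip /Rintegral fineK; last first.
      exact: (integrable_fin_num measurable_posline (intFx _ x0)).
    rewrite ex; apply: eq_integral => y _; rewrite /G/= I1E.
    by rewrite (_ : x \in posline) ?mulr1//; exact/mem_set/poslineE.
  rewrite mulr0; apply: integral0_eq => y _.
  by rewrite /G /= [I1 x]I1E (negbTE xn) mulr0 mul0r.
have E2 y : (\int[lebesgue_measure]_x G (x, y))%E = (ip (F^~ y) * I1 y)%:E.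
  rewrite I1E; case: (boolP (y \in posline)) => [/set_mem/poslineE y0|yn].
    rewrite mulr1 /ip /Rintegral fineK; last first.
      exact: (integrable_fin_num measurable_posline (intFy _ y0)).
    rewrite ex; apply: eq_integral => x _; rewrite /G/= [I1 y]I1E.
    by rewrite (_ : y \in posline) ?mulr1//; exact/mem_set/poslineE.
  rewrite mulr0; apply: integral0_eq => x _.
  by rewrite /G /= [I1 y]I1E (negbTE yn) mulr0.
have := @Fubini _ _ _ _ R lebesgue_measure lebesgue_measure G intG.
under eq_integral => x _ do rewrite E1.
under [in RHS]eq_integral => y _ do rewrite E2.
by rewrite -!ex /ip /Rintegral => ->.
Qed.

(** By uniqueness of Lebesgue measure: [c] times the image measure under x -> c x gives each
    half-open interval its length. *)
Lemma lebesgue_measure_scale (R : realType) (c : R) : 0 < c ->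
  forall A : set (measurableTypeR R), measurable A ->
  lebesgue_measure ((fun x : measurableTypeR R => c * x : measurableTypeR R) @^-1` A) =
  (c^-1%:E * lebesgue_measure A)%E.
Proof.
move=> c0 A mA; have cN0 : c != 0 by rewrite gt_eqF.
pose phi (x : measurableTypeR R) : measurableTypeR R := c * x.
have mphi : measurable_fun setT phi by exact: mulrl_measurable.
pose nu := mscale (NngNum (ltW c0)) (pushforward (@lebesgue_measure R) phi).
have nuE B : nu mphi B = (c%:E * lebesgue_measure (phi @^-1` B))%E by [].
suff -> : lebesgue_measure A = nu mphi A.
  by rewrite nuE muleA -EFinM mulVf// mul1e.
apply: (@lebesgue_measure_unique R (nu mphi)) => // _ [[a b]] _ <-.
transitivity (c%:E * lebesgue_measure (phi @^-1` `]a, b]%classic))%E => //.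
rewrite (_ : phi @^-1` _ = `]a / c, b / c]%classic); last first.
  apply/seteqP; split=> x; rewrite /phi /= !in_itv/= ltr_pdivrMr// ler_pdivlMr//;
    by rewrite mulrC.
rewrite !lebesgue_measure_itv/= !lte_fin ltr_pM2r ?invr_gt0//.
case: ifPn => _; rewrite ?mule0//= -!EFinB -EFinM; congr EFin.
by field.
Qed.

Lemma Itg_scale (R : realType) (c : R) (f : R -> R) : 0 < c -> Itg f ->
  Itg (fun x => f (c * x)) /\ ip (fun x => f (c * x)) = c^-1 * ip f.
Proof.
move=> c0 intf; have ci0 : 0 <= c^-1 by rewrite invr_ge0 ltW.
pose phi (x : measurableTypeR R) : measurableTypeR R := c * x.
have mphi : measurable_fun setT phi by exact: mulrl_measurable.
have phiP : phi @^-1` posline = posline.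
  by apply/seteqP; split=> x /poslineE x0; apply/poslineE; move: x0;
    rewrite /phi pmulr_rgt0.
have ge0_scale (g : R -> \bar R) :
    measurable_fun (posline : set (measurableTypeR R)) g ->
    (forall x : R, 0 < x -> (0 <= g x)%E) ->
    (\int[lebesgue_measure]_(x in posline) g (c * x)%R =
     c^-1%:E * \int[lebesgue_measure]_(x in posline) g x)%E.
  move=> mg g0.
  have := @ge0_integral_pushforward _ _ _ _ _ _ mphi lebesgue_measure posline g.
  rewrite phiP => <-//; last by move=> x /set_mem/poslineE/g0.
  rewrite -(ge0_integral_mscale _ measurable_posline (NngNum ci0))//; last first.
    by move=> x /poslineE/g0.
  apply: eq_measure_integral => A mA _.
  exact: lebesgue_measure_scale.
have mf : measurable_fun (posline : set (measurableTypeR R)) (EFin \o f).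
  exact: (pmeas_EFin (measurable_Itg intf)).
have intfc : Itg (fun x => f (c * x)).
  apply/integrableP; split.
    have mphiP : measurable_fun posline phi.
      by apply: (measurable_funS measurableT) => //; exact: mphi.
    have phiPS : phi @` posline `<=` posline by move=> _ [x + <-]; rewrite -{1}phiP.
    exact: (measurable_comp measurable_posline phiPS mf mphiP).
  rewrite (ge0_scale (abse \o (EFin \o f))); last 2 first.
  - exact: measurableT_comp.
  - by move=> x _; exact: abse_ge0.
  by have /integrableP[_ ?] := intf; rewrite lte_mul_pinfty.
split=> //; apply: EFin_inj; rewrite EFinM /ip /Rintegral !fineK; last 2 first.
- exact: (integrable_fin_num measurable_posline intf).
- exact: (integrable_fin_num measurable_posline intfc).
rewrite integralE [in RHS]integralE muleBr//; last first.
  rewrite fin_num_adde_defl// fin_numN.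
  exact: (integrable_neg_fin_num measurable_posline intf).
rewrite -(ge0_scale ((EFin \o f)^\+)%E)//; last exact: measurable_funepos.
rewrite -(ge0_scale ((EFin \o f)^\-)%E)//; last exact: measurable_funeneg.
by congr (_ - _)%E; apply: eq_integral => x _; rewrite ?funeposE ?funenegE.
Qed.

(** * Differentiation rules for explicit lambda terms *)

Lemma derD (R : realType) (f g : R -> R) (x df dg : R) : is_derive x 1 f df ->
  is_derive x 1 g dg -> is_derive x 1 (fun y => f y + g y) (df + dg).
Proof. by move=> hf hg; exact: is_deriveD. Qed.

Lemma derB (R : realType) (f g : R -> R) (x df dg : R) : is_derive x 1 f df ->
  is_derive x 1 g dg -> is_derive x 1 (fun y => f y - g y) (df - dg).
Proof. by move=> hf hg; exact: is_deriveB. Qed.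

Lemma derN (R : realType) (f : R -> R) (x df : R) : is_derive x 1 f df ->
  is_derive x 1 (fun y => - f y) (- df).
Proof. by move=> hf; exact: is_deriveN. Qed.

Lemma derM (R : realType) (f g : R -> R) (x df dg : R) : is_derive x 1 f df ->
  is_derive x 1 g dg -> is_derive x 1 (fun y => f y * g y) (df * g x + f x * dg).
Proof.
move=> hf hg; have h := is_deriveM hf hg; apply: (is_derive_eq h).
by rewrite /GRing.scale/= addrC (mulrC (g x)).
Qed.

Lemma der_cst (R : realType) (c x : R) : is_derive x 1 (fun=> c) 0.
Proof. exact: is_derive_cst. Qed.

Lemma derZ (R : realType) (c : R) (f : R -> R) (x df : R) : is_derive x 1 f df ->
  is_derive x 1 (fun y => c * f y) (c * df).
Proof. by move=> hf; apply: (is_derive_eq (derM (der_cst c x) hf)); rewrite mul0r add0r. Qed.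

Lemma der_comp (R : realType) (f g : R -> R) (x df dg : R) : is_derive (g x) 1 f df ->
  is_derive x 1 g dg -> is_derive x 1 (fun y => f (g y)) (df * dg).
Proof. by move=> hf hg; exact: is_derive1_comp. Qed.

Lemma der_expR (R : realType) (f : R -> R) (x df : R) : is_derive x 1 f df ->
  is_derive x 1 (fun y => expR (f y)) (expR (f x) * df).
Proof. by move=> hf; exact: der_comp. Qed.

Lemma der_cos (R : realType) (f : R -> R) (x df : R) : is_derive x 1 f df ->
  is_derive x 1 (fun y => cos (f y)) (- sin (f x) * df).
Proof. by move=> hf; exact: der_comp. Qed.

Lemma der_sin (R : realType) (f : R -> R) (x df : R) : is_derive x 1 f df ->
  is_derive x 1 (fun y => sin (f y)) (cos (f x) * df).
Proof. by move=> hf; exact: der_comp. Qed.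

Lemma der_V (R : realType) (f : R -> R) (x df : R) : f x != 0 -> is_derive x 1 f df ->
  is_derive x 1 (fun y => (f y)^-1) (- df / f x ^+ 2).
Proof.
move=> f0 hf; have h := is_deriveV f0 hf; apply: (is_derive_eq h).
by rewrite /GRing.scale/= !mulNr mulrC.
Qed.

Lemma der_ln (R : realType) (f : R -> R) (x df : R) : 0 < f x -> is_derive x 1 f df ->
  is_derive x 1 (fun y => ln (f y)) (df / f x).
Proof.
move=> f0 hf; apply: (is_derive_eq (der_comp (is_derive1_ln f0) hf)).
by rewrite mulrC.
Qed.

Lemma der_atan (R : realType) (f : R -> R) (x df : R) : is_derive x 1 f df ->
  is_derive x 1 (fun y => atan (f y)) (df / (1 + f x ^+ 2)).
Proof.
move=> hf; apply: (is_derive_eq (der_comp (is_derive1_atan (f x)) hf)).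
by rewrite mulrC.
Qed.

Lemma der_continuous (R : realType) (f : R -> R) (x df : R) : is_derive x 1 f df ->
  {for x, continuous f}.
Proof. by move=> [hf _]; apply: differentiable_continuous; exact/derivable1_diffP. Qed.

Lemma der_derive1 (R : realType) (f : R -> R) (x df : R) : is_derive x 1 f df ->
  derive1 f x = df.
Proof. by move=> [_ <-]; rewrite derive1E. Qed.

(** * Fundamental theorem of calculus on the half-line *)

Lemma near_posline (R : realType) (x : R) : 0 < x ->
  \forall n \near \oo, n.+2%:R^-1 <= x <= n.+2%:R.
Proof.
move=> x0; near=> n.
have nn : (n%:R : R) <= n.+2%:R by rewrite ler_nat -addn2 leq_addr.
apply/andP; split.
  rewrite -[leRHS]invrK lef_pV2 ?posrE ?invr_gt0// (le_trans _ nn)//.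
  by near: n; exact: nbhs_infty_ger.
rewrite (le_trans _ nn)//; near: n; exact: nbhs_infty_ger.
Unshelve. all: end_near. Qed.

(** The intervals [1/(n+2), n+2] exhaust the half-line. Starting at 2 makes each of them
    nondegenerate, as the fundamental theorem on a segment requires. *)
Lemma cvg_ip_itv (R : realType) (f : R -> R) : Itg f ->
  \int[lebesgue_measure]_(x in `[n.+2%:R^-1, n.+2%:R]) f x @[n --> \oo] --> ip f.
Proof.
move=> intf.
pose D n : set (measurableTypeR R) := `[n.+2%:R^-1, n.+2%:R]%classic.
have mD n : measurable (D n) by exact: measurable_itv.
have DP n : D n `<=` posline.
  move=> x; rewrite /D /= in_itv/= => /andP[h _]; apply/poslineE.
  by apply: lt_le_trans h; rewrite invr_gt0.
have E n : \int[lebesgue_measure]_(x in D n) f x = ip (fun x => f x * \1_(D n) x).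
  rewrite -[in LHS](setIidr (DP n)) Rintegral_mkcondr; apply: eq_ip => x _.
  by rewrite patchE indicE; case: ifPn; rewrite ?mulr1 ?mulr0.
under eq_fun do rewrite E.
have := @dominated_ip _ (fun n x => f x * \1_(D n) x) f (fun x => `|f x|).
case=> //.
- move=> n; apply: pmeasM; first exact: measurable_Itg.
  by apply: measurable_funTS; exact: measurable_indic.
- move=> x x0; apply: cvg_near_cst.
  near=> n; rewrite indicE mem_set ?mulr1// /D /= in_itv/=.
  by near: n; exact: near_posline.
- exact: integrable_norm.
- move=> n x _; rewrite normrM ler_piMr// indicE; case: (_ \in _); rewrite ?normr1 ?normr0//.
Unshelve. all: end_near. Qed.

Lemma integral_der (R : realType) (f F : R -> R) (a b : R) : a < b ->
  (forall x : R, a <= x <= b -> {for x, continuous f}) ->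
  (forall x : R, a <= x <= b -> is_derive x 1 F (f x)) ->
  (\int[lebesgue_measure]_(x in `[a, b]) (f x)%:E = (F b - F a)%:E)%E.
Proof.
move=> ab cf dF; rewrite (@continuous_FTC2 _ f F a b ab)//.
- apply: continuous_in_subspaceT => x /set_mem /=; rewrite in_itv/=; exact: cf.
- split.
  + by move=> x; rewrite in_itv/= => /andP[ax xb]; have [] := dF x; rewrite ?ltW.
  + apply: cvg_at_right_filter; apply: der_continuous (dF _ _).
    by rewrite lexx ltW.
  + apply: cvg_at_left_filter; apply: der_continuous (dF _ _).
    by rewrite lexx ltW.
- by move=> x; rewrite in_itv/= => /andP[ax xb]; apply: der_derive1; apply: dF; rewrite !ltW.
Qed.

Lemma Rintegral_der (R : realType) (f F : R -> R) (a b : R) : a < b ->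
  (forall x : R, a <= x <= b -> {for x, continuous f}) ->
  (forall x : R, a <= x <= b -> is_derive x 1 F (f x)) ->
  \int[lebesgue_measure]_(x in `[a, b]) f x = F b - F a.
Proof. by move=> ab cf dF; rewrite /Rintegral (integral_der ab cf dF). Qed.

Lemma ip_FTC (R : realType) (f F : R -> R) (l0 l1 : R) :
  (forall x : R, 0 < x -> {for x, continuous f}) ->
  (forall x : R, 0 < x -> is_derive x 1 F (f x)) -> Itg f ->
  F n.+2%:R^-1 @[n --> \oo] --> l0 -> F n.+2%:R @[n --> \oo] --> l1 ->
  ip f = l1 - l0.
Proof.
move=> cf dF intf F0 F1.
have lt_n n : n.+2%:R^-1 < n.+2%:R :> R.
  by rewrite (@lt_trans _ _ 1)// ?invf_lt1// ltr1n.
have inP n (x : R) : n.+2%:R^-1 <= x <= n.+2%:R -> 0 < x.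
  by move=> /andP[h _]; apply: lt_le_trans h; rewrite invr_gt0.
have E n : \int[lebesgue_measure]_(x in `[n.+2%:R^-1, n.+2%:R]) f x =
    F n.+2%:R - F n.+2%:R^-1.
  by apply: Rintegral_der => // x /inP; [exact: cf|exact: dF].
have := cvg_ip_itv intf; under eq_fun do rewrite E.
move=> h; apply: (cvg_unique _ h) => //; exact: cvgB.
Qed.

(** Monotone convergence: the integrals over the exhausting intervals increase, and as differences
    of values of [F] they stay below [M + M]. *)
Lemma Itg_FTC (R : realType) (f F : R -> R) (M : R) :
  (forall x, 0 < x -> 0 <= f x) ->
  (forall x : R, 0 < x -> {for x, continuous f}) ->
  (forall x : R, 0 < x -> is_derive x 1 F (f x)) ->
  (forall x, 0 < x -> `|F x| <= M) -> Itg f.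
Proof.
move=> f0 cf dF FM.
have lt_n n : n.+2%:R^-1 < n.+2%:R :> R.
  by rewrite (@lt_trans _ _ 1)// ?invf_lt1// ltr1n.
have inP n (x : R) : n.+2%:R^-1 <= x <= n.+2%:R -> 0 < x.
  by move=> /andP[h _]; apply: lt_le_trans h; rewrite invr_gt0.
pose D n : set (measurableTypeR R) := `[n.+2%:R^-1, n.+2%:R]%classic.
have mf : measurable_fun (posline : set (measurableTypeR R)) (EFin \o f).
  exact: pmeas_EFin (continuous_pmeas cf).
apply/integrableP; split=> //.
rewrite (_ : posline = \bigcup_n D n); last first.
  apply/seteqP; split=> [x /poslineE x0|x [n _]]; last first.
    by rewrite /D /= in_itv/= => /inP ?; exact/poslineE.
  near \oo => n; exists n => //; rewrite /D /= in_itv/=.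
  by near: n; exact: near_posline.
have ndD : nondecreasing_seq D.
  move=> m n mn; apply/subsetPset => x; rewrite /D /= !in_itv/= => /andP[mx xm].
  have mnR : (m.+2%:R : R) <= n.+2%:R by rewrite ler_nat.
  rewrite (le_trans xm mnR) andbT (le_trans _ mx)// lef_pV2 ?posrE//.
have mD n : measurable (D n) by exact: measurable_itv.
have DP n : D n `<=` posline.
  by move=> x; rewrite /D /= in_itv/= => /inP ?; exact/poslineE.
have M0 : 0 <= M by apply: le_trans (FM 1 _).
have h := @ge0_nondecreasing_set_cvg_integral _ _ R D (fun x => `|(EFin \o f) x|)%E
   lebesgue_measure ndD mD.
apply: (@le_lt_trans _ _ (M + M)%:E); last exact: ltry.
apply: (cvge_le _ (h _ _)).
- exists 0%N => // n _.
  have -> : (\int[lebesgue_measure]_(x in D n) `|(EFin \o f) x| =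
      \int[lebesgue_measure]_(x in D n) (f x)%:E)%E.
    apply: eq_integral.
    by move=> x /set_mem/DP/poslineE x0; rewrite gee0_abs// lee_fin f0.
  have cfn x : n.+2%:R^-1 <= x <= n.+2%:R -> {for x, continuous f} by move=> /inP/cf.
  have dFn (x : R) : n.+2%:R^-1 <= x <= n.+2%:R -> is_derive x 1 F (f x).
    by move=> /inP/dF.
  rewrite /D (integral_der (lt_n n) cfn dFn).
  rewrite lee_fin (le_trans (ler_norm _))// (le_trans (ler_normB _ _))//.
  by rewrite lerD// FM// invr_gt0.
- move=> n; apply: measurableT_comp => //.
  exact: (measurable_funS measurable_posline (DP n) mf).
- by move=> n x _; exact: abse_ge0.
Unshelve. all: end_near. Qed.

Lemma der_id (R : realType) (x : R) : is_derive x 1 (fun y : R => y) 1.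
Proof. exact: is_derive_id. Qed.

Lemma der_eq (R : realType) (f : R -> R) (x df d : R) :
  is_derive x 1 f df -> df = d -> is_derive x 1 f d.
Proof. by move=> h <-. Qed.

Lemma der_ext (R : realType) (f g : R -> R) (x df : R) :
  f =1 g -> is_derive x 1 f df -> is_derive x 1 g df.
Proof. by move=> /funext ->. Qed.

Lemma der_X (R : realType) (f : R -> R) n (x df : R) : is_derive x 1 f df ->
  is_derive x 1 (fun y => f y ^+ n) (n%:R * f x ^+ n.-1 * df).
Proof.
move=> hf; have h := is_deriveX n hf.
by apply: (@der_ext _ (f ^+ n)) => y; rewrite fctE.
Qed.

Lemma der_cosh (R : realType) (f : R -> R) (x df : R) : is_derive x 1 f df ->
  is_derive x 1 (fun y => cosh (f y)) (sinh (f x) * df).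
Proof.
move=> hf; refine (der_comp _ hf).
notypeclasses refine (der_eq (derM (derD (der_expR (der_id _))
  (der_expR (derN (der_id _)))) (der_cst _ _)) _).
rewrite /sinh; ring.
Qed.

Lemma der_sinh (R : realType) (f : R -> R) (x df : R) : is_derive x 1 f df ->
  is_derive x 1 (fun y => sinh (f y)) (cosh (f x) * df).
Proof.
move=> hf; refine (der_comp _ hf).
notypeclasses refine (der_eq (derM (derB (der_expR (der_id _))
  (der_expR (derN (der_id _)))) (der_cst _ _)) _).
rewrite /cosh; ring.
Qed.

(** [notypeclasses refine] leaves the premises to this recursion instead of instance search. What
    remains are the side conditions of [der_V] (nonzero) and [der_ln] (positive). *)
Ltac der := repeat first
  [ eassumption
  | notypeclasses refine (der_cst _ _)
  | notypeclasses refine (der_id _)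
  | notypeclasses refine (der_cosh _)
  | notypeclasses refine (der_sinh _)
  | notypeclasses refine (der_expR _)
  | notypeclasses refine (der_cos _)
  | notypeclasses refine (der_sin _)
  | notypeclasses refine (der_ln _ _)
  | notypeclasses refine (der_atan _)
  | notypeclasses refine (der_X _ _)
  | notypeclasses refine (derD _ _)
  | notypeclasses refine (derN _)
  | notypeclasses refine (derM _ _)
  | notypeclasses refine (der_V _ _) ].

Ltac cont := notypeclasses refine (der_continuous _); der.

Lemma der_ge0_le (R : realType) (f df : R -> R) (a b : R) : a <= b ->
  (forall x : R, a <= x <= b -> is_derive x 1 f (df x)) ->
  (forall x : R, a <= x <= b -> 0 <= df x) -> f a <= f b.
Proof.
rewrite le_eqVlt => /predU1P[->//|ab] dF df0.
have dF' (x : R) : x \in `]a, b[ -> is_derive x 1 f (df x).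
  by rewrite in_itv/= => /andP[ax xb]; apply: dF; rewrite !ltW.
have cf : {within `[a, b], continuous f}.
  apply: continuous_in_subspaceT => x /set_mem /=; rewrite in_itv/= => /dF.
  exact: der_continuous.
have [c cab E] := MVT ab dF' cf.
rewrite -subr_ge0 E mulr_ge0 ?subr_ge0 ?(ltW ab)// df0//.
by move: cab; rewrite in_itv/= => /andP[ax xb]; rewrite !ltW.
Qed.

Lemma der0_cst (R : realType) (f : R -> R) (a b : R) : a <= b ->
  (forall x : R, a <= x <= b -> is_derive x 1 f 0) -> f a = f b.
Proof.
move=> ab df; apply/eqP; rewrite eq_le; apply/andP; split.
  by apply: (der_ge0_le ab df).
rewrite -lerN2; apply: (@der_ge0_le _ (fun x => - f x) (fun=> 0) _ _ ab) => // x xab.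
by apply: der_eq (derN (df _ xab)) _; rewrite oppr0.
Qed.

Lemma cvg_harmonic2 (R : realType) : (n.+2%:R^-1 : R) @[n --> \oo] --> 0.
Proof.
have := @cvg_harmonic R; rewrite -(cvg_shiftn 1); apply: cvg_trans.
by apply: near_eq_cvg; apply: nearW => n; rewrite /harmonic /= addn1.
Qed.

Lemma cvg_at0 (R : realType) (F : R -> R) : {for 0, continuous F} ->
  F n.+2%:R^-1 @[n --> \oo] --> F 0.
Proof. by move=> cF; apply: (cvg_comp _ F (@cvg_harmonic2 R)). Qed.

Lemma cvg_expRN (R : realType) (c M : R) (F : R -> R) : 0 < c ->
  (forall x, 0 < x -> `|F x| <= M * expR (- (c * x))) ->
  F n.+2%:R @[n --> \oo] --> 0.
Proof.
move=> c0 FM; apply/norm_cvg0P.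
have M0 : 0 <= M.
  have := le_trans (normr_ge0 _) (FM 1 ltr01); rewrite pmulr_lge0//; exact: expR_gt0.
(* e^{- c x} <= 1 / (c x), because c x <= 1 + c x <= e^{c x}. *)
apply: (@squeeze_cvgr _ _ _ _ (fun=> 0) (fun n => M * c^-1 * n.+2%:R^-1)).
- apply: nearW => n; rewrite normr_ge0/= (le_trans (FM _ _))// -mulrA ler_wpM2l//.
  rewrite expRN -invfM lef_pV2 ?posrE ?mulr_gt0 ?expR_gt0//.
  by rewrite (le_trans _ (expR_ge1Dx _))// lerDr.
- exact: cvg_cst.
- by rewrite -[X in _ --> X](mulr0 (M * c^-1)); apply: cvgMr; exact: cvg_harmonic2.
Qed.

(** This is y^p <= p^p e^y; after taking logarithms and dividing by [p] it becomes ln (y / p) <= y /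
    p. *)
Lemma expR_ln_le (R : realType) (p y : R) : 0 < p -> 0 < y ->
  expR (p * ln y) <= expR (p * ln p) * expR y.
Proof.
move=> p0 y0; rewrite -expRD ler_expR -[X in _ + X](mulfVK (lt0r_neq0 p0)) mulrC [X in _ + X]mulrC.
rewrite (mulrC p (ln p)) -!(mulrC p) -mulrDr ler_pM2l// -lerBlDl -ln_div ?posrE//.
rewrite -ler_expR lnK ?posrE ?divr_gt0//.
by rewrite (le_trans _ (expR_ge1Dx _))// lerDr.
Qed.

(** One majorant serves both ends: p x^{p-1} / (1 + x^p)^2 is the derivative of the bounded function
    -1 / (1 + x^p), is of order x^{p-1} at 0, and its denominator is at most a multiple of e^{c
    x}. *)
Lemma Itg_gamma (R : realType) (p c : R) : 0 < p -> 0 < c ->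
  Itg (fun x => expR ((p - 1) * ln x - c * x)).
Proof.
move=> p0 c0; pose X (x : R) := expR (p * ln x).
have X0 x : 0 < X x by exact: expR_gt0.
pose f x := p * X x / x / (1 + X x) ^+ 2.
pose F x := - (1 + X x)^-1.
have N0 x : 1 + X x != 0 by rewrite gt_eqF// addr_gt0.
have intf : Itg f.
  apply: (@Itg_FTC _ f F 1) => x x0.
  - rewrite /f !mulr_ge0 ?invr_ge0 ?exprn_ge0// ?addr_ge0// ?ltW//.
  - by rewrite /f /X; cont; rewrite ?expf_neq0 ?(gt_eqF x0)//; exact: N0.
  - rewrite /F /X; notypeclasses refine (der_eq _ _).
      by der => //; exact: N0.
    rewrite /f /X -/(X x); move: (X x) (N0 x) (gt_eqF x0) => y y0 xn.
    by field; rewrite y0 xn.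
  - have X1 : 0 < 1 + X x by rewrite addr_gt0.
    by rewrite /F normrN gtr0_norm ?invr_gt0// invf_le1// lerDl ltW.
(* From (1 + X)^2 <= 2 + 2 X^2 and X^2 = x^{2p} <= (2p)^{2p} c^{-2p} e^{c x}, by [expR_ln_le] at y =
   c x; the division by [p] cancels the factor [p] in [f]. *)
pose K := (2 + 2 * expR (2 * p * ln (2 * p) - 2 * p * ln c)) / p.
apply: (@Itg_le _ _ (fun x => K * f x)); last exact: ItgZ.
  by apply: continuous_pmeas => x x0; cont.
move=> x x0; rewrite ger0_norm ?expR_ge0//.
have -> : expR ((p - 1) * ln x - c * x) = X x / x * expR (- (c * x)).
  rewrite expRD mulrBl mul1r [X in X * _]expRD; congr (_ * _ * _).
  by rewrite expRN lnK// posrE.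
rewrite /f /K.
have H : (1 + X x) ^+ 2 <= (2 + 2 * expR (2 * p * ln (2 * p) - 2 * p * ln c)) * expR (c * x).
  have X2 : X x ^+ 2 <= expR (2 * p * ln (2 * p) - 2 * p * ln c) * expR (c * x).
    have := @expR_ln_le _ (2 * p) (c * x) _ _.
    rewrite lnM ?posrE// mulrDr expRD => h.
    rewrite expRD expRN mulrAC ler_pdivlMr ?expR_gt0// mulrC.
    apply: le_trans (h _ _); rewrite ?mulr_gt0// ler_wpM2l ?expR_ge0// /X.
    by rewrite -expRM_natl mulrA.
  have e1 : 1 <= expR (c * x) by rewrite -expR0 ler_expR mulr_ge0 ?ltW.
  have := sqr_ge0 (X x - 1); move: (X x) X2 => y X2 sq; nra.
rewrite (_ : _ / p * _ = X x / x * ((2 + 2 * expR (2 * p * ln (2 * p) - 2 * p * ln c)) / (1 + X x) ^+ 2)); last first.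
  by field; rewrite N0 !gt_eqF.
apply: ler_wpM2l; first by rewrite divr_ge0 ?ltW.
by rewrite expRN ler_pdivlMr ?exprn_gt0 ?addr_gt0// mulrC ler_pdivrMr ?expR_gt0.
Qed.

(** * Shifting the contour *)

Lemma cosh2_sinh2 (R : realType) (u : R) : cosh u ^+ 2 - sinh u ^+ 2 = 1.
Proof.
have h : expR u * expR (- u) = 1 by rewrite -expRD subrr expR0.
rewrite /cosh /sinh; move: (expR u) (expR (- u)) h => x y h.
by rewrite (_ : _ - _ = x * y); [|field].
Qed.

Lemma cosh_ge_expR (R : realType) (u : R) : expR u / 2 <= cosh u.
Proof. by rewrite /cosh ler_pM2r ?invr_gt0// lerDl expR_ge0. Qed.

Lemma cosh_gt0 (R : realType) (u : R) : 0 < cosh u.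
Proof. by rewrite (lt_le_trans _ (cosh_ge_expR u))// divr_gt0 ?expR_gt0. Qed.

Lemma cosh_ge1 (R : realType) (u : R) : 1 <= cosh u.
Proof.
have := cosh2_sinh2 u; have := cosh_gt0 u; have := sqr_ge0 (sinh u).
move: (cosh u) (sinh u) => x y; nra.
Qed.

Lemma normr_sinh_le (R : realType) (u : R) : `|sinh u| <= cosh u.
Proof.
have := cosh2_sinh2 u; have := cosh_gt0 u.
rewrite ler_norml; move: (cosh u) (sinh u) => x y x0 h.
by apply/andP; split; nra.
Qed.

Lemma cosh0 (R : realType) : cosh 0 = 1 :> R.
Proof. by rewrite /cosh oppr0 expR0; field. Qed.

Lemma sinh0 (R : realType) : sinh 0 = 0 :> R.
Proof. by rewrite /sinh oppr0 subrr mul0r. Qed.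

Lemma cos_le_norm (R : realType) (x y : R) : `|x| <= y -> y <= pi -> cos y <= cos x.
Proof.
move=> xy ypi; have x0 : cos `|x| = cos x.
  by have [?|?] := leP 0 x; [rewrite ger0_norm|rewrite ltr0_norm// cosN].
have y0 : 0 <= y by rewrite (le_trans _ xy).
by rewrite -x0 leNgt ltr_cos -?leNgt// in_itv/= ?y0 ?ypi ?normr_ge0 ?(le_trans xy ypi).
Qed.

Lemma cos_gtN1 (R : realType) (x : R) : `|x| < pi -> 0 < 1 + cos x.
Proof.
rewrite ltr_norml => /andP[x1 x2].
have -> : 1 + cos x = cos (x / 2) ^+ 2 *+ 2.
  have {1}-> : x = (x / 2) *+ 2 by rewrite -mulr_natr; field.
  by rewrite cos_mulr2n addrC subrK.
rewrite pmulrn_lgt0// exprn_gt0// cos_gt0_pihalf//.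
by rewrite -mulNr ltr_pM2r ?invr_gt0// ltr_pM2r ?invr_gt0// x1.
Qed.

(** * Measurability by structural rules *)

Lemma mfM d (T : measurableType d) (R : realType) (f g : T -> R) :
  measurable_fun setT f -> measurable_fun setT g ->
  measurable_fun setT (fun z => f z * g z).
Proof. exact: measurable_funM. Qed.

Lemma mfD d (T : measurableType d) (R : realType) (f g : T -> R) :
  measurable_fun setT f -> measurable_fun setT g ->
  measurable_fun setT (fun z => f z + g z).
Proof. exact: measurable_funD. Qed.

Lemma mf_comp d (T : measurableType d) (R : realType) (f : R -> R) (g : T -> R) :
  measurable_fun setT f -> measurable_fun setT g ->
  measurable_fun setT (fun z => f (g z)).
Proof. exact: measurableT_comp. Qed.

Lemma mfN d (T : measurableType d) (R : realType) (f : T -> R) :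
  measurable_fun setT f -> measurable_fun setT (fun z => - f z).
Proof.
move=> mf; apply: (@mf_comp _ _ _ (fun x => - x)) => //.
by apply: continuous_measurable_fun => x; cont.
Qed.

Lemma mf_cst d (T : measurableType d) (R : realType) (c : R) :
  measurable_fun setT (fun _ : T => c).
Proof. exact: measurable_cst. Qed.

Lemma measurable_cos (R : realType) : measurable_fun setT (@cos R).
Proof. by apply: continuous_measurable_fun; exact: continuous_cos. Qed.

Lemma measurable_sin (R : realType) : measurable_fun setT (@sin R).
Proof. by apply: continuous_measurable_fun; exact: continuous_sin. Qed.

Lemma measurable_cosh (R : realType) : measurable_fun setT (@cosh R).
Proof. by apply: continuous_measurable_fun => x; cont. Qed.

Lemma measurable_sinh (R : realType) : measurable_fun setT (@sinh R).
Proof. by apply: continuous_measurable_fun => x; cont. Qed.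

Ltac meas := lazymatch goal with
  | |- measurable_fun _ (fun z => expR _) =>
      notypeclasses refine (mf_comp (@measurable_expR _) _); meas
  | |- measurable_fun _ (fun z => cosh _) =>
      notypeclasses refine (mf_comp (@measurable_cosh _) _); meas
  | |- measurable_fun _ (fun z => sinh _) =>
      notypeclasses refine (mf_comp (@measurable_sinh _) _); meas
  | |- measurable_fun _ (fun z => cos _) =>
      notypeclasses refine (mf_comp (@measurable_cos _) _); meas
  | |- measurable_fun _ (fun z => sin _) =>
      notypeclasses refine (mf_comp (@measurable_sin _) _); meas
  | |- measurable_fun _ (fun z => ln _) =>
      notypeclasses refine (mf_comp (@measurable_ln _) _); meas
  | |- measurable_fun _ (fun z => _ + _) => notypeclasses refine (mfD _ _); meas
  | |- measurable_fun _ (fun z => - _) => notypeclasses refine (mfN _); meas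
  | |- measurable_fun _ (fun z => _ * _) => notypeclasses refine (mfM _ _); meas
  | |- measurable_fun _ (GRing.mul _) => exact: mulrl_measurable
  | _ => first [ assumption | exact: mf_cst
               | exact: measurable_cosh | exact: measurable_sinh
               | exact: measurable_cos | exact: measurable_sin
               | exact: measurable_expR | exact: measurable_ln | exact: measurable_fst
               | exact: measurable_snd | exact: measurable_id | idtac ]
  end.

(* Real part of [e^{i th} * q ^ (- (sg + i nu))]. *)
Definition cpowr (R : realType) (sg nu th q : R) : R :=
  expR (- sg * ln q) * cos (th - nu * ln q).

Definition hfun (R : realType) (sg nu th tau : R) : R :=
  ip (fun u => cos (tau * u) * cpowr sg nu th (1 + cosh u)).

Lemma measurable_hfun (R : realType) (sg nu th : R) :
  measurable_fun setT (hfun sg nu th).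
Proof.
apply: (@measurable_ip _ (measurableTypeR R) _
  (fun tau u => cos (tau * u) * cpowr sg nu th (1 + cosh u))).
by rewrite /cpowr; meas.
Qed.

(** * Real and imaginary parts of (1 + cosh z)^{-s} in the strip |Im z| < pi *)

Section contour.
Variable R : realType.
Variables sg nu th : R.
Hypothesis sg0 : 0 < sg.
Implicit Types u b tau : R.

(* [1 + cosh (u + i b)] has modulus [cosh u + cos b] and argument [arg1 u b];
   [exp (pw + i qw)] is [(1 + cosh (u + i b)) ^ (- (sg + i nu)) * e^{i th}],
   with real and imaginary parts [wC] and [wS]. *)
Let den u b := cosh u + cos b.
Let tu u := sinh u / (1 + cosh u).
Let tb b := sin b / (1 + cos b).
Let arg1 u b := 2 * atan (tu u * tb b).
Let pw u b := - sg * ln (den u b) + nu * arg1 u b.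
Let qw u b := - nu * ln (den u b) - sg * arg1 u b + th.
Let wC u b := expR (pw u b) * cos (qw u b).
Let wS u b := expR (pw u b) * sin (qw u b).
(** [Pu + i Qu] is - s tanh (z / 2) at z = u + i b, the logarithmic derivative of (1 + cosh
    z)^{-s}. *)
Let Pu u b := (- sg * sinh u + nu * sin b) / den u b.
Let Qu u b := (- nu * sinh u - sg * sin b) / den u b.
Let dC u b := expR (pw u b) * (Pu u b * cos (qw u b) - Qu u b * sin (qw u b)).
Let dS u b := expR (pw u b) * (Pu u b * sin (qw u b) + Qu u b * cos (qw u b)).

Let den_gt0 u b : `|b| < pi -> 0 < den u b.
Proof.
move=> /cos_gtN1; rewrite /den; have := cosh_ge1 u.
by move: (cosh u) (cos b) => x y; lra.
Qed.

(** [tu u] is tanh (u / 2) and [tb b] is tan (b / 2). Since 1 + cosh z = 2 cosh (z / 2)^2, the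
    argument of 1 + cosh z is twice that of cosh (z / 2), whose tangent is [tu u * tb b]; this
    explains the shape of [arg1]. *)
Let tu_sqr u : tu u ^+ 2 = (cosh u - 1) / (cosh u + 1).
Proof.
have c0 : 1 + cosh u != 0 by rewrite gt_eqF// addr_gt0// cosh_gt0.
rewrite /tu expr_div_n (_ : sinh u ^+ 2 = (cosh u - 1) * (1 + cosh u)).
  by field; rewrite addrC c0.
by have := cosh2_sinh2 u; lra.
Qed.

Let tb_sqr b : `|b| < pi -> tb b ^+ 2 = (1 - cos b) / (1 + cos b).
Proof.
move=> /cos_gtN1/gt_eqF/negbT c0.
rewrite /tb expr_div_n (_ : sin b ^+ 2 = (1 - cos b) * (1 + cos b)); first by field.
by have := cos2Dsin2 b; lra.
Qed.

Let arg1_den u b : `|b| < pi ->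
  1 + (tu u * tb b) ^+ 2 = 2 * den u b / ((1 + cosh u) * (1 + cos b)).
Proof.
move=> bpi; have cb0 := gt_eqF (cos_gtN1 bpi).
have c0 : 1 + cosh u != 0 by rewrite gt_eqF// addr_gt0// cosh_gt0.
by rewrite exprMn tu_sqr tb_sqr// /den; field; rewrite ?cb0 ?c0 /= ?[cosh u + 1]addrC ?c0.
Qed.

Let der_tu u : is_derive u 1 tu (1 + cosh u)^-1.
Proof.
have c0 : 1 + cosh u != 0 by rewrite gt_eqF// addr_gt0// cosh_gt0.
notypeclasses refine (der_eq _ _); first by rewrite /tu; der.
apply: (@mulIf _ ((1 + cosh u) ^+ 2)); first by rewrite expf_neq0.
transitivity (cosh u * (1 + cosh u) - sinh u ^+ 2); first by field.
have -> : sinh u ^+ 2 = cosh u ^+ 2 - 1 by have := cosh2_sinh2 u; lra.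
by field.
Qed.

Let der_tb b : `|b| < pi -> is_derive b 1 tb (1 + cos b)^-1.
Proof.
move=> /cos_gtN1/gt_eqF/negbT c0.
notypeclasses refine (der_eq _ _); first by rewrite /tb; der.
apply: (@mulIf _ ((1 + cos b) ^+ 2)); first by rewrite expf_neq0.
transitivity (cos b * (1 + cos b) + sin b ^+ 2); first by field.
have -> : sin b ^+ 2 = 1 - cos b ^+ 2 by have := cos2Dsin2 b; lra.
by field.
Qed.

Let der_arg1_u u b : `|b| < pi -> is_derive u 1 (arg1 ^~ b) (sin b / den u b).
Proof.
move=> bpi; have d0 := gt_eqF (den_gt0 u bpi).
have cb0 := gt_eqF (cos_gtN1 bpi).
have c0 : 1 + cosh u != 0 by rewrite gt_eqF// addr_gt0// cosh_gt0.
have := der_tu u => hu.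
notypeclasses refine (der_eq _ _); first by rewrite /arg1; der.
by rewrite arg1_den// /tb; field; rewrite ?d0 ?cb0 ?c0.
Qed.

Let der_arg1_b u b : `|b| < pi -> is_derive b 1 (arg1 u) (sinh u / den u b).
Proof.
move=> bpi; have d0 := gt_eqF (den_gt0 u bpi).
have cb0 := gt_eqF (cos_gtN1 bpi).
have c0 : 1 + cosh u != 0 by rewrite gt_eqF// addr_gt0// cosh_gt0.
have := der_tb bpi => hb.
notypeclasses refine (der_eq _ _); first by rewrite /arg1; der.
by rewrite arg1_den// /tu; field; rewrite ?d0 ?cb0 ?c0.
Qed.

Let der_pw_u u b : `|b| < pi -> is_derive u 1 (pw ^~ b) (Pu u b).
Proof.
move=> bpi; have d0 := den_gt0 u bpi; have h := der_arg1_u u bpi.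
notypeclasses refine (der_eq _ _); first by rewrite /pw /den; der.
by rewrite /Pu /den; field; rewrite gt_eqF.
Qed.

Let der_qw_u u b : `|b| < pi -> is_derive u 1 (qw ^~ b) (Qu u b).
Proof.
move=> bpi; have d0 := den_gt0 u bpi; have h := der_arg1_u u bpi.
notypeclasses refine (der_eq _ _); first by rewrite /qw /den; der.
by rewrite /Qu /den; field; rewrite gt_eqF.
Qed.

(** Cauchy-Riemann: differentiating in [b] instead of [u] multiplies [Pu + i Qu] by i. The same
    holds for [qw], [wC] and [wS] below. *)
Let der_pw_b u b : `|b| < pi -> is_derive b 1 (pw u) (- Qu u b).
Proof.
move=> bpi; have d0 := den_gt0 u bpi; have h := der_arg1_b u bpi.
notypeclasses refine (der_eq _ _); first by rewrite /pw /den; der.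
by rewrite /Qu /den; field; rewrite gt_eqF.
Qed.

Let der_qw_b u b : `|b| < pi -> is_derive b 1 (qw u) (Pu u b).
Proof.
move=> bpi; have d0 := den_gt0 u bpi; have h := der_arg1_b u bpi.
notypeclasses refine (der_eq _ _); first by rewrite /qw /den; der.
by rewrite /Pu /den; field; rewrite gt_eqF.
Qed.

Let der_wC_u u b : `|b| < pi -> is_derive u 1 (wC ^~ b) (dC u b).
Proof.
move=> bpi; have hp := der_pw_u u bpi; have hq := der_qw_u u bpi.
notypeclasses refine (der_eq _ _); first by rewrite /wC; der.
by rewrite /dC; ring.
Qed.

Let der_wS_u u b : `|b| < pi -> is_derive u 1 (wS ^~ b) (dS u b).
Proof.
move=> bpi; have hp := der_pw_u u bpi; have hq := der_qw_u u bpi.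
notypeclasses refine (der_eq _ _); first by rewrite /wS; der.
by rewrite /dS; ring.
Qed.

Let der_wC_b u b : `|b| < pi -> is_derive b 1 (wC u) (- dS u b).
Proof.
move=> bpi; have hp := der_pw_b u bpi; have hq := der_qw_b u bpi.
notypeclasses refine (der_eq _ _); first by rewrite /wC; der.
by rewrite /dS; ring.
Qed.

Let der_wS_b u b : `|b| < pi -> is_derive b 1 (wS u) (dC u b).
Proof.
move=> bpi; have hp := der_pw_b u bpi; have hq := der_qw_b u bpi.
notypeclasses refine (der_eq _ _); first by rewrite /wS; der.
by rewrite /dC; ring.
Qed.

(** Uniformity in [b] is what differentiation under the integral sign will need. All four bounds
    rest on den >= k cosh u: the modulus then decays like e^{- sg u}, the argument lies between - pi
    and pi and costs at most e^{|nu| pi}, and the logarithmic derivative stays below (sg + |nu|) /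
    k. *)
Let bounds b0 : 0 <= b0 < pi -> exists M : R, [/\ 0 <= M,
  (forall u b, `|b| <= b0 -> 0 < u -> `|wC u b| <= M * expR (- (sg * u))),
  (forall u b, `|b| <= b0 -> 0 < u -> `|wS u b| <= M * expR (- (sg * u))),
  (forall u b, `|b| <= b0 -> 0 < u -> `|dC u b| <= M * expR (- (sg * u))) &
  (forall u b, `|b| <= b0 -> 0 < u -> `|dS u b| <= M * expR (- (sg * u)))].
Proof.
move=> /andP[b00 b0pi].
(* With cos b >= cos b0 = 2 k - 1 and cosh u >= 1, the difference cosh u + cos b - k cosh u is at
   least k. *)
pose k := (1 + cos b0) / 2.
have k0 : 0 < k by rewrite divr_gt0// cos_gtN1// ger0_norm.
have kc u b : `|b| <= b0 -> k * cosh u <= den u b.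
  move=> bb; have := cos_le_norm bb (ltW b0pi); have := cosh_ge1 u.
  have := cos_le1 b; have := cos_geN1 b.
  rewrite /k /den; move: (cosh u) (cos b) (cos b0) => c x y; nra.
have pwb u b : `|b| <= b0 -> expR (pw u b) <=
    expR (`|nu| * pi - sg * ln (k / 2)) * expR (- (sg * u)).
  move=> bb; have cu := cosh_gt0 u.
  rewrite -expRD ler_expR /pw.
  have D0 : 0 < den u b by rewrite (lt_le_trans _ (kc _ _ bb))// mulr_gt0.
  have h1 : u + ln (k / 2) <= ln (den u b).
    have k20 : 0 < k / 2 by rewrite divr_gt0.
    have -> : u + ln (k / 2) = ln (expR u * (k / 2)).
      by rewrite [in RHS]lnM ?posrE ?expR_gt0// expRK.
    rewrite ler_ln ?posrE ?(mulr_gt0 (expR_gt0 u) k20)//.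
    rewrite (le_trans _ (kc u b bb))// mulrCA ler_pM2l//; exact: cosh_ge_expR.
  have h2 : nu * arg1 u b <= `|nu| * pi.
    rewrite (le_trans (ler_norm _))// normrM ler_wpM2l// /arg1.
    have := atan_gtNpi2 (tu u * tb b); have := atan_ltpi2 (tu u * tb b).
    by rewrite ler_norml; lra.
  have : 0 <= sg * (ln (den u b) - (u + ln (k / 2))) by apply: mulr_ge0; [exact: ltW|rewrite subr_ge0].
  by lra.
pose K := (sg + `|nu|) / k.
have K0 : 0 <= K by apply: divr_ge0; [apply: addr_ge0 => //; exact: ltW|exact: ltW].
have PQ u b (x y : R) : `|b| <= b0 -> `|x| + `|y| <= sg + `|nu| ->
    `|(x * sinh u + y * sin b) / den u b| <= K.
  move=> bb xy; have c1 := cosh_ge1 u; have c0 := cosh_gt0 u.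
  have D0 : 0 < den u b by rewrite (lt_le_trans _ (kc _ _ bb))// mulr_gt0.
  rewrite normrM normfV (gtr0_norm D0) ler_pdivrMr//.
  apply: (@le_trans _ _ ((sg + `|nu|) * cosh u)); last first.
    have sn0 : 0 <= sg + `|nu| by rewrite addr_ge0// ltW.
    rewrite /K -mulrA ler_wpM2l//.
    by rewrite ler_pdivlMl// kc.
  rewrite (le_trans (ler_normD _ _))// (normrM x) (normrM y).
  rewrite (@le_trans _ _ ((`|x| + `|y|) * cosh u))//; last by rewrite ler_pM2r.
  rewrite mulrDl; apply: lerD; apply: ler_wpM2l => //; first exact: normr_sinh_le.
  by rewrite (le_trans _ c1)// ler_norml sin_geN1 sin_le1.
have PK u b : `|b| <= b0 -> `|Pu u b| <= K.
  by move=> bb; apply: PQ => //; rewrite normrN (gtr0_norm sg0).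
have QK u b : `|b| <= b0 -> `|Qu u b| <= K.
  move=> bb; rewrite /Qu -mulNr; apply: PQ => //.
  by rewrite !normrN (gtr0_norm sg0) addrC.
pose M0 := expR (`|nu| * pi - sg * ln (k / 2)).
have M00 : 0 <= M0 by exact: expR_ge0.
have cs (x : R) : `|cos x| <= 1 by rewrite ler_norml cos_geN1 cos_le1.
have sn (x : R) : `|sin x| <= 1 by rewrite ler_norml sin_geN1 sin_le1.
have mulb u b (t L : R) : `|b| <= b0 -> `|t| <= L -> L <= 1 + 2 * K ->
    `|expR (pw u b) * t| <= M0 * (1 + 2 * K) * expR (- (sg * u)).
  move=> bb tL LK; rewrite normrM ger0_norm ?expR_ge0// mulrAC.
  by apply: ler_pM; rewrite ?expR_ge0 ?(le_trans tL)//; exact: pwb.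
have lin (p q x y : R) : `|p| <= K -> `|q| <= K -> `|x| <= 1 -> `|y| <= 1 ->
    `|p * x + q * y| <= 1 + 2 * K.
  move=> pK qK x1 y1; rewrite (le_trans (ler_normD _ _))// !normrM.
  have h1 : `|p| * `|x| <= K * 1 by exact: ler_pM.
  have h2 : `|q| * `|y| <= K * 1 by exact: ler_pM.
  lra.
exists (M0 * (1 + 2 * K)); split.
- by rewrite mulr_ge0// addr_ge0// mulr_ge0.
- by move=> u b bb u0; apply: (mulb _ _ _ 1) => //; lra.
- by move=> u b bb u0; apply: (mulb _ _ _ 1) => //; lra.
- move=> u b bb u0; apply: (mulb _ _ _ _ bb _ (lexx _)).
  by rewrite -mulNr; apply: lin; rewrite ?normrN//; [exact: PK|exact: QK].
- move=> u b bb u0; apply: (mulb _ _ _ _ bb _ (lexx _)).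
  by apply: lin => //; [exact: PK|exact: QK].
Qed.

(* The transforms of [A] and [B] satisfy [IA' = tau IB] and [IB' = tau IA] in
   [b], with [IB 0 = 0]: this is the shift of the contour. *)
Let A u b := (wC u b + wC u (- b)) / 2.
Let B u b := (wS u (- b) - wS u b) / 2.
Let A' u b := (dC u b + dC u (- b)) / 2.
Let B' u b := (dS u (- b) - dS u b) / 2.

Let der_A_u u b : `|b| < pi -> is_derive u 1 (A ^~ b) (A' u b).
Proof.
move=> bpi; have h1 := der_wC_u u bpi.
have h2 : is_derive u 1 (wC ^~ (- b)) (dC u (- b)) by apply: der_wC_u; rewrite normrN.
notypeclasses refine (der_eq _ _); first by rewrite /A; der.
by rewrite /A'; ring.
Qed.

Let der_B_u u b : `|b| < pi -> is_derive u 1 (B ^~ b) (B' u b).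
Proof.
move=> bpi; have h1 := der_wS_u u bpi.
have h2 : is_derive u 1 (wS ^~ (- b)) (dS u (- b)) by apply: der_wS_u; rewrite normrN.
notypeclasses refine (der_eq _ _); first by rewrite /B; der.
by rewrite /B'; ring.
Qed.

Let der_A_b u b : `|b| < pi -> is_derive b 1 (A u) (B' u b).
Proof.
move=> bpi; have h1 := der_wC_b u bpi.
have h2 : is_derive (- b) 1 (wC u) (- dS u (- b)) by apply: der_wC_b; rewrite normrN.
have h3 : is_derive b 1 (fun y => wC u (- y)) (- dS u (- b) * - 1).
  exact: der_comp h2 (derN (der_id b)).
notypeclasses refine (der_eq _ _); first by rewrite /A; der.
by rewrite /B'; ring.
Qed.

Let der_B_b u b : `|b| < pi -> is_derive b 1 (B u) (- A' u b).
Proof.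
move=> bpi; have h1 := der_wS_b u bpi.
have h2 : is_derive (- b) 1 (wS u) (dC u (- b)) by apply: der_wS_b; rewrite normrN.
have h3 : is_derive b 1 (fun y => wS u (- y)) (dC u (- b) * - 1).
  exact: der_comp h2 (derN (der_id b)).
notypeclasses refine (der_eq _ _); first by rewrite /B; der.
by rewrite /A'; ring.
Qed.

Let arg1_0b b : arg1 0 b = 0.
Proof. by rewrite /arg1 /tu sinh0 !mul0r atan0 mulr0. Qed.

Let arg1_u0 u : arg1 u 0 = 0.
Proof. by rewrite /arg1 /tb sin0 mul0r mulr0 atan0 mulr0. Qed.

Let B_0b b : B 0 b = 0.
Proof. by rewrite /B /wS /pw /qw !arg1_0b /den cosN subrr mul0r. Qed.

Let B_u0 u : B u 0 = 0.
Proof. by rewrite /B oppr0 subrr mul0r. Qed.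

Let boundsAB b0 : 0 <= b0 < pi -> exists M : R, [/\ 0 <= M,
  (forall u b, `|b| <= b0 -> 0 < u -> `|A u b| <= M * expR (- (sg * u))),
  (forall u b, `|b| <= b0 -> 0 < u -> `|B u b| <= M * expR (- (sg * u))),
  (forall u b, `|b| <= b0 -> 0 < u -> `|A' u b| <= M * expR (- (sg * u))) &
  (forall u b, `|b| <= b0 -> 0 < u -> `|B' u b| <= M * expR (- (sg * u)))].
Proof.
move=> /bounds[M [M0 h1 h2 h3 h4]].
have half (x y m : R) : `|x| <= m -> `|y| <= m -> `|(x + y) / 2| <= m.
  move=> xm ym; rewrite normrM (gtr0_norm (_ : 0 < 2^-1))//.
  rewrite ler_pdivrMr// (le_trans (ler_normD _ _))//; lra.
by exists M; split=> // u b bb u0; apply: half; rewrite ?normrN; auto;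
  (apply: h1 || apply: h2 || apply: h3 || apply: h4); rewrite ?normrN.
Qed.

Let ItgE (f : R -> R) M : (forall u, 0 < u -> {for u, continuous f}) ->
  (forall u, 0 < u -> `|f u| <= M * expR (- (sg * u))) -> Itg f.
Proof.
move=> cf fM; apply: (@Itg_le _ _ (fun u => M * expR (- (sg * u)))) => //.
  exact: continuous_pmeas.
apply: ItgZ; apply: eq_Itg (Itg_gamma ltr01 sg0) => u _.
by rewrite subrr mul0r add0r.
Qed.

(** These second derivatives serve only to show that the first ones are continuous, so their values
    stay existential. *)
Let exder_dC u b : `|b| < pi -> exists d, is_derive u 1 (dC ^~ b) d.
Proof.
move=> bpi; have hp := der_pw_u u bpi; have hq := der_qw_u u bpi.
by eexists; rewrite /dC /Pu /Qu /den; der; rewrite gt_eqF// den_gt0.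
Qed.

Let exder_dS u b : `|b| < pi -> exists d, is_derive u 1 (dS ^~ b) d.
Proof.
move=> bpi; have hp := der_pw_u u bpi; have hq := der_qw_u u bpi.
by eexists; rewrite /dS /Pu /Qu /den; der; rewrite gt_eqF// den_gt0.
Qed.

Let exder_A' u b : `|b| < pi -> exists d, is_derive u 1 (A' ^~ b) d.
Proof.
move=> bpi; have [d1 h1] := exder_dC u bpi.
have [d2 h2] : exists d, is_derive u 1 (dC ^~ (- b)) d by apply: exder_dC; rewrite normrN.
by eexists; rewrite /A'; der.
Qed.

Let exder_B' u b : `|b| < pi -> exists d, is_derive u 1 (B' ^~ b) d.
Proof.
move=> bpi; have [d1 h1] := exder_dS u bpi.
have [d2 h2] : exists d, is_derive u 1 (dS ^~ (- b)) d by apply: exder_dS; rewrite normrN.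
by eexists; rewrite /B'; der.
Qed.

Let cs1 (x : R) : `|cos x| <= 1. Proof. by rewrite ler_norml cos_geN1 cos_le1. Qed.
Let sn1 (x : R) : `|sin x| <= 1. Proof. by rewrite ler_norml sin_geN1 sin_le1. Qed.

Let mul1_le (t x m : R) : `|t| <= 1 -> `|x| <= m -> `|t * x| <= m.
Proof. by move=> t1 xm; rewrite normrM -[leRHS]mul1r; exact: ler_pM. Qed.

Let bd b : `|b| < pi -> exists M : R, [/\ 0 <= M,
  (forall u, 0 < u -> `|A u b| <= M * expR (- (sg * u))),
  (forall u, 0 < u -> `|B u b| <= M * expR (- (sg * u))),
  (forall u, 0 < u -> `|A' u b| <= M * expR (- (sg * u))) &
  (forall u, 0 < u -> `|B' u b| <= M * expR (- (sg * u)))].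
Proof.
move=> bpi; have [|M [M0 h1 h2 h3 h4]] := @boundsAB `|b|; first by rewrite normr_ge0.
by exists M; split=> // u; [exact: h1|exact: h2|exact: h3|exact: h4].
Qed.

Section fixed_tau.
Variable tau : R.

Let ItgcA b : `|b| < pi -> Itg (fun u => cos (tau * u) * A u b).
Proof.
move=> bpi; have [M [_ hA _ _ _]] := bd bpi; apply: (ItgE (M := M)) => u u0.
  by have h := der_A_u u bpi; cont.
by apply: mul1_le => //; exact: hA.
Qed.

Let ItgsB b : `|b| < pi -> Itg (fun u => sin (tau * u) * B u b).
Proof.
move=> bpi; have [M [_ _ hB _ _]] := bd bpi; apply: (ItgE (M := M)) => u u0.
  by have h := der_B_u u bpi; cont.
by apply: mul1_le => //; exact: hB.
Qed.

Let ItgcB' b : `|b| < pi -> Itg (fun u => cos (tau * u) * B' u b).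
Proof.
move=> bpi; have [M [_ _ _ _ hB]] := bd bpi; apply: (ItgE (M := M)) => u u0.
  by have [d h] := exder_B' u bpi; cont.
by apply: mul1_le => //; exact: hB.
Qed.

Let ItgsA' b : `|b| < pi -> Itg (fun u => sin (tau * u) * A' u b).
Proof.
move=> bpi; have [M [_ _ _ hA _]] := bd bpi; apply: (ItgE (M := M)) => u u0.
  by have [d h] := exder_A' u bpi; cont.
by apply: mul1_le => //; exact: hA.
Qed.

Let IA b := ip (fun u => cos (tau * u) * A u b).
Let IB b := ip (fun u => sin (tau * u) * B u b).

(** Integration by parts. The boundary term decays at infinity; at 0 it vanishes by [B_0b], and in
    the companion [byparts_sA] because of the factor sin. *)
Let byparts_cB b : `|b| < pi -> ip (fun u => cos (tau * u) * B' u b) = tau * IB b.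
Proof.
move=> bpi; have [M [_ _ hB _ _]] := bd bpi.
have i1 := ItgcB' bpi; have i2 := ItgZ tau (ItgsB bpi).
apply/eqP; rewrite -subr_eq0 -(ipZ tau (ItgsB bpi)) -(ipB i1 i2).
apply/eqP; transitivity (0 - 0 : R); last by rewrite subrr.
notypeclasses refine (@ip_FTC _ _ (fun u => cos (tau * u) * B u b) 0 0 _ _ _ _ _).
- by move=> u u0; have [d h] := exder_B' u bpi; have h' := der_B_u u bpi; cont.
- move=> u u0; have h := der_B_u u bpi; notypeclasses refine (der_eq _ _); first by der.
  by cbv beta; ring.
- exact: ItgB.
- have -> : 0 = cos (tau * 0) * B 0 b by rewrite B_0b mulr0.
  apply: (@cvg_at0 _ (fun u => cos (tau * u) * B u b)).
  by have h := der_B_u 0 bpi; cont.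
- apply: (@cvg_expRN _ sg M (fun u => cos (tau * u) * B u b)) => // u u0.
  by apply: mul1_le => //; exact: hB.
Qed.

Let byparts_sA b : `|b| < pi -> ip (fun u => sin (tau * u) * A' u b) = - (tau * IA b).
Proof.
move=> bpi; have [M [_ hA _ _ _]] := bd bpi.
have i1 := ItgsA' bpi; have i2 := ItgZ tau (ItgcA bpi).
apply/eqP; rewrite -addr_eq0 -(ipZ tau (ItgcA bpi)) -(ipD i1 i2).
apply/eqP; transitivity (0 - 0 : R); last by rewrite subrr.
notypeclasses refine (@ip_FTC _ _ (fun u => sin (tau * u) * A u b) 0 0 _ _ _ _ _).
- by move=> u u0; have [d h] := exder_A' u bpi; have h' := der_A_u u bpi; cont.
- move=> u u0; have h := der_A_u u bpi; notypeclasses refine (der_eq _ _); first by der.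
  by cbv beta; ring.
- exact: ItgD.
- have -> : 0 = sin (tau * 0) * A 0 b by rewrite mulr0 sin0 mul0r.
  apply: (@cvg_at0 _ (fun u => sin (tau * u) * A u b)).
  by have h := der_A_u 0 bpi; cont.
- apply: (@cvg_expRN _ sg M (fun u => sin (tau * u) * A u b)) => // u u0.
  by apply: mul1_le => //; exact: hA.
Qed.

(** Differentiating at [b] requires one majorant on a whole neighbourhood, hence a slightly larger
    strip that is still inside |b| < pi. *)
Let mid b : `|b| < pi -> exists2 b0 : R, 0 <= b0 < pi & - b0 < b < b0.
Proof.
move=> bpi; exists ((`|b| + pi) / 2).
  by have := normr_ge0 b; move: (`|b|) bpi => x *; lra.
rewrite -ltr_norml; move: (`|b|) bpi => x *; lra.
Qed.

Let inn b b0 : 0 <= b0 < pi -> - b0 < b < b0 -> `|b| <= b0 /\ `|b| < pi.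
Proof.
move=> /andP[b00 b0pi]; rewrite -ltr_norml => bb; split; first exact: ltW.
exact: lt_trans bb b0pi.
Qed.

Let der_IA b : `|b| < pi -> is_derive b 1 IA (tau * IB b).
Proof.
move=> bpi; rewrite -byparts_cB//; have [b0 b0pi bb0] := mid bpi.
have [M [M0 h1 h2 h3 h4]] := boundsAB b0pi.
apply: (@is_derive_under_ip _ (fun b u => cos (tau * u) * A u b)
  (fun b u => cos (tau * u) * B' u b) (fun u => M * expR (- (sg * u))) _ _ _ bb0).
- by move=> y /(inn b0pi)[_ ypi]; exact: ItgcA.
- move=> y u /(inn b0pi)[_ ypi] u0; have h := der_A_b u ypi.
  by notypeclasses refine (der_eq _ _); [der|cbv beta; ring].
- apply: ItgE => u u0; first by cont.
  by rewrite ger0_norm// mulr_ge0// expR_ge0.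
- move=> y u /(inn b0pi)[yb0 ypi] u0; apply: mul1_le => //; exact: h4.
Qed.

Let der_IB b : `|b| < pi -> is_derive b 1 IB (tau * IA b).
Proof.
move=> bpi; rewrite -[_ * _]opprK -byparts_sA//; have [b0 b0pi bb0] := mid bpi.
have [M [M0 h1 h2 h3 h4]] := boundsAB b0pi.
rewrite -mulN1r -(ipZ _ (ItgsA' bpi)).
apply: (@is_derive_under_ip _ (fun b u => sin (tau * u) * B u b)
  (fun b u => -1 * (sin (tau * u) * A' u b)) (fun u => M * expR (- (sg * u))) _ _ _ bb0).
- by move=> y /(inn b0pi)[_ ypi]; exact: ItgsB.
- move=> y u /(inn b0pi)[_ ypi] u0; have h := der_B_b u ypi.
  by notypeclasses refine (der_eq _ _); [der|cbv beta; ring].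
- apply: ItgE => u u0; first by cont.
  by rewrite ger0_norm// mulr_ge0// expR_ge0.
- move=> y u /(inn b0pi)[yb0 ypi] u0; rewrite mulN1r normrN; apply: mul1_le => //; exact: h3.
Qed.

(** [E1] and [E2] are the two first integrals of the system IA' = tau IB, IB' = tau IA. Evaluating
    them at 0, where [IB] vanishes, and eliminating [IB b] through cosh^2 - sinh^2 = 1 gives
    [IA b]. *)
Local Lemma contour_shift b : 0 <= b < pi ->
  ip (fun u => cos (tau * u) * A u b) =
  cosh (tau * b) * ip (fun u => cos (tau * u) * A u 0).
Proof.
rewrite -/(IA b) -/(IA 0); move=> /andP[b0 bpi].
have xpi x : 0 <= x <= b -> `|x| < pi.
  by move=> /andP[x0 xb]; rewrite ger0_norm// (le_lt_trans xb).
have E1 : cosh (tau * 0) * IA 0 - sinh (tau * 0) * IB 0 =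
    cosh (tau * b) * IA b - sinh (tau * b) * IB b.
  notypeclasses refine (@der0_cst _ (fun b => cosh (tau * b) * IA b - sinh (tau * b) * IB b) 0 b b0 _) => x /xpi xp.
  have hA := der_IA xp; have hB := der_IB xp.
  by notypeclasses refine (der_eq _ _); [der|cbv beta; ring].
have E2 : cosh (tau * 0) * IB 0 - sinh (tau * 0) * IA 0 =
    cosh (tau * b) * IB b - sinh (tau * b) * IA b.
  notypeclasses refine (@der0_cst _ (fun b => cosh (tau * b) * IB b - sinh (tau * b) * IA b) 0 b b0 _) => x /xpi xp.
  have hA := der_IA xp; have hB := der_IB xp.
  by notypeclasses refine (der_eq _ _); [der|cbv beta; ring].
have IB0 : IB 0 = 0.
  rewrite /IB (@eq_ip _ _ (fun=> 0)); last by move=> x _; rewrite B_u0 mulr0.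
  by rewrite /ip /Rintegral integral0.
move: E1 E2; rewrite IB0 !mulr0 cosh0 sinh0 !mul1r !mul0r !subr0 => E1 E2.
have := cosh2_sinh2 (tau * b); move: E1 E2.
move: (cosh _) (sinh _) (IA b) (IB b) (IA 0) => c s x y z -> h.
rewrite mulrBr !mulrA => e; rewrite (_ : c * s * y = s * (c * y)); last by ring.
have -> : c * y = s * x by lra.
by rewrite mulrA -mulrBl -!expr2 e mul1r.
Qed.
End fixed_tau.

Let A_u0 u : A u 0 = cpowr sg nu th (1 + cosh u).
Proof.
have e (x : R) : (x + x) / 2 = x by field.
rewrite /A oppr0 e /wC /pw /qw arg1_u0 /den cos0.
by rewrite !mulr0 addr0 subr0 /cpowr (addrC (cosh u)); congr (_ * cos _); ring.
Qed.

Let A_0b b : A 0 b = cpowr sg nu th (1 + cos b).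
Proof.
have e (x : R) : (x + x) / 2 = x by field.
rewrite /A /wC /pw /qw !arg1_0b /den cosN cosh0 e.
by rewrite !mulr0 addr0 subr0 /cpowr; congr (_ * cos _); ring.
Qed.

Let cosh_hfun tau b : 0 <= b < pi ->
  cosh (tau * b) * hfun sg nu th tau = ip (fun u => cos (tau * u) * A u b).
Proof.
move=> bpi; rewrite contour_shift//; congr (_ * _); apply: eq_ip => u _.
by rewrite A_u0.
Qed.

Lemma hfun_decay b : 0 <= b < pi -> exists2 C : R, 0 <= C &
  forall tau, `|hfun sg nu th tau| <= C * expR (- (b * tau)).
Proof.
move=> bpi; have bpi' : `|b| < pi by have /andP[? ?] := bpi; rewrite ger0_norm.
have [M [M0 hA _ _ _]] := bd bpi'.
have intM : Itg (fun u => M * expR (- (sg * u))).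
  by apply: ItgE => u u0; [cont|rewrite ger0_norm// mulr_ge0// expR_ge0].
exists (2 * ip (fun u => M * expR (- (sg * u)))).
  by rewrite mulr_ge0// ip_ge0// => u _; rewrite mulr_ge0// expR_ge0.
move=> tau; have := cosh_hfun tau bpi => /(congr1 Num.norm).
have h1 : Itg (fun u => cos (tau * u) * A u b).
  apply: (ItgE (M := M)) => u u0; first by have h := der_A_u u bpi'; cont.
  by apply: mul1_le => //; exact: hA.
have h2 : `|ip (fun u => cos (tau * u) * A u b)| <= ip (fun u => M * expR (- (sg * u))).
  by apply: ip_norm => // u u0; apply: mul1_le => //; exact: hA.
rewrite normrM (gtr0_norm (cosh_gt0 _)) => E; move: h2; rewrite -E => h2.
have h3 : expR (tau * b) / 2 * `|hfun sg nu th tau| <=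
    cosh (tau * b) * `|hfun sg nu th tau|.
  by rewrite ler_wpM2r// cosh_ge_expR.
rewrite expRN ler_pdivlMr ?expR_gt0// (mulrC b); lra.
Qed.

(** * Fourier inversion at 0 *)

Let poisson_kernel (eps u : R) : 0 < eps ->
  ip (fun tau => expR (- (eps * tau)) * cos (tau * u)) = eps / (eps ^+ 2 + u ^+ 2).
Proof.
move=> e0; have D0 : 0 < eps ^+ 2 + u ^+ 2.
  by rewrite ltr_pwDl ?exprn_gt0 ?sqr_ge0.
have DN : eps ^+ 2 + u ^+ 2 != 0 by rewrite gt_eqF.
pose F t := expR (- (eps * t)) * (u * sin (t * u) - eps * cos (t * u)) / (eps ^+ 2 + u ^+ 2).
transitivity (0 - (- (eps / (eps ^+ 2 + u ^+ 2)))); last by rewrite sub0r opprK.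
notypeclasses refine (@ip_FTC _ _ F _ _ _ _ _ _ _).
- by move=> t t0; cont.
- move=> t t0; rewrite /F; notypeclasses refine (der_eq _ _); first by der.
  by cbv beta; field.
- apply: (@Itg_le _ _ (fun t => expR (- (eps * t)))).
  + by apply: continuous_pmeas => t t0; cont.
  + by move=> t t0; rewrite normrM ger0_norm ?expR_ge0// ler_piMr ?expR_ge0.
  + apply: eq_Itg (Itg_gamma ltr01 e0) => t _.
    by rewrite subrr mul0r add0r.
- have -> : - (eps / (eps ^+ 2 + u ^+ 2)) = F 0.
    by rewrite /F mulr0 oppr0 expR0 mul0r sin0 cos0; field.
  by apply: cvg_at0; rewrite /F; cont.
- apply: (@cvg_expRN _ eps ((`|u| + eps) / (eps ^+ 2 + u ^+ 2))) => // t t0.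
  have h : `|u * sin (t * u) - eps * cos (t * u)| <= `|u| + eps.
    rewrite (le_trans (ler_normB _ _))// !normrM (gtr0_norm e0).
    by rewrite lerD// ler_piMr// ltW.
  rewrite /F normrM normrM (ger0_norm (expR_ge0 _)) normfV (gtr0_norm D0).
  by rewrite -mulrA mulrC ler_wpM2r ?expR_ge0// ler_wpM2r// invr_ge0 ltW.
Qed.

Let measurable_A b : `|b| < pi -> measurable_fun setT (A ^~ b).
Proof.
move=> bpi; apply: continuous_measurable_fun => u.
by have h := der_A_u u bpi; cont.
Qed.

Let der_atan1 (v : R) : is_derive v 1 (@atan R) (1 + v ^+ 2)^-1.
Proof. exact: is_derive1_atan. Qed.

Let continuous_cauchy (v : R) : {for v, continuous (fun v : R => (1 + v ^+ 2)^-1)}.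
Proof. by cont; rewrite gt_eqF// ltr_pwDl ?sqr_ge0. Qed.

Let Itg_cauchy : Itg (fun v : R => (1 + v ^+ 2)^-1).
Proof.
apply: (@Itg_FTC _ _ (@atan R) pi) => // v v0.
  by rewrite invr_ge0 addr_ge0// sqr_ge0.
have := atan_gtNpi2 v; have := atan_ltpi2 v; have := pi_ge0 R.
by rewrite ler_norml; move=> *; lra.
Qed.

Let ip_cauchy : ip (fun v : R => (1 + v ^+ 2)^-1) = pi / 2.
Proof.
transitivity (pi / 2 - 0 : R); last by rewrite subr0.
notypeclasses refine (@ip_FTC _ _ (@atan R) _ _ _ _ _ _ _) => //.
- by rewrite -[X in _ --> X]atan0; apply: cvg_at0; exact: continuous_atan.
- have h2 : (n.+2%:R : R) @[n --> \oo] --> +oo.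
    apply/cvgryPge => M; near=> n; apply: (@le_trans _ _ n%:R).
      by near: n; exact: nbhs_infty_ger.
    by rewrite ler_nat -addn2 leq_addr.
  exact: (cvg_comp _ _ h2 (@cvgy_atan R)).
Unshelve. all: end_near. Qed.

(** The factor e^{- eps tau} makes Fubini available; the inner integral is then the Poisson kernel,
    and the substitution u = eps v moves all dependence on [eps] from the kernel into the argument
    of [A]. *)
Let regularized b eps : 0 <= b < pi -> 0 < eps ->
  ip (fun tau => expR (- (eps * tau)) * (cosh (tau * b) * hfun sg nu th tau)) =
  ip (fun v => A (eps * v) b * (1 + v ^+ 2)^-1).
Proof.
move=> bpi e0; have bpi' : `|b| < pi by have /andP[? ?] := bpi; rewrite ger0_norm.
have [M [M0 hA _ _ _]] := bd bpi'.
have intA : Itg (fun u => M * expR (- (sg * u))).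
  by apply: ItgE => u u0; [cont|rewrite ger0_norm// mulr_ge0// expR_ge0].
have intE : Itg (fun tau => expR (- (eps * tau))).
  by apply: eq_Itg (Itg_gamma ltr01 e0) => t _; rewrite subrr mul0r add0r.
have intcA tau : Itg (fun u => cos (tau * u) * A u b).
  apply: (ItgE (M := M)) => u u0; first by have h := der_A_u u bpi'; cont.
  by apply: mul1_le => //; exact: hA.
have mA := measurable_A bpi'.
transitivity (ip (fun tau => ip (fun u => expR (- (eps * tau)) * (cos (tau * u) * A u b)))).
  by apply: eq_ip => tau _; rewrite cosh_hfun// ipZ.
rewrite (@ip_fubini _ (fun tau u => expR (- (eps * tau)) * (cos (tau * u) * A u b))
  _ _ _ intE intA); last 2 first.
- meas; exact: (mf_comp mA measurable_snd).
- move=> tau u tau0 u0; rewrite normrM ger0_norm ?expR_ge0// ler_wpM2l ?expR_ge0//.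
  by apply: mul1_le => //; exact: hA.
have intK u : Itg (fun tau => expR (- (eps * tau)) * cos (tau * u)).
  apply: (@Itg_le _ _ (fun tau => expR (- (eps * tau)))) => //.
    by apply: continuous_pmeas => t t0; cont.
  by move=> t t0; rewrite normrM ger0_norm ?expR_ge0// ler_piMr ?expR_ge0.
have D0 (u : R) : 0 < eps ^+ 2 + u ^+ 2 by rewrite ltr_pwDl ?exprn_gt0 ?sqr_ge0.
pose f u := A u b * (eps / (eps ^+ 2 + u ^+ 2)).
transitivity (ip f).
  apply: eq_ip => u _; rewrite /f -poisson_kernel// -ipZ//.
  by apply: eq_ip => tau _; ring.
have intf : Itg f.
  apply: (@Itg_le _ _ (fun u => eps^-1 * (M * expR (- (sg * u))))); last exact: ItgZ.
    apply: continuous_pmeas => u u0; have h := der_A_u u bpi'; rewrite /f; cont.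
    by rewrite gt_eqF.
  move=> u u0; rewrite /f normrM mulrC; apply: ler_pM => //; last exact: hA.
  rewrite ger0_norm ?divr_ge0 ?(ltW e0) ?(ltW (D0 u))// ler_pdivrMr//.
  by rewrite mulrDr expr2 mulrA mulVf ?gt_eqF// mul1r lerDl mulr_ge0 ?invr_ge0 ?sqr_ge0 ?ltW.
have [intfe E] := Itg_scale e0 intf.
have -> : ip f = eps * ip (fun x => f (eps * x)).
  by rewrite E mulrA mulfV ?gt_eqF// mul1r.
rewrite -ipZ//; apply: eq_ip => v v0; rewrite /f.
have : 1 + v ^+ 2 != 0 by rewrite gt_eqF// ltr_pwDl ?sqr_ge0.
move: (D0 (eps * v)) e0 => /gt_eqF h1 /gt_eqF h2 h3.
rewrite exprMn in h1 *; have -> : eps ^+ 2 + eps ^+ 2 * v ^+ 2 = eps ^+ 2 * (1 + v ^+ 2) by ring.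
by field; rewrite h2 h3.
Qed.

Lemma hfun_base b : 0 <= b < pi ->
  Itg (fun tau => cosh (b * tau) * hfun sg nu th tau) /\
  ip (fun tau => cosh (b * tau) * hfun sg nu th tau) =
  pi / 2 * cpowr sg nu th (1 + cos b).
Proof.
move=> bpi; have bpi' : `|b| < pi by have /andP[? ?] := bpi; rewrite ger0_norm.
have [M [M0 hA _ _ _]] := bd bpi'.
(* A rate strictly between [b] and pi: the decay e^{- g tau} of the transform beats cosh (b tau). *)
pose g := (b + pi) / 2.
have gpi : 0 <= g < pi by rewrite /g; move: bpi => /andP[? ?]; apply/andP; split; lra.
have gb : 0 < g - b by rewrite /g; move: bpi => /andP[? ?]; lra.
have [C C0 hC] := hfun_decay gpi.
have intE : Itg (fun tau => C * expR (- ((g - b) * tau))).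
  apply: ItgZ; apply: eq_Itg (Itg_gamma ltr01 gb) => t _.
  by rewrite subrr mul0r add0r.
have dom tau : 0 < tau ->
    `|cosh (b * tau) * hfun sg nu th tau| <= C * expR (- ((g - b) * tau)).
  move=> t0; rewrite normrM (gtr0_norm (cosh_gt0 _)).
  have h1 : cosh (b * tau) <= expR (b * tau).
    rewrite /cosh; have : expR (- (b * tau)) <= expR (b * tau).
      rewrite ler_expR ge0_cp// mulr_ge0 ?(ltW t0)//; by case/andP: bpi.
    by lra.
  rewrite (le_trans (ler_pM _ _ h1 (hC tau)))//; first exact: ltW (cosh_gt0 _).
  by rewrite mulrCA -expRD ler_wpM2l// ler_expR; lra.
have mh : pmeas (fun tau => cosh (b * tau) * hfun sg nu th tau).
  by apply: pmeasW; have mh := measurable_hfun sg nu th; meas.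
have int1 : Itg (fun tau => cosh (b * tau) * hfun sg nu th tau).
  exact: (@Itg_le _ _ _ mh dom).
split=> //; pose e n : R := n.+2%:R^-1.
have e0 n : 0 < e n by rewrite invr_gt0.
have [_ L1] : Itg (fun tau => cosh (b * tau) * hfun sg nu th tau) /\
    ip (fun tau => expR (- (e n * tau)) * (cosh (b * tau) * hfun sg nu th tau)) @[n --> \oo]
    --> ip (fun tau => cosh (b * tau) * hfun sg nu th tau).
  apply: (dominated_ip _ _ intE) => [n|tau t0|n tau t0].
  - by apply: pmeasM => //; apply: continuous_pmeas => t t0; cont.
  - rewrite -[X in _ --> X]mul1r; apply: cvgMl.
    have -> : 1 = expR (- (0 * tau)) by rewrite mul0r oppr0 expR0.
    by apply: (@cvg_at0 _ (fun e => expR (- (e * tau)))); cont.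
  - rewrite normrM ger0_norm ?expR_ge0//; apply: le_trans (dom _ t0).
    rewrite ler_piMl// -expR0 ler_expR oppr_le0 mulr_ge0// ltW//.
(* As the regularization vanishes, [A (eps v) b] tends to its value at u = 0, which [A_0b]
   identifies; the Cauchy kernel contributes the factor pi / 2. *)
have [_ L2] : Itg (fun v => A 0 b * (1 + v ^+ 2)^-1) /\
    ip (fun v => A (e n * v) b * (1 + v ^+ 2)^-1) @[n --> \oo]
    --> ip (fun v => A 0 b * (1 + v ^+ 2)^-1).
  apply: (@dominated_ip _ _ _ (fun v => M * (1 + v ^+ 2)^-1)) => [n|v v0||n v v0].
  - apply: continuous_pmeas => v v0.
    have h : is_derive (e n * v) 1 (A ^~ b) (A' (e n * v) b) by exact: der_A_u.
    have h2 : is_derive v 1 (fun v => e n * v) (e n).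
      by notypeclasses refine (der_eq (derZ (e n) (der_id v)) _); rewrite mulr1.
    have h3 := @der_comp _ (A ^~ b) (fun v => e n * v) v _ _ h h2.
    by cont; rewrite gt_eqF// ltr_pwDl ?sqr_ge0.
  - apply: cvgMl.
    have -> : A 0 b = A (0 * v) b by rewrite mul0r.
    apply: (@cvg_at0 _ (fun e => A (e * v) b)).
    have h : is_derive (0 * v) 1 (A ^~ b) (A' (0 * v) b) by exact: der_A_u.
    have h2 : is_derive (0 : R) 1 (fun e => e * v) v.
      notypeclasses refine (der_eq (derM (der_id 0) (der_cst v 0)) _).
      by rewrite mul1r mulr0 addr0.
    exact: (der_continuous (@der_comp _ (A ^~ b) (fun e => e * v) 0 _ _ h h2)).
  - exact: ItgZ.
  - rewrite normrM [X in _ * X]ger0_norm; last by rewrite invr_ge0 addr_ge0// sqr_ge0.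
    rewrite ler_wpM2r ?invr_ge0 ?addr_ge0 ?sqr_ge0//.
    have ev : 0 < e n * v by rewrite mulr_gt0.
    rewrite (le_trans (hA _ ev))// ler_piMr// -expR0 ler_expR oppr_le0.
    by rewrite mulr_ge0// ltW.
rewrite -A_0b mulrC -ip_cauchy -ipZ//.
apply: (cvg_unique _ L1) => //.
rewrite (_ : (fun n => _) = (fun n => ip (fun v => A (e n * v) b * (1 + v ^+ 2)^-1))) //.
apply/funext => n; rewrite -(regularized bpi (e0 n)); apply: eq_ip => tau _.
by rewrite (mulrC tau).
Qed.

End contour.

(** * The weighted Mellin transform of the Macdonald function *)

(** The real part of e^{i th} x^{s-1} e^{-x}, with s = sg + i nu. *)
Definition mweight (R : realType) (sg nu th x : R) : R :=
  expR ((sg - 1) * ln x - x) * cos (nu * ln x + th).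

Lemma measurable_mweight (R : realType) (sg nu th : R) :
  measurable_fun setT (mweight sg nu th).
Proof. by rewrite /mweight; meas. Qed.

Lemma normr_mweight (R : realType) (sg nu th x : R) :
  `|mweight sg nu th x| <= expR ((sg - 1) * ln x - x).
Proof.
rewrite normrM ger0_norm ?expR_ge0// ler_piMr ?expR_ge0//.
by rewrite ler_norml cos_geN1 cos_le1.
Qed.

Lemma Itg_expRN (R : realType) (c : R) : 0 < c -> Itg (fun x => expR (- (c * x))).
Proof. by move=> c0; apply: eq_Itg (Itg_gamma ltr01 c0) => t _; rewrite subrr mul0r add0r. Qed.

Lemma Itg_mexp (R : realType) (sg nu th c : R) : 0 < sg -> 0 < c ->
  Itg (fun x => expR ((sg - 1) * ln x - c * x) * cos (nu * ln x + th)).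
Proof.
move=> sg0 c0; apply: (Itg_le _ _ (Itg_gamma sg0 c0)).
  by apply: pmeasW; meas.
move=> x x0; rewrite normrM ger0_norm ?expR_ge0// ler_piMr ?expR_ge0//.
by rewrite ler_norml cos_geN1 cos_le1.
Qed.

(* [Gamma(s) * c ^ (- s)], [s = sg + i nu], rotated by [th]. *)
Lemma ip_mexp (R : realType) (sg nu th c : R) : 0 < sg -> 0 < c ->
  ip (fun x => expR ((sg - 1) * ln x - c * x) * cos (nu * ln x + th)) =
  ip (mweight sg nu 0) * cpowr sg nu th c +
  ip (mweight sg nu (- (pi / 2))) * cpowr sg nu (th + pi / 2) c.
Proof.
move=> sg0 c0.
(* The substitution x -> c x adds nu ln c to the phase; this shift compensates it. *)
pose t := th - nu * ln c.
have int1 r : Itg (mweight sg nu r).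
  apply: eq_Itg (Itg_mexp nu r sg0 ltr01) => x x0; by rewrite mul1r.
have [_ E] := Itg_scale c0 (int1 t).
transitivity (expR (- ((sg - 1) * ln c)) * ip (fun x => mweight sg nu t (c * x))).
  rewrite -ipZ; last by have [] := Itg_scale c0 (int1 t).
  apply: eq_ip => x x0; rewrite /mweight lnM ?posrE// mulrA -expRD.
  by congr (expR _ * cos _); rewrite /t; ring.
rewrite E mulrA.
have -> : expR (- ((sg - 1) * ln c)) / c = expR (- sg * ln c).
  rewrite -{2}(lnK (c0 : c \is Num.pos)) -expRN -expRD; congr expR; ring.
have -> : ip (mweight sg nu t) = cos t * ip (mweight sg nu 0) -
    sin t * ip (mweight sg nu (- (pi / 2))).
  rewrite -!ipZ// -ipB//; [|exact: ItgZ..].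
  have c2 y : cos (y + - (pi / 2)) = sin y :> R.
    by rewrite cosD cosN sinN cos_pihalf sin_pihalf; ring.
  by apply: eq_ip => x _; rewrite /mweight addr0 c2 cosD; ring.
rewrite /cpowr -/t (_ : th + pi / 2 - nu * ln c = t + pi / 2); last by rewrite /t; ring.
rewrite cosD cos_pihalf sin_pihalf; ring.
Qed.

(** [expR_ln_le] at y = x cosh t, with cosh t >= e^t / 2. The free exponent [p] trades a singularity
    x^{-p} at 0 for a decay e^{- p t}; the choice p = sg / 2 will keep x^{sg - 1 - p} integrable at
    0. *)
Lemma expR_cosh_le (R : realType) (p : R) : 0 < p -> exists2 C : R, 0 <= C &
  forall x t, 0 < x -> expR (- x * cosh t) <= C * expR (- (p * ln x)) * expR (- (p * t)).
Proof.
move=> p0; exists (expR (p * ln p + p * ln 2)); first exact: expR_ge0.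
move=> x t x0; have c0 := cosh_gt0 t.
have := expR_ln_le p0 (mulr_gt0 x0 c0).
rewrite -expRD ler_expR lnM ?posrE// => h.
rewrite -!expRD ler_expR.
have h2 : t - ln 2 <= ln (cosh t).
  have -> : t - ln 2 = ln (expR t / 2) by rewrite ln_div ?posrE ?expR_gt0// expRK.
  have e2 : 0 < expR t / 2 by rewrite divr_gt0 ?expR_gt0.
  by rewrite ler_ln ?posrE// cosh_ge_expR.
have : 0 <= p * (ln (cosh t) - (t - ln 2)) by rewrite mulr_ge0 ?subr_ge0// ltW.
by lra.
Qed.

(* [macdonald] over the open half-line. *)
Definition mac (R : realType) (tau x : R) : R :=
  ip (fun t => expR (- x * cosh t) * cos (tau * t)).

Lemma Itg_mac (R : realType) (tau x : R) : 0 < x ->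
  Itg (fun t => expR (- x * cosh t) * cos (tau * t)).
Proof.
move=> x0; have [C C0 hC] := @expR_cosh_le R 1 ltr01.
apply: (@Itg_le _ _ (fun t => C * expR (- (1 * ln x)) * expR (- (1 * t)))).
- by apply: pmeasW; meas.
- move=> t t0; rewrite normrM ger0_norm ?expR_ge0//; apply: le_trans (hC _ _ x0).
  by rewrite ler_piMr ?expR_ge0// ler_norml cos_geN1 cos_le1.
- by apply: ItgZ; exact: Itg_expRN.
Qed.

Lemma macdonaldE (R : realType) (tau x : R) : 0 < x -> macdonald tau x = mac tau x.
Proof.
move=> x0; rewrite /macdonald -Rintegral_itv_obnd_cbnd//; exact: Itg_mac.
Qed.

Lemma measurable_mac (R : realType) : measurable_fun setT
  (fun z : measurableTypeR R * measurableTypeR R => mac z.1 z.2).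
Proof.
apply: (@measurable_ip _ (measurableTypeR R * measurableTypeR R)%type _
  (fun z t => expR (- z.2 * cosh t) * cos (z.1 * t))).
have m1 : measurable_fun setT
    (fun z : measurableTypeR R * measurableTypeR R * measurableTypeR R => z.1.1 : R).
  exact: measurableT_comp.
have m2 : measurable_fun setT
    (fun z : measurableTypeR R * measurableTypeR R * measurableTypeR R => z.1.2 : R).
  exact: measurableT_comp.
by meas.
Qed.

Lemma mac_le (R : realType) (p : R) : 0 < p -> exists2 C : R, 0 <= C &
  forall tau x, 0 < x -> `|mac tau x| <= C * expR (- (p * ln x)).
Proof.
move=> p0; have [C C0 hC] := expR_cosh_le p0.
have intE := Itg_expRN p0.
exists (C * ip (fun t => expR (- (p * t)))).
  by rewrite mulr_ge0// ip_ge0// => t _; exact: expR_ge0.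
move=> tau x x0; rewrite mulrAC -ipZ//.
apply: ip_norm; [exact: Itg_mac|exact: ItgZ|move=> t t0].
rewrite normrM ger0_norm ?expR_ge0//; apply: le_trans (hC _ _ x0).
by rewrite ler_piMr ?expR_ge0// ler_norml cos_geN1 cos_le1.
Qed.

Section mellin_mac.
Variables (R : realType) (sg nu th : R).
Hypothesis sg0 : 0 < sg.

Definition mac_mellin (tau : R) : R := ip (fun x => mac tau x * mweight sg nu th x).

Lemma Itg_mac_mellin (tau : R) : Itg (fun x => mac tau x * mweight sg nu th x).
Proof.
have p0 : 0 < sg / 2 by rewrite divr_gt0.
have [C C0 hC] := mac_le p0.
apply: (@Itg_le _ _ (fun x => C * expR ((sg / 2 - 1) * ln x - 1 * x))).
- apply: pmeasW; have mw := measurable_mweight sg nu th; meas.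
  exact: (measurableT_comp (@measurable_mac R) (@pair1_measurable _ _ _ _ tau)).
- move=> x x0; rewrite normrM.
  have h := ler_pM (normr_ge0 _) (normr_ge0 _) (hC tau _ x0) (normr_mweight sg nu th x).
  by rewrite (le_trans h)// -[leLHS]mulrA -expRD ler_wpM2l// ler_expR; lra.
- apply: ItgZ; exact: Itg_gamma.
Qed.

Lemma measurable_mac_mellin : measurable_fun setT mac_mellin.
Proof.
apply: (@measurable_ip _ (measurableTypeR R) _
  (fun tau x => mac tau x * mweight sg nu th x)).
apply: mfM; first exact: measurable_mac.
by apply: mf_comp => //; exact: measurable_mweight.
Qed.

(** Exchange the integrals in t and x. The inner one, of e^{- x (1 + cosh t)} x^{s-1}, is Gamma(s)
    (1 + cosh t)^{-s} by [ip_mexp]; the two terms are the real part of this complex product. *)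
Lemma mac_mellinE (tau : R) : mac_mellin tau =
  ip (mweight sg nu 0) * hfun sg nu th tau +
  ip (mweight sg nu (- (pi / 2))) * hfun sg nu (th + pi / 2) tau.
Proof.
have p0 : 0 < sg / 2 by rewrite divr_gt0.
have [C C0 hC] := expR_cosh_le p0.
have cs1 (x : R) : `|cos x| <= 1 by rewrite ler_norml cos_geN1 cos_le1.
pose F x t := expR (- x * cosh t) * cos (tau * t) * mweight sg nu th x.
transitivity (ip (fun x => ip (F x))).
  apply: eq_ip => x x0; rewrite mulrC /mac -ipZ; last exact: Itg_mac.
  by apply: eq_ip => t _; rewrite mulrC.
rewrite (@ip_fubini _ F (fun x => C * expR ((sg / 2 - 1) * ln x - 1 * x))
  (fun t => expR (- (sg / 2 * t)))); last 4 first.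
- by rewrite /F /mweight; meas.
- by apply: ItgZ; exact: Itg_gamma.
- exact: Itg_expRN.
- move=> x t x0 t0; rewrite /F normrM normrM (ger0_norm (expR_ge0 _)).
  have h : expR (- x * cosh t) * `|cos (tau * t)| <=
      C * expR (- (sg / 2 * ln x)) * expR (- (sg / 2 * t)).
    by apply: le_trans (hC _ _ x0); rewrite ler_piMr ?expR_ge0.
  have h0 : 0 <= expR (- x * cosh t) * `|cos (tau * t)| by rewrite mulr_ge0// expR_ge0.
  rewrite (le_trans (ler_pM h0 (normr_ge0 _) h (normr_mweight sg nu th x)))//.
  by rewrite -!mulrA ler_wpM2l// -!expRD ler_expR; lra.
have inth r : Itg (fun t => cos (tau * t) * cpowr sg nu r (1 + cosh t)).
  apply: (@Itg_le _ _ (fun t => expR (sg * ln 2) * expR (- (sg * t)))).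
  - by apply: pmeasW; rewrite /cpowr; meas.
  - move=> t t0; rewrite normrM.
    have h : `|cpowr sg nu r (1 + cosh t)| <= expR (sg * ln 2) * expR (- (sg * t)).
      rewrite normrM ger0_norm ?expR_ge0// -expRD.
      rewrite (@le_trans _ _ (expR (- sg * ln (1 + cosh t))))//.
        by rewrite ler_piMr ?expR_ge0.
      have c0 := cosh_gt0 t; rewrite ler_expR.
      have h2 : t - ln 2 <= ln (1 + cosh t).
        have -> : t - ln 2 = ln (expR t / 2) by rewrite ln_div ?posrE ?expR_gt0// expRK.
        have e2 : 0 < expR t / 2 by rewrite divr_gt0 ?expR_gt0.
        have e3 : 0 < 1 + cosh t by rewrite addr_gt0.
        rewrite ler_ln ?posrE//.
        by rewrite (le_trans (cosh_ge_expR _))// lerDr.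
      have : 0 <= sg * (ln (1 + cosh t) - (t - ln 2)) by rewrite mulr_ge0 ?subr_ge0// ltW.
      by lra.
    by rewrite -[leRHS]mul1r; apply: ler_pM.
  - by apply: ItgZ; exact: Itg_expRN.
rewrite /hfun -!ipZ// -ipD//; [|exact: ItgZ..].
apply: eq_ip => t t0.
have c0 : 0 < 1 + cosh t by rewrite addr_gt0// cosh_gt0.
transitivity (cos (tau * t) * (ip (mweight sg nu 0) * cpowr sg nu th (1 + cosh t) +
  ip (mweight sg nu (- (pi / 2))) * cpowr sg nu (th + pi / 2) (1 + cosh t))); last by ring.
rewrite -ip_mexp// -ipZ; last exact: Itg_mexp.
apply: eq_ip => x x0; rewrite /F /mweight.
transitivity (cos (tau * t) * (expR (- x * cosh t) * expR ((sg - 1) * ln x - x)) *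
  cos (nu * ln x + th)); first by ring.
rewrite -expRD -mulrA; congr (_ * (expR _ * _)); ring.
Qed.

Lemma mac_mellin_decay b : 0 <= b < pi -> exists2 C : R, 0 <= C &
  forall tau, `|mac_mellin tau| <= C * expR (- (b * tau)).
Proof.
move=> bpi; have [C1 C10 h1] := hfun_decay nu th sg0 bpi.
have [C2 C20 h2] := hfun_decay nu (th + pi / 2) sg0 bpi.
exists (`|ip (mweight sg nu 0)| * C1 + `|ip (mweight sg nu (- (pi / 2)))| * C2).
  by rewrite addr_ge0// mulr_ge0.
move=> tau; rewrite mac_mellinE (le_trans (ler_normD _ _))// [leRHS]mulrDl.
by apply: lerD; rewrite -[leRHS]mulrA normrM ler_wpM2l.
Qed.

(** [ip_mexp] is read backwards at c = 1 + cos b, where it recombines Gamma(s) c^{-s} into the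
    transform of e^{- x cos b}. *)
Lemma mac_mellin_base b : 0 <= b < pi ->
  ip (fun tau => cosh (b * tau) * mac_mellin tau) =
  pi / 2 * ip (fun x => expR (- (x * cos b)) * mweight sg nu th x).
Proof.
move=> bpi; have [i1 h1] := hfun_base nu th sg0 bpi.
have [i2 h2] := hfun_base nu (th + pi / 2) sg0 bpi.
pose G1 := ip (mweight sg nu 0); pose G2 := ip (mweight sg nu (- (pi / 2))).
transitivity (ip (fun tau => G1 * (cosh (b * tau) * hfun sg nu th tau) +
    G2 * (cosh (b * tau) * hfun sg nu (th + pi / 2) tau))).
  by apply: eq_ip => tau _; rewrite mac_mellinE -/G1 -/G2; ring.
rewrite ipD ?ipZ//; [|exact: ItgZ..].
have cb : 0 < 1 + cos b.
  by have /andP[b0 bpi'] := bpi; apply: cos_gtN1; rewrite ger0_norm.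
rewrite h1 h2.
transitivity (pi / 2 * (G1 * cpowr sg nu th (1 + cos b) +
   G2 * cpowr sg nu (th + pi / 2) (1 + cos b))); first by ring.
rewrite -ip_mexp//; congr (_ * _); apply: eq_ip => x x0.
by rewrite /mweight mulrA -expRD; congr (expR _ * _); ring.
Qed.

End mellin_mac.

(** * Derivatives of [e^{x sin a}] *)

(** A truncated exponential generating function: differentiation in [r] shifts the coefficients, and
    binomial convolution corresponds to multiplication. *)
Definition psum (R : realType) (A : nat -> R) N (r : R) : R :=
  \sum_(n < N) A n * (r ^+ n / n`!%:R).

Lemma der_sum (R : realType) (f : nat -> R -> R) (df : nat -> R) (x : R) n :
  (forall k, (k < n)%N -> is_derive x 1 (f k) (df k)) ->
  is_derive x 1 (fun y => \sum_(k < n) f k y) (\sum_(k < n) df k).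
Proof.
elim: n => [_|n ih h].
  rewrite big_ord0; apply: (der_ext _ (der_cst 0 x)) => y; by rewrite big_ord0.
rewrite big_ord_recr/=.
have h1 : is_derive x 1 (fun y => \sum_(k < n) f k y) (\sum_(k < n) df k).
  by apply: ih => k kn; apply: h; rewrite ltnW.
apply: (der_ext _ (derD h1 (h n (ltnSn n)))) => y; by rewrite big_ord_recr.
Qed.

Lemma measurable_bigsum d (T : measurableType d) (R : realType) (f : nat -> T -> R) n :
  (forall k, (k < n)%N -> measurable_fun setT (f k)) ->
  measurable_fun setT (fun y => \sum_(k < n) f k y).
Proof.
elim: n => [_|n ih h].
  rewrite (_ : (fun _ => _) = fun=> 0); first exact: measurable_cst.
  by apply/funext => y; rewrite big_ord0.
rewrite (_ : (fun _ => _) = fun y => \sum_(k < n) f k y + f n y); last first.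
  by apply/funext => y; rewrite big_ord_recr.
by apply: mfD; [apply: ih => k kn; apply: h; rewrite ltnW|exact: h].
Qed.

Lemma der_psum (R : realType) (A : nat -> R) N (r : R) :
  is_derive r 1 (psum A N.+1) (psum (A \o S) N r).
Proof.
apply: der_eq.
  apply: (@der_sum _ (fun n r => A n * (r ^+ n / n`!%:R))
    (fun n => A n * (n%:R * r ^+ n.-1 / n`!%:R))) => k _.
  notypeclasses refine (der_eq _ _); first by der.
  by cbv beta; ring.
rewrite big_ord_recl /= mul0r mul0r mulr0 add0r; apply: eq_bigr => n _.
rewrite /bump /= add1n factS natrM; congr (_ * _).
have h1 : (n.+1%:R : R) != 0 by rewrite pnatr_eq0.
have h2 : (n`!%:R : R) != 0 by rewrite pnatr_eq0 -lt0n fact_gt0.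
move: (n.+1%:R : R) (n`!%:R : R) (r ^+ n) h1 h2 => x y z h1 h2.
by field; rewrite h1 h2.
Qed.

Lemma psum0 (R : realType) (A : nat -> R) N : psum A N.+1 0 = A 0%N.
Proof.
rewrite /psum big_ord_recl /= expr0 fact0 divr1 mulr1 big1 ?addr0// => i _.
by rewrite /bump /= add1n expr0n /= mul0r mulr0.
Qed.

Lemma le_psum (R : realType) (A B : nat -> R) N (r : R) : 0 <= r ->
  (forall n, (n < N)%N -> A n <= B n) -> psum A N r <= psum B N r.
Proof.
move=> r0 AB; apply: ler_sum => n _; apply: ler_wpM2r; last exact: AB.
by rewrite divr_ge0 ?exprn_ge0.
Qed.

Lemma psum_ge0 (R : realType) (A : nat -> R) N (r : R) : 0 <= r ->
  (forall n, 0 <= A n) -> 0 <= psum A N r.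
Proof. by move=> r0 A0; apply: sumr_ge0 => n _; rewrite mulr_ge0// divr_ge0 ?exprn_ge0. Qed.

Lemma triangle_sum (R : realType) (F : nat -> nat -> R) N :
  \sum_(n < N) \sum_(k < n.+1) F k (n - k)%N = \sum_(k < N) \sum_(j < N - k) F k j.
Proof.
elim: N => [|N ih]; first by rewrite !big_ord0.
rewrite big_ord_recr ih /=.
transitivity (\sum_(k < N.+1) (\sum_(j < N - k) F k j + F k (N - k)%N)).
  by rewrite big_split/= [in RHS]big_ord_recr/= subnn big_ord0 addr0.
by apply: eq_bigr => k _; rewrite subSn ?big_ord_recr// -ltnS.
Qed.

(** The convolution keeps only the terms with k + j < N of the product of the two sums; as all terms
    are nonnegative, an inequality remains. *)
Lemma psum_mul (R : realType) (A B : nat -> R) N (r : R) : 0 <= r ->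
  (forall n, 0 <= A n) -> (forall n, 0 <= B n) ->
  psum (fun n => \sum_(k < n.+1) 'C(n, k)%:R * (A k * B (n - k)%N)) N r <=
  psum A N r * psum B N r.
Proof.
move=> r0 A0 B0; pose q (A : nat -> R) n := A n * (r ^+ n / n`!%:R).
have q0 (A' : nat -> R) n : (forall n, 0 <= A' n) -> 0 <= q A' n.
  by move=> h; rewrite mulr_ge0// divr_ge0 ?exprn_ge0.
have -> : psum (fun n => \sum_(k < n.+1) 'C(n, k)%:R * (A k * B (n - k)%N)) N r =
    \sum_(n < N) \sum_(k < n.+1) q A k * q B (n - k)%N.
  apply: eq_bigr => n _; rewrite mulr_suml; apply: eq_bigr => k _.
  have kn : (k <= n)%N by rewrite -ltnS.
  have e : r ^+ n = r ^+ k * r ^+ (n - k) by rewrite -exprD subnKC.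
  rewrite /q e.
  have : (n`!%:R : R) = 'C(n, k)%:R * (k`!%:R * (n - k)`!%:R).
    by rewrite -!natrM bin_fact.
  move=> ->.
  have h1 : ('C(n, k)%:R : R) != 0 by rewrite pnatr_eq0 -lt0n bin_gt0.
  have h2 : (k`!%:R : R) != 0 by rewrite pnatr_eq0 -lt0n fact_gt0.
  have h3 : ((n - k)`!%:R : R) != 0 by rewrite pnatr_eq0 -lt0n fact_gt0.
  move: (r ^+ k) (r ^+ (n - k)) ('C(n, k)%:R : R) (k`!%:R : R) ((n - k)`!%:R : R) h1 h2 h3.
  by move=> x y u v w h1 h2 h3; field; rewrite h1 h2 h3.
rewrite (triangle_sum (fun k j => q A k * q B j)) {2}/psum mulr_suml.
apply: ler_sum => k _; rewrite -mulr_sumr ler_wpM2l ?q0//.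
have le_sub m : (m <= N)%N -> \sum_(j < m) q B j <= \sum_(j < N) q B j.
  move=> mN; rewrite -(subnKC mN) big_split_ord/= lerDl sumr_ge0// => i _.
  exact: q0.
exact: (le_sub _ (leq_subr _ _)).
Qed.

Lemma psum1_le (R : realType) N (r : R) : 0 <= r -> psum (fun=> 1) N r <= expR r.
Proof.
elim: N r => [|N ih] r r0; first by rewrite /psum big_ord0 expR_ge0.
rewrite -subr_ge0.
have h0 : expR 0 - psum (fun=> 1) N.+1 0 = 0 :> R by rewrite psum0 expR0 subrr.
rewrite -[X in X <= _]h0.
notypeclasses refine (@der_ge0_le _ (fun r => expR r - psum (fun=> 1) N.+1 r)
  (fun r => expR r - psum (fun=> 1) N r) 0 r r0 _ _).
- move=> y _; have h := der_psum (fun=> 1) N y.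
  by notypeclasses refine (der_eq (derB (der_expR (der_id y)) h) _); rewrite mulr1.
- by move=> y /andP[y0 _]; rewrite subr_ge0; exact: ih.
Qed.

(** * Leibniz recursion for the derivatives in a *)

Section exp_sin.
Variable R : realType.
Implicit Types (x a r : R).

Definition expsin (x a : R) : R := expR (x * sin a).

Definition dexpsin n (x a : R) : R := derive1n n (expsin x) a.

Let cosn j a := cos (a + j%:R * (pi / 2)).

Let der_cosn j a : is_derive a 1 (cosn j) (cosn j.+1 a).
Proof.
notypeclasses refine (der_eq _ _); first by rewrite /cosn; der.
have -> : cosn j.+1 a = - sin (a + j%:R * (pi / 2)).
  by rewrite /cosn -cosDpihalf; congr cos; rewrite -(natr1 j); ring.
cbv beta; ring.
Qed.

Let normr_cosn j a : `|cosn j a| <= 1.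
Proof. by rewrite ler_norml cos_geN1 cos_le1. Qed.

(** Pascal's rule in the form that turns the derivative of a Leibniz sum of order n into the one of
    order n + 1. *)
Let pascal (u v : nat -> R) n :
  \sum_(k < n.+1) 'C(n, k)%:R * (u (n - k).+1 * v k + u (n - k)%N * v k.+1) =
  \sum_(k < n.+2) 'C(n.+1, k)%:R * (u (n.+1 - k)%N * v k).
Proof.
rewrite [RHS]big_ord_recl /= bin0 subn0 mul1r.
under [in RHS]eq_bigr => k _ do rewrite /bump /= add1n binS natrD mulrDl subSS.
rewrite big_split /= addrA.
under eq_bigr => k _ do rewrite mulrDr.
rewrite big_split/=; congr (_ + _).
rewrite big_ord_recl /= bin0 subn0 mul1r; congr (_ + _).
rewrite [in RHS]big_ord_recr /= bin_small// mul0r addr0.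
by apply: eq_bigr => k _; rewrite /bump /= add1n subnSK.
Qed.

Let leibniz x n a : R :=
  x * \sum_(k < n.+1) 'C(n, k)%:R * (cosn (n - k) a * dexpsin k x a).

Let der_leibniz x n a :
  (forall k, (k < n.+1)%N -> is_derive a 1 (dexpsin k x) (dexpsin k.+1 x a)) ->
  is_derive a 1 (leibniz x n) (leibniz x n.+1 a).
Proof.
move=> h; apply: der_eq.
  apply: derZ; apply: (@der_sum _ (fun k a => 'C(n, k)%:R * (cosn (n - k) a * dexpsin k x a))
    (fun k => 'C(n, k)%:R * (cosn (n - k).+1 a * dexpsin k x a +
                             cosn (n - k) a * dexpsin k.+1 x a))) => k kn.
  apply: derZ; apply: derM; [exact: der_cosn|exact: h].
by rewrite /leibniz -(pascal (cosn ^~ a) (fun k => dexpsin k x a)).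
Qed.

(** The two halves need each other: the formula of order n gives the differentiability of
    [dexpsin n.+1], and differentiating that formula requires the differentiability of all lower
    orders. *)
Let dexpsin_main x n :
  (forall k, (k < n.+1)%N -> forall a, is_derive a 1 (dexpsin k x) (dexpsin k.+1 x a)) /\
  (forall a, dexpsin n.+1 x a = leibniz x n a).
Proof.
elim: n => [|n [ih1 ih2]].
  have h a : is_derive a 1 (dexpsin 0 x) (leibniz x 0 a).
    have -> : dexpsin 0 x = (fun a => expR (x * sin a)) by [].
    notypeclasses refine (der_eq _ _); first by der.
    rewrite /leibniz big_ord_recl big_ord0 /= bin0 subn0.
    by rewrite /dexpsin /= /expsin /cosn !mul0r !addr0; cbv beta; ring.
  have E a : dexpsin 1 x a = leibniz x 0 a by exact: der_derive1 (h a).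
  split; last exact: E.
  by move=> k; rewrite ltnS leqn0 => /eqP -> a; rewrite E; exact: h.
have E : dexpsin n.+1 x = leibniz x n by apply/funext.
have h a : is_derive a 1 (dexpsin n.+1 x) (leibniz x n.+1 a).
  by rewrite E; apply: der_leibniz => k kn; exact: ih1.
have E2 a : dexpsin n.+2 x a = leibniz x n.+1 a by exact: der_derive1 (h a).
split; last exact: E2.
move=> k; rewrite ltnS leq_eqVlt => /predU1P[-> a|kn a]; last exact: ih1.
rewrite E2; exact: h.
Qed.

Lemma der_dexpsin n x a : is_derive a 1 (dexpsin n x) (dexpsin n.+1 x a).
Proof. by have [h _] := dexpsin_main x n; exact: h. Qed.

Lemma dexpsinS n x a : dexpsin n.+1 x a = leibniz x n a.
Proof. by have [_ ->] := dexpsin_main x n. Qed.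

Lemma measurable_dexpsin n a : measurable_fun setT (fun x => dexpsin n x a).
Proof.
elim/ltn_ind: n => -[_|n ih]; first by rewrite /dexpsin /= /expsin; meas.
under eq_fun do rewrite dexpsinS; rewrite /leibniz.
apply: mfM; first exact: measurable_id.
apply: (@measurable_bigsum _ _ _ (fun k x => 'C(n, k)%:R * (cosn (n - k) a * dexpsin k x a))).
move=> k kn; apply: mfM; first exact: mf_cst.
by apply: mfM; [exact: mf_cst|exact: ih].
Qed.

(** The derivatives of cos are at most 1 in absolute value, and the sequence 1 has generating
    function e^r. The Leibniz recursion thus becomes the differential inequality A' <= x e^r A, up
    to truncation. *)
Let psumS_le x a r N : 0 <= x -> 0 <= r ->
  psum (fun n => `|dexpsin n.+1 x a|) N r <=
  x * expR r * psum (fun n => `|dexpsin n x a|) N r.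
Proof.
move=> x0 r0; pose A n := `|dexpsin n x a|.
have h : psum (fun n => x * \sum_(k < n.+1) 'C(n, k)%:R * (A k * 1)) N r <=
    x * expR r * psum A N r.
  rewrite {1}/psum; under eq_bigr do rewrite -mulrA.
  rewrite -mulr_sumr -mulrA ler_wpM2l//.
  have := @psum_mul _ A (fun=> 1) N r r0 (fun n => normr_ge0 _) (fun n => ler01).
  move=> /le_trans; apply; rewrite mulrC ler_wpM2r ?psum1_le//.
  by apply: psum_ge0 => // n; exact: normr_ge0.
apply: le_trans h; apply: le_psum => // n _.
rewrite dexpsinS /leibniz normrM ger0_norm// ler_wpM2l//.
apply: le_trans (ler_norm_sum _ _ _) _; apply: ler_sum => k _.
rewrite normrM ger0_norm// ler_wpM2l// normrM mulrC ler_wpM2l//.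
Qed.

(* The majorant [e^{x (sin a + e^r - 1)}] satisfies with equality the
   differential inequality in [r] obeyed by these partial sums. *)
Lemma psum_dexpsin_le x a r N : 0 <= x -> 0 <= r ->
  psum (fun n => `|dexpsin n x a|) N r <= expR (x * (sin a + expR r - 1)).
Proof.
move=> x0; elim: N r => [|N ih] r r0; first by rewrite /psum big_ord0 expR_ge0.
pose Phi r := expR (x * (sin a + expR r - 1)).
rewrite -subr_ge0.
have h0 : Phi 0 - psum (fun n => `|dexpsin n x a|) N.+1 0 = 0.
  rewrite psum0 /Phi expR0 addrK /dexpsin /= /expsin ger0_norm ?expR_ge0//.
  by rewrite subrr.
rewrite -[X in X <= _]h0.
notypeclasses refine (@der_ge0_le _ (fun r => Phi r - psum (fun n => `|dexpsin n x a|) N.+1 r)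
  (fun r => x * expR r * Phi r - psum (fun n => `|dexpsin n.+1 x a|) N r) 0 r r0 _ _).
- move=> y _; have h := der_psum (fun n => `|dexpsin n x a|) N y.
  have hP : is_derive y 1 Phi (x * expR y * Phi y).
    rewrite /Phi; notypeclasses refine (der_eq _ _); first by der.
    by cbv beta; ring.
  exact (derB hP h).
- move=> y /andP[y0 _]; rewrite subr_ge0 (le_trans (psumS_le _ _ x0 y0))//.
  by rewrite ler_wpM2l ?mulr_ge0 ?expR_ge0//; exact: ih.
Qed.

End exp_sin.

(** * Real coefficients *)

Lemma Itg_pow_exp (R : realType) n (c : R) : 0 < c ->
  Itg (fun t => t ^+ n * expR (- (c * t))).
Proof.
move=> c0; have n0 : 0 < n.+1%:R :> R by [].
apply: eq_Itg (Itg_gamma n0 c0) => t t0.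
rewrite expRD -natr1 addrK; congr (_ * _).
by rewrite expRM_natl lnK.
Qed.

Lemma absolutely_summable (R : realType) (u : nat -> R) (M : R) :
  (forall N, \sum_(n < N) `|u n| <= M) -> cvgn (series u).
Proof.
move=> uM; apply: normed_cvg; apply: nondecreasing_is_cvgn.
  by apply: nondecreasing_series => n _ _; exact: normr_ge0.
by exists M => _ [N _ <-]; move: (uM N); rewrite -(big_mkord xpredT (fun n => `|u n|)).
Qed.

(** With u = pi / 2 - a this is 1 - cos u <= u. It converts the margin available for sin a into a
    margin for the angle pi / 2 + a. *)
Lemma onem_sin_le (R : realType) (a : R) : a <= pi / 2 -> 1 - sin a <= pi / 2 - a.
Proof.
move=> api; have -> : sin a = cos (pi / 2 - a).
  by rewrite cosB cos_pihalf sin_pihalf; ring.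
have : 0 <= pi / 2 - a by rewrite subr_ge0.
move: (pi / 2 - a) => u u0; rewrite lerBlDr -subr_ge0.
have h0 : (0 : R) + cos 0 - 1 = 0 by rewrite cos0; ring.
rewrite -[X in X <= _]h0.
notypeclasses refine (@der_ge0_le _ (fun u => u + cos u - 1) (fun u => 1 - sin u) 0 u u0 _ _).
- by move=> y _; notypeclasses refine (der_eq _ _); [der|cbv beta; ring].
- by move=> y _; rewrite subr_ge0 sin_le1.
Qed.

(** Preserves the margin for parameters within [d] of [a], where the differentiation under the
    integral takes place. *)
Lemma sin_lip (R : realType) (a b d : R) : a - d < b < a + d -> sin b <= sin a + d.
Proof.
move=> /andP[ab1 ab2]; have [ab|/ltW ba] := leP a b.
  have : a - sin a <= b - sin b.
    notypeclasses refine (@der_ge0_le _ (fun y => y - sin y) (fun y => 1 - cos y) a b ab _ _).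
    - by move=> y _; notypeclasses refine (der_eq _ _); [der|cbv beta; ring].
    - by move=> y _; rewrite subr_ge0 cos_le1.
  by lra.
have : b + sin b <= a + sin a.
  notypeclasses refine (@der_ge0_le _ (fun y => y + sin y) (fun y => 1 + cos y) b a ba _ _).
  - by move=> y _; notypeclasses refine (der_eq _ _); [der|cbv beta; ring].
  - by move=> y _; have := cos_geN1 y; lra.
by lra.
Qed.

(** The [n]-th derivative of cosh. *)
Definition hyp (R : realType) (n : nat) (y : R) : R := if odd n then sinh y else cosh y.

Lemma der_hyp (R : realType) n (y : R) : is_derive y 1 (@hyp R n) (hyp n.+1 y).
Proof.
rewrite /hyp /=; case: (odd n) => /=.
  by notypeclasses refine (der_eq (der_sinh (der_id y)) _); rewrite mulr1.
by notypeclasses refine (der_eq (der_cosh (der_id y)) _); rewrite mulr1.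
Qed.

Lemma normr_hyp_le (R : realType) n (y : R) : `|hyp n y| <= expR `|y|.
Proof.
have ch : cosh y <= expR `|y|.
  have h1 : expR y <= expR `|y| by rewrite ler_expR ler_norm.
  have h2 : expR (- y) <= expR `|y| by rewrite ler_expR -normrN ler_norm.
  by rewrite /cosh; lra.
rewrite /hyp; case: (odd n); first exact: le_trans (normr_sinh_le y) ch.
by rewrite gtr0_norm ?cosh_gt0.
Qed.

Lemma measurable_hyp (R : realType) n : measurable_fun setT (@hyp R n).
Proof.
by rewrite /hyp; case: (odd n); [exact: measurable_sinh|exact: measurable_cosh].
Qed.

Lemma lim_norm_le (R : realType) (u : nat -> R) (l M : R) :
  u n @[n --> \oo] --> l -> (forall n, `|u n| <= M) -> `|l| <= M.
Proof.
move=> ul uM; have cu : cvgn u by apply/cvg_ex; exists l.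
rewrite -(cvg_lim _ ul)// ler_norml; apply/andP; split.
  by apply: limr_ge => //; apply: nearW => n; have := uM n; rewrite ler_norml => /andP[].
by apply: limr_le => //; apply: nearW => n; have := uM n; rewrite ler_norml => /andP[].
Qed.

Lemma series_norm_le (R : realType) (u : nat -> R) N :
  `|series u N| <= \sum_(n < N) `|u n|.
Proof.
rewrite -(big_mkord xpredT (fun n => `|u n|)) /series /=; exact: ler_norm_sum.
Qed.

(** Completing the square gives b t - eps t^2 <= (b + 1)^2 / (4 eps) - t. *)
Lemma Itg_gauss (R : realType) (eps b : R) : 0 < eps ->
  Itg (fun t => expR (- eps * t ^+ 2 + b * t)).
Proof.
move=> e0.
apply: (@Itg_le _ _ (fun t => expR ((b + 1) ^+ 2 / (4 * eps)) * expR (- (1 * t)))).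
- by apply: continuous_pmeas => t t0; cont.
- move=> t t0; rewrite ger0_norm ?expR_ge0// -expRD ler_expR.
  have : 0 <= eps * (t - (b + 1) / (2 * eps)) ^+ 2 by rewrite mulr_ge0 ?sqr_ge0// ltW.
  have -> : eps * (t - (b + 1) / (2 * eps)) ^+ 2 =
     eps * t ^+ 2 - (b + 1) * t + (b + 1) ^+ 2 / (4 * eps).
    by field; rewrite gt_eqF.
  by lra.
- by apply: ItgZ; exact: Itg_expRN.
Qed.

(* [opsum e a tau] is [\sum_n e_n D_a^n cosh ((pi / 2 + a) tau)]. *)
Definition opsum (R : realType) (e : nat -> R) (a tau : R) : R :=
  limn (series (fun n => e n * (tau ^+ n * hyp n ((pi / 2 + a) * tau)))).

Definition opD (R : realType) (e : nat -> R) (a x : R) : R :=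
  limn (series (fun n => e n * dexpsin n x a)).

Definition freg (R : realType) (e : nat -> R) (a eps x : R) : R :=
  ip (fun tau => expR (- eps * tau ^+ 2) * opsum e a tau * mac tau x).

Lemma le_of_eq (R : realType) (x y : R) : x = y -> x <= y.
Proof. by move->. Qed.

(** * Identity for each power of D_a, and summation over the powers *)

Section real_core.
Variables (R : realType) (sg nu th a r dl : R).
Hypotheses (sg0 : 0 < sg) (a0 : 0 <= a < pi / 2) (r0 : 0 < r) (dl0 : 0 < dl).
(** One [dl] pays for moving the parameter away from [a]; the other leaves a factor e^{- dl x} in
    the majorants. *)
Hypothesis rdl : sin a + (expR r - 1) + 2 * dl <= 1.

Local Notation bt := (pi / 2 + a).
Local Notation Y := (mweight sg nu th).
Local Notation H := (mac_mellin sg nu th).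

Let r_le : r <= expR r - 1.
Proof. by have := expR_ge1Dx r; lra. Qed.

Let btdl : bt + r + 2 * dl <= pi.
Proof.
have := @onem_sin_le _ a; move/andP: a0 => [_ /ltW ap] /(_ ap).
move: r_le rdl; lra.
Qed.

(** The decay rate taken for [H]. By [btdl] it exceeds pi / 2 + b by dl / 2 for every b below a +
    dl, and it exceeds r + pi / 2 + a by more than [dl]. *)
Let gm := pi - dl / 2.

Let gm_lt : 0 <= gm < pi.
Proof. by rewrite /gm; move/andP: a0 btdl r0 dl0 => [? ?] ? ? ?; apply/andP; split; lra. Qed.

Let near_a b : a - dl < b < a + dl -> 0 <= pi / 2 + b < pi.
Proof.
move=> /andP[h1 h2]; move/andP: a0 btdl r0 dl0 => [? ?] ? ? ?; apply/andP; split; last by lra.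
have pi2 := pi_ge2 R.
have sa : 0 <= sin a by apply: sin_ge0_pi; apply/andP; split; lra.
by move: r_le rdl r0; lra.
Qed.

(** One term of a nonnegative sum is at most the whole sum, which [psum_dexpsin_le] bounds. *)
Lemma dexpsin_le n x b : a - dl < b < a + dl -> 0 < x ->
  `|dexpsin n x b| <= n`!%:R / r ^+ n * expR ((1 - dl) * x).
Proof.
move=> ab x0; have sb := sin_lip ab.
have h := @psum_dexpsin_le _ x b r n.+1 (ltW x0) (ltW r0).
have f0 : 0 < (n`!%:R : R) by rewrite ltr0n fact_gt0.
rewrite mulrAC ler_pdivlMr ?exprn_gt0// mulrC -ler_pdivrMl//.
have -> : (n`!%:R)^-1 * (r ^+ n * `|dexpsin n x b|) = `|dexpsin n x b| * (r ^+ n / n`!%:R).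
  by ring.
apply: (@le_trans _ _ (psum (fun n => `|dexpsin n x b|) n.+1 r)).
  rewrite /psum big_ord_recr/= lerDr.
  exact: (@psum_ge0 _ (fun n => `|dexpsin n x b|) n r (ltW r0) (fun n => normr_ge0 _)).
apply: (le_trans h); rewrite ler_expR mulrC ler_wpM2r ?(ltW x0)//.
by move: rdl dl0; lra.
Qed.

Let lhs n b := ip (fun t => t ^+ n * hyp n ((pi / 2 + b) * t) * H t).
Let rhs n b := ip (fun x => dexpsin n x b * Y x).

Let dom_lhs n : exists2 C : R, 0 <= C & forall b t, a - dl < b < a + dl -> 0 < t ->
  `|t ^+ n * hyp n ((pi / 2 + b) * t) * H t| <= C * (t ^+ n * expR (- (dl / 2 * t))).
Proof.
have [C C0 hC] := mac_mellin_decay nu th sg0 gm_lt.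
exists C => // b t ab t0; have /andP[b0 _] := near_a ab.
rewrite !normrM (ger0_norm (exprn_ge0 _ (ltW t0))) -mulrA [leRHS]mulrCA.
rewrite ler_wpM2l ?exprn_ge0 ?(ltW t0)//.
apply: le_trans (ler_pM (normr_ge0 _) (normr_ge0 _) (normr_hyp_le _ _) (hC t)) _.
rewrite ger0_norm ?(mulr_ge0 b0 (ltW t0))// mulrCA -expRD ler_wpM2l// ler_expR.
rewrite /gm.
have : (pi / 2 + b) - (pi - dl / 2) <= - (dl / 2).
  by have /andP[_ ?] := ab; move: btdl r0 dl0; lra.
move=> /(ler_wpM2r (ltW t0)); lra.
Qed.

Let Itg_lhs n b : a - dl < b < a + dl ->
  Itg (fun t => t ^+ n * hyp n ((pi / 2 + b) * t) * H t).
Proof.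
move=> ab; have [C C0 hC] := dom_lhs n.
apply: (@Itg_le _ _ (fun t => C * (t ^+ n * expR (- (dl / 2 * t))))).
- apply: pmeasW; have mH := measurable_mac_mellin sg nu th.
  have mh : measurable_fun setT (fun t => hyp n ((pi / 2 + b) * t)).
    by apply: mf_comp (@measurable_hyp _ n) _; meas.
  by apply: mfM => //; apply: mfM => //; exact: exprn_measurable.
- by move=> t t0; exact: hC.
- by apply: ItgZ; apply: Itg_pow_exp; rewrite divr_gt0.
Qed.

Let dom_rhs n b x : a - dl < b < a + dl -> 0 < x ->
  `|dexpsin n x b * Y x| <= n`!%:R / r ^+ n * expR ((sg - 1) * ln x - dl * x).
Proof.
move=> ab x0; rewrite normrM.
apply: le_trans (ler_pM (normr_ge0 _) (normr_ge0 _) (dexpsin_le n ab x0) (normr_mweight _ _ _ _)) _.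
rewrite -[leLHS]mulrA -expRD ler_wpM2l ?divr_ge0 ?exprn_ge0 ?(ltW r0)// ler_expR; lra.
Qed.

Let Itg_rhs n b : a - dl < b < a + dl -> Itg (fun x => dexpsin n x b * Y x).
Proof.
move=> ab; apply: (@Itg_le _ _ (fun x => n`!%:R / r ^+ n * expR ((sg - 1) * ln x - dl * x))).
- apply: pmeasW; apply: mfM; first exact: measurable_dexpsin.
  exact: measurable_mweight.
- by move=> x x0; exact: dom_rhs.
- by apply: ItgZ; exact: Itg_gamma.
Qed.

Let der_lhs n b : a - dl < b < a + dl -> is_derive b 1 (lhs n) (lhs n.+1 b).
Proof.
move=> ab; have [C C0 hC] := dom_lhs n.+1.
notypeclasses refine (@is_derive_under_ip _
  (fun b t => t ^+ n * hyp n ((pi / 2 + b) * t) * H t)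
  (fun b t => t ^+ n.+1 * hyp n.+1 ((pi / 2 + b) * t) * H t)
  (fun t => C * (t ^+ n.+1 * expR (- (dl / 2 * t)))) _ _ _ ab _ _ _ _).
- by move=> y /Itg_lhs.
- move=> y t yab t0.
  have h1 : is_derive y 1 (fun y => (pi / 2 + y) * t) t.
    by notypeclasses refine (der_eq _ _); [der|cbv beta; ring].
  have h2 := @der_comp _ (hyp n) (fun y => (pi / 2 + y) * t) y _ _ (der_hyp n _) h1.
  notypeclasses refine (der_eq (derM (derZ (t ^+ n) h2) (der_cst (H t) y)) _).
  by cbv beta; rewrite exprS; ring.
- by apply: ItgZ; apply: Itg_pow_exp; rewrite divr_gt0.
- by move=> y t yab t0; exact: hC.
Qed.

Let der_rhs n b : a - dl < b < a + dl -> is_derive b 1 (rhs n) (rhs n.+1 b).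
Proof.
move=> ab.
notypeclasses refine (@is_derive_under_ip _
  (fun b x => dexpsin n x b * Y x) (fun b x => dexpsin n.+1 x b * Y x)
  (fun x => n.+1`!%:R / r ^+ n.+1 * expR ((sg - 1) * ln x - dl * x)) _ _ _ ab _ _ _ _).
- by move=> y /Itg_rhs.
- move=> y x yab x0.
  notypeclasses refine (der_eq (derM (der_dexpsin n x y) (der_cst (Y x) y)) _).
  by rewrite mulr0 addr0.
- by apply: ItgZ; exact: Itg_gamma.
- by move=> y x yab x0; exact: dom_rhs.
Qed.

(** The identity is stated on an open interval around [a] because each induction step differentiates
    it in [b]. *)
Let moment n b : a - dl < b < a + dl -> lhs n b = pi / 2 * rhs n b.
Proof.
elim: n b => [|n ih] b ab.
  rewrite /lhs /rhs; have := mac_mellin_base nu th sg0 (near_a ab).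
  under eq_ip => t _ do rewrite -[cosh _]mul1r.
  move=> ->; congr (_ * _); apply: eq_ip => x _.
  (* - cos (pi / 2 + b) = sin b. *)
  by rewrite addrC cosDpihalf mulrN opprK.
have h1 := der_lhs n ab.
have h2 := derZ (pi / 2) (der_rhs n ab).
have E : {near b, lhs n =1 (fun b => pi / 2 * rhs n b)}.
  have : b \in `]a - dl, a + dl[ by rewrite in_itv.
  move=> /near_in_itvoo; apply: filterS => y; rewrite in_itv/=; exact: ih.
have [_ <-] := h1; have [_ <-] := h2.
exact: near_eq_derive.
Qed.

Variables (e : nat -> R) (Ce : R).
Hypothesis eC : forall n, `|e n| <= Ce * (r ^+ n / n`!%:R).

Let Ce0 : 0 <= Ce.
Proof. by have := eC 0; rewrite expr0 fact0 divr1 mulr1; exact: le_trans. Qed.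

Let u tau n := e n * (tau ^+ n * hyp n (bt * tau)).
Let v x n := e n * dexpsin n x a.

Let bt0 : 0 <= bt.
Proof. by have /near_a/andP[] : a - dl < a < a + dl by rewrite ltrBlDr ltrDl dl0. Qed.

Let ina : a - dl < a < a + dl.
Proof. by rewrite ltrBlDr ltrDl dl0. Qed.

Let u_le tau N : \sum_(n < N) `|u tau n| <= Ce * expR ((r + bt) * `|tau|).
Proof.
apply: (@le_trans _ _ (Ce * psum (fun=> 1) N (r * `|tau|) * expR (bt * `|tau|))).
  rewrite /psum mulr_sumr mulr_suml; apply: ler_sum => n _.
  rewrite /u !normrM normrX.
  have h1 : `|hyp n (bt * tau)| <= expR (bt * `|tau|).
    by rewrite (le_trans (normr_hyp_le _ _))// normrM (ger0_norm bt0).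
  have -> : Ce * (1 * ((r * `|tau|) ^+ n / n`!%:R)) * expR (bt * `|tau|) =
      Ce * (r ^+ n / n`!%:R) * (`|tau| ^+ n * expR (bt * `|tau|)).
    by rewrite exprMn; ring.
  have t0 : 0 <= `|tau| ^+ n by rewrite exprn_ge0.
  exact: (ler_pM (normr_ge0 _) (mulr_ge0 t0 (normr_ge0 _)) (eC n) (ler_wpM2l t0 h1)).
have -> : expR ((r + bt) * `|tau|) = expR (r * `|tau|) * expR (bt * `|tau|).
  by rewrite -expRD -mulrDl.
rewrite -mulrA ler_wpM2l// ler_wpM2r ?expR_ge0//.
by apply: psum1_le; rewrite mulr_ge0// ltW.
Qed.

Let v_le x N : 0 < x -> \sum_(n < N) `|v x n| <= Ce * expR ((1 - dl) * x).
Proof.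
move=> x0; apply: (@le_trans _ _ (Ce * psum (fun n => `|dexpsin n x a|) N r)).
  rewrite /psum mulr_sumr; apply: ler_sum => n _; rewrite /v normrM.
  have -> : Ce * (`|dexpsin n x a| * (r ^+ n / n`!%:R)) =
     Ce * (r ^+ n / n`!%:R) * `|dexpsin n x a| by ring.
  by rewrite ler_wpM2r.
rewrite ler_wpM2l//; apply: le_trans (psum_dexpsin_le _ _ (ltW x0) (ltW r0)) _.
by rewrite ler_expR mulrC ler_wpM2r ?(ltW x0)//; move: rdl dl0; lra.
Qed.

Lemma opsum_cvg tau : series (u tau) @ \oo --> opsum e a tau.
Proof. exact: absolutely_summable (u_le tau). Qed.

Lemma opD_cvg x : 0 < x -> series (v x) @ \oo --> opD e a x.
Proof. by move=> x0; exact: absolutely_summable (fun N => v_le N x0). Qed.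

Let opsum_le tau : `|opsum e a tau| <= Ce * expR ((r + bt) * `|tau|).
Proof.
apply: (@lim_norm_le _ (series (u tau)) _ _ (@opsum_cvg tau)) => N.
exact: le_trans (series_norm_le _ _) (u_le tau N).
Qed.

Let measurable_u n : measurable_fun setT (u ^~ n).
Proof.
apply: mfM; first exact: mf_cst.
apply: mfM; first exact: exprn_measurable.
apply: mf_comp; first exact: measurable_hyp.
exact: mulrl_measurable.
Qed.

Let seriesE (w : nat -> R) N : series w N = \sum_(n < N) w n.
Proof. by rewrite seriesEord. Qed.

Let measurable_opsum : measurable_fun setT (opsum e a).
Proof.
apply: (@measurable_fun_cvg _ _ _ setT (fun N tau => series (u tau) N)).
  move=> N; under eq_fun do rewrite seriesE.
  apply: (@measurable_bigsum _ _ _ (fun k t => u t k)) => k _.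
  exact: (measurable_u k).
by move=> tau _; exact: opsum_cvg.
Qed.

Let Itg_v n : Itg (fun x => v x n * Y x).
Proof.
apply: eq_Itg (ItgZ (e n) (Itg_rhs n ina)) => x _.
by rewrite /v mulrA.
Qed.

Let Itg_u n : Itg (fun t => u t n * H t).
Proof.
apply: eq_Itg (ItgZ (e n) (Itg_lhs n ina)) => x _.
by rewrite /u mulrA.
Qed.

Let domG x : 0 < x ->
  Ce * expR ((1 - dl) * x) * expR ((sg - 1) * ln x - x) =
  Ce * expR ((sg - 1) * ln x - dl * x).
Proof. by move=> x0; rewrite -mulrA -expRD; congr (_ * expR _); ring. Qed.

Let limG : Itg (fun x => opD e a x * Y x) /\
  ip (fun x => series (v x) N * Y x) @[N --> \oo] --> ip (fun x => opD e a x * Y x).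
Proof.
apply: (@dominated_ip _ (fun N x => series (v x) N * Y x) _
  (fun x => Ce * expR ((sg - 1) * ln x - dl * x))).
- move=> N; apply: pmeasW; apply: mfM; last exact: measurable_mweight.
  under eq_fun do rewrite seriesE.
  apply: (@measurable_bigsum _ _ _ (fun k x => v x k)) => k _.
  by apply: mfM; [exact: mf_cst|exact: (measurable_dexpsin k)].
- by move=> x x0; apply: cvgMl; exact: opD_cvg.
- by apply: ItgZ; exact: Itg_gamma.
- move=> N x x0; rewrite normrM -domG//; apply: ler_pM => //.
    exact: le_trans (series_norm_le _ _) (v_le N x0).
  exact: normr_mweight.
Qed.

Let C1 := sval (cid2 (mac_mellin_decay nu th sg0 gm_lt)).

Let dom_uH t (w : R) : 0 < t -> `|w| <= Ce * expR ((r + bt) * `|t|) ->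
  `|w * H t| <= Ce * C1 * expR (- (dl * t)).
Proof.
rewrite /C1; case: cid2 => C C0 hC /= t0 wC.
rewrite normrM; apply: le_trans (ler_pM (normr_ge0 _) (normr_ge0 _) wC (hC t)) _.
rewrite mulrACA -expRD ler_wpM2l ?mulr_ge0// ler_expR (gtr0_norm t0).
have : r + bt - gm <= - dl by rewrite /gm; move: btdl dl0; lra.
by move=> /(ler_wpM2r (ltW t0)); lra.
Qed.

Let limH : Itg (fun t => opsum e a t * H t) /\
  ip (fun t => series (u t) N * H t) @[N --> \oo] --> ip (fun t => opsum e a t * H t).
Proof.
apply: (@dominated_ip _ (fun N t => series (u t) N * H t) _
  (fun t => Ce * C1 * expR (- (dl * t)))).
- move=> N; apply: pmeasW; apply: mfM; last exact: measurable_mac_mellin.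
  under eq_fun do rewrite seriesE.
  apply: (@measurable_bigsum _ _ _ (fun k t => u t k)) => k _.
  exact: (measurable_u k).
- by move=> t t0; apply: cvgMl; exact: opsum_cvg.
- by apply: ItgZ; exact: Itg_expRN.
- move=> N t t0; apply: dom_uH => //.
  exact: le_trans (series_norm_le _ _) (u_le t N).
Qed.

(** For partial sums this is [moment] and linearity; [limH] and [limG] carry the two sides to the
    limit. *)
Let value : ip (fun t => opsum e a t * H t) = pi / 2 * ip (fun x => opD e a x * Y x).
Proof.
have [_ h1] := limH; have [_ h2] := limG.
apply: (cvg_unique _ h1) => //.
rewrite (_ : (fun N => _) = (fun N => pi / 2 * ip (fun x => series (v x) N * Y x))).
  by apply: cvgMr.
apply/funext => N.
transitivity (\sum_(n < N) ip (fun t => u t n * H t)).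
  rewrite -(ip_sum N Itg_u); apply: eq_ip => t _.
  by rewrite seriesE mulr_suml.
transitivity (pi / 2 * \sum_(n < N) ip (fun x => v x n * Y x)); last first.
  congr (_ * _); rewrite -(ip_sum N Itg_v); apply: eq_ip => t _.
  by rewrite seriesE mulr_suml.
rewrite mulr_sumr; apply: eq_bigr => n _.
transitivity (e n * lhs n a).
  rewrite /lhs -ipZ; last exact: Itg_lhs.
  by apply: eq_ip => t _; rewrite /u !mulrA.
rewrite (moment n ina) mulrCA; congr (_ * _).
rewrite /rhs -ipZ; last exact: Itg_rhs.
by apply: eq_ip => t _; rewrite /v !mulrA.
Qed.

Lemma Itg_opD : Itg (fun x => opD e a x * Y x).
Proof. by have [] := limG. Qed.

Lemma Itg_freg_integrand eps x : 0 < eps -> 0 < x ->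
  Itg (fun tau => expR (- eps * tau ^+ 2) * opsum e a tau * mac tau x).
Proof.
move=> e0 x0; have [C C0 hC] := @mac_le R 1 ltr01.
apply: (@Itg_le _ _ (fun t => Ce * C * expR (- (1 * ln x)) *
   expR (- eps * t ^+ 2 + (r + bt) * t))).
- apply: pmeasW; apply: mfM; last first.
    exact: (measurableT_comp (@measurable_mac R) (@pair2_measurable _ _ _ _ x)).
  apply: mfM => //; apply: mf_comp; first exact: measurable_expR.
  by apply: mfM; [exact: mf_cst|exact: exprn_measurable].
- move=> t t0; rewrite !normrM (ger0_norm (expR_ge0 _)) expRD.
  have h := ler_pM (normr_ge0 _) (normr_ge0 _) (opsum_le t) (hC t x x0).
  rewrite (gtr0_norm t0) in h.
  rewrite -mulrA; apply: le_trans (ler_wpM2l (expR_ge0 _) h) _.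
  by apply: le_of_eq; ring.
- by apply: ItgZ; exact: Itg_gauss.
Qed.

Let p0 : 0 < sg / 2.
Proof. by rewrite divr_gt0. Qed.

(** The majorant splits as a product: [mac_le] is uniform in t and gives the factor x^{- sg / 2},
    integrable against the weight, while the Gaussian absorbs the growth e^{(r + pi/2 + a) t} of
    [opsum]. *)
Lemma mellin_freg eps : 0 < eps ->
  Itg (fun x => freg e a eps x * Y x) /\
  ip (fun x => freg e a eps x * Y x) =
  ip (fun t => expR (- eps * t ^+ 2) * (opsum e a t * H t)).
Proof.
move=> e0; have [C C0 hC] := mac_le p0.
pose F x t := expR (- eps * t ^+ 2) * opsum e a t * mac t x * Y x.
pose g1 x := C * expR ((sg / 2 - 1) * ln x - 1 * x).
pose g2 t := Ce * expR (- eps * t ^+ 2 + (r + bt) * t).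
have i1 : Itg g1 by apply: ItgZ; exact: Itg_gamma.
have i2 : Itg g2 by apply: ItgZ; exact: Itg_gauss.
have mg : measurable_fun setT (fun t : R => expR (- eps * t ^+ 2) * opsum e a t).
  apply: mfM => //; apply: mf_comp; first exact: measurable_expR.
  by apply: mfM; [exact: mf_cst|exact: exprn_measurable].
have mF : measurable_fun setT
    (fun z : measurableTypeR R * measurableTypeR R => F z.1 z.2).
  apply: mfM; last by apply: mf_comp => //; exact: measurable_mweight.
  apply: mfM; first exact: (mf_comp mg measurable_snd).
  exact: (measurableT_comp (@measurable_mac R) (@measurable_swap _ _ _ _)).
have domF x t : 0 < x -> 0 < t -> `|F x t| <= g1 x * g2 t.
  move=> x0 t0; rewrite /F (normrM _ (Y x)) (normrM _ (mac t x)) (normrM _ (opsum e a t)).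
  rewrite (ger0_norm (expR_ge0 _)) /g1 /g2.
  have h1 := ler_pM (normr_ge0 _) (normr_ge0 _) (hC t x x0) (normr_mweight sg nu th x).
  have h2 := opsum_le t; rewrite (gtr0_norm t0) in h2.
  have h3 := ler_wpM2l (expR_ge0 (- eps * t ^+ 2)) h2.
  have z1 : 0 <= `|mac t x| * `|Y x| by [].
  have z2 : 0 <= expR (- eps * t ^+ 2) * `|opsum e a t| by rewrite mulr_ge0// expR_ge0.
  rewrite -[leLHS]mulrA; apply: le_trans (ler_pM z2 z1 h3 h1) _.
  have -> : expR ((sg / 2 - 1) * ln x - 1 * x) =
      expR (- (sg / 2 * ln x)) * expR ((sg - 1) * ln x - x).
    by rewrite -expRD; congr expR; field.
  rewrite [expR (- eps * t ^+ 2 + _)]expRD.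
  by apply: le_of_eq; ring.
have E x : 0 < x -> freg e a eps x * Y x = ip (F x).
  move=> x0; rewrite mulrC /freg -ipZ; last exact: Itg_freg_integrand.
  by apply: eq_ip => t _; rewrite /F mulrC.
have intFx x : 0 < x -> Itg (F x).
  move=> x0; apply: eq_Itg (ItgZ (Y x) (Itg_freg_integrand e0 x0)) => t _.
  by rewrite /F mulrC.
split.
  apply: (@eq_Itg _ (fun x => ip (F x))) => [x x0|]; first by rewrite E.
  apply: (@Itg_le _ _ (fun x => g1 x * ip g2)).
  - apply: (@measurable_funS _ _ (measurableTypeR R) R setT) => //.
    exact: (@measurable_ip _ (measurableTypeR R) _ F).
  - move=> x x0; rewrite -ipZ//; apply: ip_norm; [exact: intFx|exact: ItgZ|].
    by move=> t t0; exact: domF.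
  - by apply: (@eq_Itg _ (fun x => ip g2 * g1 x)) => [x _|]; [rewrite mulrC|exact: ItgZ].
rewrite (eq_ip E) (ip_fubini mF i1 i2 domF); apply: eq_ip => t t0.
rewrite /mac_mellin mulrA -ipZ; last exact: Itg_mac_mellin.
by apply: eq_ip => x _; rewrite /F !mulrA.
Qed.

Lemma cvg_mellin_freg :
  ip (fun x => freg e a eps x * Y x) @[eps --> 0^'+] -->
  pi / 2 * ip (fun x => opD e a x * Y x).
Proof.
rewrite -value; apply/cvg_at_rightP => w [w0 wl].
rewrite (_ : (fun n => _) =
    (* The right limit is tested on sequences, where dominated convergence applies: [H] already
       supplies a majorant free of [eps]. *)
    (fun n => ip (fun t => expR (- w n * t ^+ 2) * (opsum e a t * H t)))); last first.
  by apply/funext => n; have [_ ->] := mellin_freg (w0 n).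
have domH t : 0 < t -> `|opsum e a t * H t| <= Ce * C1 * expR (- (dl * t)).
  by move=> t0; apply: dom_uH => //; exact: opsum_le.
suff [] : Itg (fun t => opsum e a t * H t) /\
  ip (fun t => expR (- w n * t ^+ 2) * (opsum e a t * H t)) @[n --> \oo] -->
  ip (fun t => opsum e a t * H t) by [].
apply: (@dominated_ip _ _ _ (fun t => Ce * C1 * expR (- (dl * t)))).
- move=> n; apply: pmeasM; last by apply: measurable_Itg; have [] := limH.
  by apply: continuous_pmeas => t t0; cont.
- move=> t t0; rewrite -[X in _ --> X]mul1r; apply: cvgMl.
  have h : {for (0 : R), continuous (fun y : R => expR (- y * t ^+ 2))} by cont.
  have := cvg_comp w (fun y : R => expR (- y * t ^+ 2)) wl h.
  by rewrite /= oppr0 mul0r expR0.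
- by apply: ItgZ; exact: Itg_expRN.
- move=> n t t0; apply: le_trans (domH _ t0).
  rewrite normrM ger0_norm ?expR_ge0// ler_piMl// -expR0 ler_expR mulNr oppr_le0.
  by rewrite mulr_ge0 ?sqr_ge0// ltW.
Qed.

End real_core.

(** * Taylor coefficients of functions of exponential type *)

(** X^n - 1 is separable in characteristic 0, hence has n distinct roots, and among n distinct n-th
    roots of unity one is primitive. *)
Lemma exists_prim_root (K : numClosedFieldType) n : (0 < n)%N ->
  exists z : K, n.-primitive_root z.
Proof.
pose p : {poly K} := 'X^n - 1; have [r Dp] := closed_field_poly_normal p.
move=> n_gt0; rewrite (monicP _) ?monicXnsubC // scale1r in Dp.
have rn1 : all n.-unity_root r by apply/allP=> z; rewrite -root_prod_XsubC -Dp.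
have sz_r : (n < (size r).+1)%N.
  by rewrite -(size_prod_XsubC r id) -Dp size_XnsubC.
have [|z] := hasP (has_prim_root n_gt0 rn1 _ sz_r); last by exists z.
by rewrite -separable_prod_XsubC -Dp separable_Xn_sub_1 // pnatr_eq0 -lt0n.
Qed.

(* Cauchy's estimate, the circle average being replaced by an average over the
   [M]-th roots of unity. *)
Lemma polynomial_coef_le (K : numClosedFieldType) (M n : nat) (c : nat -> K)
    (rho S : K) : (n < M)%N -> 0 <= rho ->
  (forall z : K, `|z| = rho -> `|\sum_(m < M) c m * z ^+ m| <= S) ->
  `|c n| * rho ^+ n <= S.
Proof.
move=> nM rho0 cS; have M0 : (0 < M)%N by exact: leq_ltn_trans nM.
have [w prim_w] := exists_prim_root K M0.
have wM := prim_expr_order prim_w.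
have w1 : `|w| = 1.
  by apply/eqP; rewrite -(@pexpr_eq1 _ _ M)// -normrX wM normr1.
(* The exponent [M - n] plays the role of [- n], as w^M = 1. *)
have orth m : (m < M)%N ->
    \sum_(j < M) (w ^+ (m + (M - n))) ^+ j = if m == n then M%:R else 0.
  move=> mM; set x := w ^+ _; have xM : x ^+ M = 1 by rewrite -exprM mulnC exprM wM expr1n.
  case: eqVneq => [mn|mn].
    have -> : x = 1 by rewrite /x mn subnKC ?wM// ltnW.
    under eq_bigr do rewrite expr1n.
    by rewrite sumr_const card_ord.
  have x1 : x - 1 != 0.
    rewrite subr_eq0 -(prim_order_dvd prim_w); apply: contra mn => /dvdnP[q].
    have := nM; have := mM; case: q => [|[|q]] h1 h2 h3; apply/eqP; nia.
  by apply: (mulfI x1); rewrite mulr0 -subrX1 xM subrr.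
have E : \sum_(j < M) (w ^+ j) ^+ (M - n) * (\sum_(m < M) c m * (rho * w ^+ j) ^+ m) =
    M%:R * (c n * rho ^+ n).
  under eq_bigr do rewrite mulr_sumr.
  rewrite exchange_big/=.
  transitivity (\sum_(m < M) c m * rho ^+ m *
      \sum_(j < M) (w ^+ (m + (M - n))) ^+ j).
    apply: eq_bigr => m _; rewrite mulr_sumr; apply: eq_bigr => j _.
    rewrite exprMn -!exprM mulnDl exprD [(m * j)%N]mulnC [((M - n) * j)%N]mulnC.
    by move: (w ^+ _) (w ^+ _) => x y; ring.
  under eq_bigr => m _ do rewrite (orth m (ltn_ord m)).
  rewrite (bigD1 (Ordinal nM))//= eqxx big1 ?addr0 1?mulrC// => m mn.
  rewrite ifN ?mulr0//; apply: contra mn => /eqP mn; apply/eqP; exact: val_inj.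
have MR : 0 < M%:R :> K by rewrite ltr0n.
rewrite -(ler_pM2l MR) -{1}(ger0_norm (exprn_ge0 n rho0)) -normrM.
rewrite -{1}(ger0_norm (ltW MR)) -normrM -E.
apply: le_trans (ler_norm_sum _ _ _) _.
rewrite (_ : M%:R * S = \sum_(j < M) S); last by rewrite sumr_const card_ord mulr_natl.
apply: ler_sum => j _; rewrite normrM !normrX w1 !expr1n mul1r.
by apply: cS; rewrite normrM normrX w1 expr1n mulr1 ger0_norm.
Qed.

(** * Cauchy's estimate for everywhere convergent power series *)

Section complex_tools.
Variable R : realType.
Local Open Scope complex_scope.
Implicit Types (z : R[i]).

Local Notation normc := (@Normc.normc R).

Lemma normrcE z : `|z| = (normc z)%:C.
Proof. by []. Qed.

Lemma normc_ge0 z : 0 <= normc z.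
Proof. by case: z => x y; exact: sqrtr_ge0. Qed.

Lemma normr_Re_le z : `|complex.Re z| <= normc z.
Proof.
case: z => x y /=; rewrite -[leLHS]sqrtr_sqr ler_wsqrtr// lerDl.
exact: sqr_ge0.
Qed.

Lemma normr_Im_le z : `|complex.Im z| <= normc z.
Proof.
case: z => x y /=; rewrite -[leLHS]sqrtr_sqr ler_wsqrtr// lerDr.
exact: sqr_ge0.
Qed.

Lemma normc_le (x y : R) : normc (x +i* y) <= `|x| + `|y|.
Proof.
have h : 0 <= `|x| + `|y| by rewrite addr_ge0.
rewrite /= -[leRHS](ger0_norm h) -sqrtr_sqr ler_wsqrtr//.
rewrite -(real_normK (num_real x)) -(real_normK (num_real y)).
have := normr_ge0 x; have := normr_ge0 y; move: (`|x|) (`|y|) => u v *; nra.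
Qed.

Lemma normcD_le z1 z2 : normc (z1 + z2) <= normc z1 + normc z2.
Proof. by rewrite -lecR rmorphD -!normrcE ler_normD. Qed.

Lemma normcX z n : normc (z ^+ n) = normc z ^+ n.
Proof. by apply: complexI; rewrite rmorphXn -!normrcE normrX. Qed.

Lemma normcM' z1 z2 : normc (z1 * z2) = normc z1 * normc z2.
Proof. by apply: complexI; rewrite rmorphM -!normrcE normrM. Qed.

Lemma normcN' z : normc (- z) = normc z.
Proof. by apply: complexI; rewrite -!normrcE normrN. Qed.

Lemma cvgC_dist (T : Type) (F : set_system T) {FF : Filter F} (f : T -> R[i]) (l : R[i]) :
  f @ F --> l <-> forall e : R, 0 < e -> \forall x \near F, normc (l - f x) < e.
Proof.
split=> [/cvgrPdist_lt h e e0|h].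
  have /h : 0 < e%:C by rewrite ltcR.
  by apply: filterS => x; rewrite normrcE ltcR.
apply/cvgrPdist_lt => -[e e'] /=; rewrite ltcE /= => /andP[/eqP -> e0].
have := h _ e0; apply: filterS => x xe.
by rewrite normrcE -[X in _ < X]/(e%:C) ltcR.
Qed.

(** The estimate for polynomials applies to partial sums once they are controlled uniformly on the
    circle |z| = rho. Convergence at the single point 2 rho suffices: it bounds |c_m| (2 rho)^m, so
    the tails on the circle are geometric. *)
Lemma taylor_coef_le (psi : R[i] -> R[i]) (c : nat -> R[i]) (C b : R) :
  taylor_coefficients psi c ->
  (forall z, normc (psi z) <= C * expR (b * normc z)) ->
  forall (rho : R) n, 0 < rho -> normc (c n) * rho ^+ n <= C * expR (b * rho).
Proof.
move=> psic psiC rho n rho0.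
have /cvgC_dist h2 := psic (2 * rho)%:C.
(* Beyond rank N a term at 2 rho is the difference of two remainders below 1, hence at most 2; the
   earlier terms are bounded by their sum. *)
have [B B0 cB] : exists2 B : R, 0 <= B & forall m, normc (c m) * rho ^+ m <= B / 2 ^+ m.
  have [N _ hN] := h2 _ (ltr01 : 0 < 1 :> R).
  pose t m := normc (c m) * (2 * rho) ^+ m.
  have t0 m : 0 <= t m.
    by rewrite mulr_ge0 ?normc_ge0 ?exprn_ge0// mulr_ge0// ltW.
  exists (2 + \sum_(m < N) t m); first by rewrite addr_ge0// sumr_ge0.
  move=> m; rewrite ler_pdivlMr ?exprn_gt0// -mulrA -exprMn (mulrC rho) -/(t m).
  have [mN|Nm] := ltnP m N.
    rewrite (bigD1 (Ordinal mN))//= addrCA lerDl addr_ge0// sumr_ge0//.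
  apply: (@le_trans _ _ 2); last by rewrite lerDl sumr_ge0.
  have e1 : c m * ((2 * rho)%:C) ^+ m =
    (psi (2 * rho)%:C - series (fun n => c n * (2 * rho)%:C ^+ n) m) -
    (psi (2 * rho)%:C - series (fun n => c n * (2 * rho)%:C ^+ n) m.+1).
    by rewrite seriesSr; ring.
  have -> : t m = normc (c m * ((2 * rho)%:C) ^+ m).
    apply: complexI; rewrite -normrcE normrM normrX !normrcE /t rmorphM rmorphXn.
    congr (_ * (_ ^+ _)); rewrite -normrcE ger0_norm// lecR mulr_ge0// ltW//.
  rewrite e1 -lecR -normrcE (le_trans (ler_normB _ _))// !normrcE -rmorphD lecR.
  have h3 := ltW (hN m Nm); have h4 := ltW (hN m.+1 (leqW Nm)).
  by rewrite (le_trans (lerD h3 h4))//.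
(* The terms from rank M on add up to at most 2 B / 2^M, proved by telescoping; [L] is large enough
   for the partial sum to be within [e] of [psi z]. *)
have tail M z : normc z = rho ->
    normc (\sum_(m < M) c m * z ^+ m) <= C * expR (b * rho) + 2 * B / 2 ^+ M.
  move=> zr; apply/ler_addgt0Pr => e e0.
  have /cvgC_dist/(_ _ e0)[N _ hN] := psic z.
  have := hN (maxn N M) (leq_maxl _ _).
  set L := maxn N M => hL; have ML : (M <= L)%N by exact: leq_maxr.
  pose s k := \sum_(m < k) c m * z ^+ m.
  have sL : series (fun n => c n * z ^+ n) L = s L by rewrite seriesEord.
  have step k : normc (s (M + k)%N - s M) <= 2 * B / 2 ^+ M - 2 * B / 2 ^+ (M + k).
    elim: k => [|k ih]; first by rewrite addn0 !subrr Normc.normc0.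
    have -> : s (M + k.+1)%N - s M = (s (M + k)%N - s M) + c (M + k)%N * z ^+ (M + k).
      by rewrite /s addnS big_ord_recr/=; ring.
    apply: le_trans (normcD_le _ _) _; rewrite normcM' normcX zr.
    apply: le_trans (lerD ih (cB _)) _; apply: le_of_eq.
    rewrite addnS exprS; have : (2 : R) ^+ (M + k) != 0 by rewrite expf_neq0.
    by move: (2 ^+ (M + k)) (2 * B / _) => u v u0; field.
  have := step (L - M)%N; rewrite subnKC// => hs.
  rewrite -/(s M) (_ : s M = psi z - (psi z - s L) - (s L - s M)); last by ring.
  rewrite sL in hL.
  apply: le_trans (normcD_le _ _) _; rewrite normcN'.
  have h3 : normc (psi z - (psi z - s L)) <= C * expR (b * rho) + e.
    apply: le_trans (normcD_le _ _) _; rewrite normcN' lerD ?(ltW hL)//.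
    by rewrite -zr; exact: psiC.
  have h4 : 0 <= 2 * B / 2 ^+ L by rewrite !mulr_ge0// invr_ge0 exprn_ge0.
  have h5 : normc (s L - s M) <= 2 * B / 2 ^+ M by apply: le_trans hs _; rewrite gerBl.
  by have := lerD h3 h5; rewrite addrAC.
have main M : (n < M)%N -> normc (c n) * rho ^+ n <= C * expR (b * rho) + 2 * B / 2 ^+ M.
  move=> nM; rewrite -lecR.
  have -> : (normc (c n) * rho ^+ n)%:C = `|c n| * rho%:C ^+ n.
    by rewrite normrcE -rmorphXn -rmorphM.
  apply: (@polynomial_coef_le _ M) => //; first by rewrite lecR ltW.
  move=> z zr; rewrite normrcE lecR; apply: tail.
  by apply: complexI; exact: zr.
apply/ler_addgt0Pr => e e0.
(* Any M with M > n and M >= 2 B / e will do, since 2^M >= M. *)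
pose x := 2 * B / e; pose M := (n.+1 + Num.bound x)%N.
have x0 : 0 <= x by rewrite !mulr_ge0// invr_ge0 ltW.
have nM : (n < M)%N by rewrite /M addSn ltnS leq_addr.
apply: le_trans (main M nM) _; rewrite lerD2l ler_pdivrMr ?exprn_gt0//.
rewrite -ler_pdivrMl// [_^-1 * _]mulrC -/x; apply: (@le_trans _ _ M%:R).
  have := archi_boundP x0; rewrite /M; set k := Num.bound x => h.
  by rewrite (le_trans (ltW h))// ler_nat leq_addl.
by rewrite -natrX ler_nat ltnW// ltn_expl.
Qed.

End complex_tools.

(** * Coefficient bounds and splitting into real and imaginary parts *)

Section complex_parts.
Variable R : realType.
Local Open Scope complex_scope.
Implicit Types (z : R[i]) (c : nat -> R[i]) (psi : R[i] -> R[i]).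

Local Notation normc := (@Normc.normc R).
Local Notation Re := complex.Re.
Local Notation Im := complex.Im.

Lemma leq_fact_exp n : (n.+1`! <= n.+1 ^ n)%N.
Proof.
elim: n => // n ih; rewrite factS expnS leq_mul2l /= (leq_trans ih)//.
by case: n {ih} => // n; rewrite leq_exp2r.
Qed.

(** Cauchy's estimate on the circle of radius (n + 1) / b' gives C e^{n+1} (b' / (n+1))^n, and
    (n+1)! <= (n+1)^n brings in the factorial. Taking n + 1 instead of n avoids a zero radius and
    yields a bound of order n + 1, the one needed for D_a psi2(D_a), where [c2 n] multiplies
    D_a^{n+1}. *)
Lemma exponential_type_coef psi c (b b' : R) : 0 <= b < b' ->
  taylor_coefficients psi c -> exponential_type b psi ->
  exists2 K : R, 0 <= K &
    forall n, normc (c n) <= K * ((expR 1 * b') ^+ n.+1 / n.+1`!%:R).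
Proof.
move=> /andP[b0 bb'] psic psib; have b'0 : 0 < b' by exact: le_lt_trans bb'.
have [|C hC] := psib (b' - b); first by rewrite subr_gt0.
rewrite subrKC in hC.
have C0 : 0 <= C.
  have := le_trans (normc_ge0 _) (hC 0); rewrite pmulr_lge0//; exact: expR_gt0.
exists (C / b'); first by rewrite divr_ge0// ltW.
move=> n; pose rho : R := n.+1%:R / b'.
have rho0 : 0 < rho by rewrite divr_gt0.
have := taylor_coef_le psic hC n rho0.
rewrite /rho mulrCA mulfV ?gt_eqF// mulr1.
rewrite -ler_pdivlMr ?exprn_gt0 ?divr_gt0// => h; apply: (le_trans h).
have -> : expR n.+1%:R = expR 1 ^+ n.+1 :> R by rewrite -expRM_natl mulr1.
rewrite expr_div_n invf_div exprMn (exprS b').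
have f0 : 0 < (n.+1`!%:R : R) by rewrite ltr0n fact_gt0.
have p0 : 0 < (n.+1%:R ^+ n : R) by rewrite exprn_gt0.
have -> : C / b' * (expR 1 ^+ n.+1 * (b' * b' ^+ n) / n.+1`!%:R) =
   C * expR 1 ^+ n.+1 * (b' ^+ n / n.+1`!%:R) by field; rewrite !gt_eqF.
rewrite ler_wpM2l ?mulr_ge0 ?exprn_ge0 ?expR_ge0//.
rewrite ler_wpM2l ?exprn_ge0 ?(ltW b'0)// lef_pV2 ?posrE//.
by rewrite -natrX ler_nat leq_fact_exp.
Qed.

(** Subtracting the expansions at z and - z shows that c_m - (-1)^m c_m are Taylor coefficients of
    the zero function. Cauchy's estimate with C = 0 kills them, and for odd n the difference is 2
    c_n. *)
Lemma even_coef psi c n : even_fct psi -> taylor_coefficients psi c -> odd n ->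
  c n = 0.
Proof.
move=> psie psic n1; pose d m := c m - (-1) ^+ m * c m.
have dt : taylor_coefficients (fun=> 0) d.
  move=> z; have h1 := psic z; have h2 := psic (- z).
  rewrite psie in h2; apply/cvgC_dist => e e0.
  have e20 : 0 < e / 2 by rewrite divr_gt0.
  move: h1 h2 => /cvgC_dist/(_ _ e20) h1 /cvgC_dist/(_ _ e20) h2.
  near=> N.
  have -> : 0 - series (fun m => d m * z ^+ m) N =
      (psi z - series (fun m => c m * z ^+ m) N) -
      (psi z - series (fun m => c m * (- z) ^+ m) N).
    rewrite sub0r !seriesEord /= (_ : \sum_(k < N) d k * z ^+ k =
      \sum_(k < N) c k * z ^+ k - \sum_(k < N) c k * (- z) ^+ k); first by ring.
    by rewrite -sumrB; apply: eq_bigr => k _; rewrite /d [(- z) ^+ _]exprNn; ring.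
  rewrite (le_lt_trans (normcD_le _ _))// normcN' [ltRHS]splitr ltrD//; near: N.
    exact: h1.
  exact: h2.
have h0 z : normc ((fun=> 0) z : R[i]) <= 0 * expR (0 * normc z).
  by rewrite Normc.normc0 mul0r.
have h : normc (d n) <= 0.
  by have := taylor_coef_le dt h0 n ltr01; rewrite expr1n mulr1 mul0r.
have dn : d n = 0 by apply: Normc.eq0_normc; apply/eqP; rewrite eq_le h normc_ge0.
move: dn; rewrite /d -signr_odd n1 expr1 mulN1r opprK => /eqP.
by rewrite -mulr2n mulrn_eq0 /= => /eqP.
Unshelve. all: end_near. Qed.

Lemma cvgC_parts (T : Type) (F : set_system T) {FF : Filter F} (f g : T -> R) (x y : R) :
  f @ F --> x -> g @ F --> y -> (fun t => f t +i* g t : R[i]) @ F --> (x +i* y : R[i]).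
Proof.
move=> fx gy; apply/cvgC_dist => e e0.
have e20 : 0 < e / 2 by rewrite divr_gt0.
have h1 : \forall t \near F, `|x - f t| < e / 2 by move/cvgrPdist_lt: fx; apply.
have h2 : \forall t \near F, `|y - g t| < e / 2 by move/cvgrPdist_lt: gy; apply.
near=> t; have -> : (x +i* y) - (f t +i* g t) = (x - f t) +i* (y - g t) by [].
rewrite (le_lt_trans (normc_le _ _))// [ltRHS]splitr ltrD//; near: t; [exact: h1|exact: h2].
Unshelve. all: end_near. Qed.

Lemma cvgC_Re (T : Type) (F : set_system T) {FF : Filter F} (f : T -> R[i]) (l : R[i]) :
  f @ F --> l -> (fun t => Re (f t)) @ F --> Re l.
Proof.
move=> /cvgC_dist h; apply/cvgrPdist_lt => e /h; apply: filterS => t.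
by apply: le_lt_trans; case: (l) (f t) => x y [x' y'];
  exact: (@normr_Re_le R ((x - x') +i* (y - y'))).
Qed.

Lemma cvgC_Im (T : Type) (F : set_system T) {FF : Filter F} (f : T -> R[i]) (l : R[i]) :
  f @ F --> l -> (fun t => Im (f t)) @ F --> Im l.
Proof.
move=> /cvgC_dist h; apply/cvgrPdist_lt => e /h; apply: filterS => t.
by apply: le_lt_trans; case: (l) (f t) => x y [x' y'];
  exact: (@normr_Im_le R ((x - x') +i* (y - y'))).
Qed.

Lemma sum_double (V : zmodType) (f : nat -> V) N :
  \sum_(n < N.*2) f n = \sum_(m < N) (f m.*2 + f m.*2.+1).
Proof.
elim: N => [|N ih]; first by rewrite !big_ord0.
by rewrite doubleS !big_ord_recr /= ih addrA.
Qed.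

Lemma cvg_double : (fun n : nat => n.*2) @ \oo --> \oo.
Proof.
apply/cvgnyPge => M; near=> n; apply: (@leq_trans n).
  by near: n; exact: nbhs_infty_ge.
by rewrite -addnn leq_addr.
Unshelve. all: end_near. Qed.

Lemma Itg_closed_itv (f : R -> R) : Itg f ->
  lebesgue_measure.-integrable `[0, +oo[ (EFin \o f).
Proof.
move=> intf; have /integrableP[mf foo] := intf.
have mf' : measurable_fun (`[0, +oo[%classic : set (measurableTypeR R)) (EFin \o f).
  exact/emeasurable_fun_itv_obnd_cbndP.
apply/integrableP; split=> //.
rewrite -integral_itv_obnd_cbnd//.
by apply: measurableT_comp.
Qed.

(* [psi1 (D) + D psi2 (D) = \sum_n interleave c1 c2 n D^n], for even [psi1] and
   [psi2]. *)
Definition interleave c1 c2 : nat -> R[i] :=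
  fun n => if odd n then c2 n.-1 else c1 n.

Lemma interleave_sum c1 c2 (w : nat -> R) N :
  \sum_(n < N.*2) interleave c1 c2 n * (w n)%:C =
  \sum_(m < N) c1 m.*2 * (w m.*2)%:C + \sum_(m < N) c2 m.*2 * (w m.*2.+1)%:C.
Proof.
rewrite (sum_double (fun n => interleave c1 c2 n * (w n)%:C)) big_split /=.
by congr (_ + _); apply: eq_bigr => m _; rewrite /interleave /= odd_double.
Qed.

Lemma Re_sum (c : nat -> R[i]) (w : nat -> R) N :
  Re (\sum_(n < N) c n * (w n)%:C) = \sum_(n < N) Re (c n) * w n.
Proof.
elim: N => [|N ih]; first by rewrite !big_ord0.
rewrite !big_ord_recr /= -ih; case: (\sum_(i < N) _) => x y.
by case: (c N) => x' y' /=; rewrite mulr0 subr0.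
Qed.

Lemma Im_sum (c : nat -> R[i]) (w : nat -> R) N :
  Im (\sum_(n < N) c n * (w n)%:C) = \sum_(n < N) Im (c n) * w n.
Proof.
elim: N => [|N ih]; first by rewrite !big_ord0.
rewrite !big_ord_recr /= -ih; case: (\sum_(i < N) _) => x y.
by case: (c N) => x' y' /=; rewrite mulr0 add0r.
Qed.

Lemma expR_le_1D2 (r : R) : 0 <= r <= 1 / 2 -> expR r <= 1 + 2 * r.
Proof.
move=> /andP[r0 r1]; have p : 0 < 1 - r by lra.
have h : 1 - r <= expR (- r) by exact: expR_ge1Dx.
have e : expR r = (expR (- r))^-1 by rewrite expRN invrK.
have : (expR (- r))^-1 <= (1 - r)^-1 by rewrite lef_pV2 ?posrE ?expR_gt0.
rewrite -e => /le_trans; apply.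
by rewrite -[leLHS]mul1r ler_pdivrMr//; nra.
Qed.

(** The factor 2 e of the hypothesis is spent here. Take [b] midway between the larger type and the
    allowed bound; then r = e b < (1 - u) / 2 <= 1/2, so e^r - 1 <= 2 r, and [dl] is half of the gap
    1 - u - 2 r that is left. *)
Lemma type_margin (u b1 b2 : R) : 0 <= u < 1 ->
  0 <= b1 < (1 - u) / (2 * expR 1) -> 0 <= b2 < (1 - u) / (2 * expR 1) ->
  exists b dl : R, [/\ b1 < b, b2 < b, 0 < dl &
    u + (expR (expR 1 * b) - 1) + 2 * dl <= 1].
Proof.
move=> /andP[u0 u1] /andP[b10 b1u] /andP[b20 b2u].
pose m := Num.max b1 b2; pose v := (1 - u) / (2 * expR 1).
have e0 : 0 < expR 1 :> R by exact: expR_gt0.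
have mv : m < v by rewrite /m gt_max b1u.
have m1 : b1 <= m by rewrite le_max lexx.
have m2 : b2 <= m by rewrite le_max lexx orbT.
have vE : expR 1 * v = (1 - u) / 2 by rewrite /v; field; rewrite gt_eqF.
pose b := (m + v) / 2; pose r := expR 1 * b.
have bv : b < v by rewrite /b; lra.
have b0 : 0 < b by rewrite /b; lra.
have r0 : 0 < r by apply: mulr_gt0.
have rv : r < (1 - u) / 2 by rewrite -vE ltr_pM2l.
exists b, ((1 - u - 2 * r) / 2); split; [rewrite /b; lra|rewrite /b; lra|lra|].
have := @expR_le_1D2 r; rewrite -/r; lra.
Qed.

(** At odd n the coefficient of psi2 has index n - 1, so its bound is exactly of order n. At even n
    the bound has order n + 1, and a factor r / (n + 1) <= r goes into the constant. *)
Lemma interleave_le (c1 c2 : nat -> R[i]) (K1 K2 r : R) :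
  0 <= K1 -> 0 <= K2 -> 0 < r ->
  (forall n, normc (c1 n) <= K1 * (r ^+ n.+1 / n.+1`!%:R)) ->
  (forall n, normc (c2 n) <= K2 * (r ^+ n.+1 / n.+1`!%:R)) ->
  forall n, normc (interleave c1 c2 n) <= (K1 * r + K2) * (r ^+ n / n`!%:R).
Proof.
move=> K10 K20 r0 h1 h2 n; rewrite /interleave.
have p k : 0 <= r ^+ k / k`!%:R by rewrite divr_ge0// exprn_ge0// ltW.
case: ifPn => [|_].
  case: n => // n _; rewrite (le_trans (h2 _))// ler_wpM2r//.
  by rewrite lerDr mulr_ge0// ltW.
rewrite (le_trans (h1 _))// (@le_trans _ _ (K1 * r * (r ^+ n / n`!%:R)))//; last first.
  by rewrite ler_wpM2r// lerDl.
rewrite exprS -!mulrA ler_wpM2l// ler_wpM2l ?(ltW r0)// ler_wpM2l ?exprn_ge0 ?(ltW r0)//.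
by rewrite lef_pV2 ?posrE ?ltr0n ?fact_gt0// ler_nat factS leq_pmull.
Qed.

Section mellin_parts.
Variables (s : R[i]) (X Y : R -> R).
Local Notation W := (mweight (Re s) (Im s)).
Hypotheses (intX : forall th, Itg (fun x => X x * W th x))
  (intY : forall th, Itg (fun x => Y x * W th x)).

(** The phases 0 and - pi / 2 of [mweight] are the real and imaginary parts of x^{s-1} e^{-x}. *)
Lemma mellin_weightedE (F : R -> R[i]) x : F x = X x +i* Y x ->
  mellin_weighted s F x =
  (X x * W 0 x - Y x * W (- (pi / 2)) x) +i* (X x * W (- (pi / 2)) x + Y x * W 0 x).
Proof.
move=> FE; rewrite /mellin_weighted FE /cpow /cexp /mweight; case: s => sg nu /=.
have sE y : sin y = cos (y - pi / 2) by rewrite cosB cos_pihalf sin_pihalf; ring.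
rewrite oppr0 !addr0 !mulr0 ?mul0r !subr0 ?add0r sE.
rewrite expRD; simpc.
by congr (_ +i* _); ring.
Qed.

Lemma cmellin (F : R -> R[i]) : (forall x, 0 < x -> F x = X x +i* Y x) ->
  cintegrable `]0, +oo[ (mellin_weighted s F) /\
  cintegral `]0, +oo[ (mellin_weighted s F) =
  (ip (fun x => X x * W 0 x) - ip (fun x => Y x * W (- (pi / 2)) x)) +i*
  (ip (fun x => X x * W (- (pi / 2)) x) + ip (fun x => Y x * W 0 x)).
Proof.
move=> FE; split.
  split.
    by apply: eq_Itg (ItgB (intX 0) (intY (- (pi / 2)))) => x x0; rewrite mellin_weightedE ?FE.
  by apply: eq_Itg (ItgD (intX (- (pi / 2))) (intY 0)) => x x0; rewrite mellin_weightedE ?FE.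
rewrite -ipB// -ipD//; congr (_ +i* _).
  by apply: eq_ip => x x0; rewrite mellin_weightedE ?FE.
by apply: eq_ip => x x0; rewrite mellin_weightedE ?FE.
Qed.

End mellin_parts.

End complex_parts.

(** * Complex coefficients *)

Section complex_coefficients.
Variables (R : realType) (a r dl Ce : R) (e : nat -> R[i]).
Local Open Scope complex_scope.
Local Notation normc := (@Normc.normc R).
Local Notation Re := complex.Re.
Local Notation Im := complex.Im.
Hypotheses (a0 : 0 <= a < pi / 2) (r0 : 0 < r) (dl0 : 0 < dl).
Hypothesis rdl : sin a + (expR r - 1) + 2 * dl <= 1.
Hypothesis eC : forall n, normc (e n) <= Ce * (r ^+ n / n`!%:R).

Let e1 n := Re (e n).
Let e2 n := Im (e n).

Let e1C n : `|e1 n| <= Ce * (r ^+ n / n`!%:R).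
Proof. by apply: le_trans (eC n); exact: normr_Re_le. Qed.

Let e2C n : `|e2 n| <= Ce * (r ^+ n / n`!%:R).
Proof. by apply: le_trans (eC n); exact: normr_Im_le. Qed.

Lemma copD_cvg x : 0 < x ->
  (fun N => \sum_(n < N) e n * (dexpsin n x a)%:C) @ \oo -->
  (opD e1 a x +i* opD e2 a x).
Proof.
move=> x0.
rewrite (_ : (fun N => _) = (fun N => series (fun n => e1 n * dexpsin n x a) N +i*
    series (fun n => e2 n * dexpsin n x a) N)).
  by apply: cvgC_parts; [exact: (@opD_cvg R a r dl r0 dl0 rdl e1 Ce e1C x x0)
                        |exact: (@opD_cvg R a r dl r0 dl0 rdl e2 Ce e2C x x0)].
apply/funext => N; rewrite !seriesEord.
pose w n := dexpsin n x a.
by move: (Re_sum e w N) (Im_sum e w N); case: (\sum_(i < N) _) => u v /= -> ->.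
Qed.

Lemma copsum_cvg tau :
  (fun N => \sum_(n < N) e n * (tau ^+ n * hyp n ((pi / 2 + a) * tau))%:C) @ \oo -->
  (opsum e1 a tau +i* opsum e2 a tau).
Proof.
rewrite (_ : (fun N => _) =
  (fun N => series (fun n => e1 n * (tau ^+ n * hyp n ((pi / 2 + a) * tau))) N +i*
    series (fun n => e2 n * (tau ^+ n * hyp n ((pi / 2 + a) * tau))) N)).
  by apply: cvgC_parts; [exact: (@opsum_cvg R a r dl a0 r0 dl0 rdl e1 Ce e1C tau)
                        |exact: (@opsum_cvg R a r dl a0 r0 dl0 rdl e2 Ce e2C tau)].
apply/funext => N; rewrite !seriesEord.
pose w n := tau ^+ n * hyp n ((pi / 2 + a) * tau).
by move: (Re_sum e w N) (Im_sum e w N); case: (\sum_(i < N) _) => u v /= -> ->.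
Qed.

Section with_integrand.
Variables (psi1 psi2 : R[i] -> R[i]).
Hypothesis psiE : forall tau : R,
  psi1 tau%:C * (cosh ((pi / 2 + a) * tau))%:C +
  psi2 tau%:C * tau%:C * (sinh ((pi / 2 + a) * tau))%:C =
  opsum e1 a tau +i* opsum e2 a tau.

Let ReI eps x tau : 0 < x -> Re (f_integrand psi1 psi2 a eps x tau) =
  expR (- eps * tau ^+ 2) * opsum e1 a tau * mac tau x.
Proof. by move=> x0; rewrite /f_integrand psiE macdonaldE//; simpc. Qed.

Let ImI eps x tau : 0 < x -> Im (f_integrand psi1 psi2 a eps x tau) =
  expR (- eps * tau ^+ 2) * opsum e2 a tau * mac tau x.
Proof. by move=> x0; rewrite /f_integrand psiE macdonaldE//; simpc. Qed.

Let Itg_Re eps x : 0 < eps -> 0 < x ->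
  Itg (fun tau => Re (f_integrand psi1 psi2 a eps x tau)).
Proof.
move=> ep x0.
by apply: eq_Itg (Itg_freg_integrand a0 r0 dl0 rdl e1C ep x0) => tau _; rewrite ReI.
Qed.

Let Itg_Im eps x : 0 < eps -> 0 < x ->
  Itg (fun tau => Im (f_integrand psi1 psi2 a eps x tau)).
Proof.
move=> ep x0.
by apply: eq_Itg (Itg_freg_integrand a0 r0 dl0 rdl e2C ep x0) => tau _; rewrite ImI.
Qed.

Lemma cintegrable_f_integrand eps x : 0 < eps -> 0 < x ->
  cintegrable `[0, +oo[ (f_integrand psi1 psi2 a eps x).
Proof. by move=> ep x0; split; apply: Itg_closed_itv; [exact: Itg_Re|exact: Itg_Im]. Qed.

Lemma f_epsE eps x : 0 < eps -> 0 < x ->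
  f_eps psi1 psi2 a eps x = freg e1 a eps x +i* freg e2 a eps x.
Proof.
move=> ep x0; have := Itg_Re ep x0; have := Itg_Im ep x0 => iI iR.
have closedE (f : R -> R) : Itg f -> \int[lebesgue_measure]_(t in `[0, +oo[) f t = ip f.
  by move=> fi; rewrite -Rintegral_itv_obnd_cbnd.
rewrite /f_eps /cintegral !closedE//; congr (_ +i* _).
  by apply: eq_ip => tau _; rewrite ReI.
by apply: eq_ip => tau _; rewrite ImI.
Qed.

Lemma cvg_mellin_f_eps (s : R[i]) (G : R -> R[i]) : 0 < Re s ->
  (forall x, 0 < x -> G x = opD e1 a x +i* opD e2 a x) ->
  (forall eps : R, 0 < eps ->
     cintegrable `]0, +oo[ (mellin_weighted s (f_eps psi1 psi2 a eps))) /\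
  cintegrable `]0, +oo[ (mellin_weighted s G) /\
  (fun eps : R =>
     cintegral `]0, +oo[ (mellin_weighted s (f_eps psi1 psi2 a eps)))
    @ 0^'+ --> (pi / 2)%:C * cintegral `]0, +oo[ (mellin_weighted s G).
Proof.
move=> s0 GE.
have I1 th := Itg_opD (Im s) th s0 r0 dl0 rdl e1C.
have I2 th := Itg_opD (Im s) th s0 r0 dl0 rdl e2C.
have L1 th := @cvg_mellin_freg R (Re s) (Im s) th a r dl s0 a0 r0 dl0 rdl e1 Ce e1C.
have L2 th := @cvg_mellin_freg R (Re s) (Im s) th a r dl s0 a0 r0 dl0 rdl e2 Ce e2C.
have J1 th eps (ep : 0 < eps) := proj1 (mellin_freg (Im s) th s0 a0 r0 dl0 rdl e1C ep).
have J2 th eps (ep : 0 < eps) := proj1 (mellin_freg (Im s) th s0 a0 r0 dl0 rdl e2C ep).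
have M eps (ep : 0 < eps) :=
  cmellin (fun th => J1 th eps ep) (fun th => J2 th eps ep) (fun x x0 => f_epsE ep x0).
have [G1 G2] := cmellin I1 I2 GE.
split; first by move=> eps /M[].
split=> //.
rewrite G2.
have -> : forall u v : R, (pi / 2)%:C * (u +i* v) = (pi / 2 * u) +i* (pi / 2 * v).
  by move=> u v; simpc.
rewrite mulrBr mulrDr.
pose W := mweight (Re s) (Im s); pose pr (f h : R -> R) := ip (fun x => f x * h x).
have cc := @cvgC_parts R _ (0^'+) _
 (fun eps => pr (freg e1 a eps) (W 0) - pr (freg e2 a eps) (W (- (pi / 2))))
 (fun eps => pr (freg e1 a eps) (W (- (pi / 2))) + pr (freg e2 a eps) (W 0)) _ _
 (cvgB (L1 0) (L2 _)) (cvgD (L1 _) (L2 0)).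
have F0 : Filter (0^'+ : set_system R) by exact: at_right_proper_filter.
have {}cc := cc F0 F0 F0.
(* [f_epsE] holds for [eps > 0] only, so the two functions of [eps] agree merely on a right
   neighbourhood of 0. *)
apply/cvgC_dist => d d0; move/cvgC_dist: cc => /(_ d d0) h; near=> eps.
have ep : 0 < eps by near: eps; exact: nbhs_right_gt.
by have [_ ->] := M eps ep; near: eps; exact: h.
Unshelve. all: end_near. Qed.

End with_integrand.
End complex_coefficients.

(** * Even functions and partial sums along even indices *)

Section even_entire.
Variable R : realType.
Local Open Scope complex_scope.
Local Notation Re := complex.Re.
Local Notation Im := complex.Im.

Lemma cvgC_unique (T : Type) (F : set_system T) {FF : ProperFilter F} (f : T -> R[i]) (l m : R[i]) :
  f @ F --> l -> f @ F --> m -> l = m.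
Proof.
move=> fl fm; have h1 := cvg_unique _ (cvgC_Re fl) (cvgC_Re fm).
have h2 := cvg_unique _ (cvgC_Im fl) (cvgC_Im fm).
by case: l m h1 h2 {fl fm} => u v [u' v'] /= -> // ->.
Qed.

Lemma cvg_subseq_double (u : nat -> R[i]) (l : R[i]) :
  u @ \oo --> l -> (fun N => u N.*2) @ \oo --> l.
Proof. by move=> ul; exact: cvg_comp cvg_double ul. Qed.

Lemma cvgC_lin (f g : nat -> R[i]) (l m : R[i]) (k h : R) :
  f @ \oo --> l -> g @ \oo --> m ->
  (fun n => f n * k%:C + g n * h%:C) @ \oo --> l * k%:C + m * h%:C.
Proof.
move=> fl gm.
have E (z w : R[i]) : z * k%:C + w * h%:C =
    (Re z * k + Re w * h) +i* (Im z * k + Im w * h).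
  by case: z w => u v [u' v']; simpc.
rewrite E (_ : (fun n => _) = (fun n => (Re (f n) * k + Re (g n) * h) +i*
   (Im (f n) * k + Im (g n) * h))); last by apply/funext => n; rewrite E.
by apply: cvgC_parts; apply: cvgD; apply: cvgM;
  try exact: cvg_cst; first [exact: cvgC_Re|exact: cvgC_Im].
Qed.

Lemma even_taylor_cvg (psi : R[i] -> R[i]) (c : nat -> R[i]) (tau : R) :
  even_fct psi -> taylor_coefficients psi c ->
  (fun N => \sum_(m < N) c m.*2 * (tau ^+ m.*2)%:C) @ \oo --> psi tau%:C.
Proof.
move=> psie psic; have := cvg_subseq_double (psic tau%:C).
rewrite (_ : (fun N => _) = (fun N => \sum_(m < N) c m.*2 * (tau ^+ m.*2)%:C))//.
apply/funext => N /=; rewrite seriesEord.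
transitivity (\sum_(m < N) (c m.*2 * tau%:C ^+ m.*2 + c m.*2.+1 * tau%:C ^+ m.*2.+1)).
  exact: (sum_double (fun n => c n * tau%:C ^+ n)).
apply: eq_bigr => m _.
by rewrite [c m.*2.+1](even_coef psie psic) ?mul0r ?addr0 ?rmorphXn//= odd_double.
Qed.

End even_entire.

Unset Implicit Arguments.
Local Open Scope complex_scope.

Theorem theorem3 (R : realType) (a b1 b2 : R)
  (psi1 psi2 : R[i] -> R[i]) (c1 c2 : nat -> R[i])
  (ha : 0 <= a < pi / 2)
  (hb1 : 0 <= b1 < (1 - sin a) / (2 * expR 1))
  (hb2 : 0 <= b2 < (1 - sin a) / (2 * expR 1))
  (entire1 : entire psi1) (entire2 : entire psi2)
  (even1 : even_fct psi1) (even2 : even_fct psi2)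
  (coeff1 : taylor_coefficients psi1 c1)
  (coeff2 : taylor_coefficients psi2 c2)
  (type1 : exponential_type b1 psi1) (type2 : exponential_type b2 psi2) :
  let g (x : R) := fun a' : R => expR (x * sin a') in
  let G (x : R) : R[i] := psiD c1 (g x) a + DpsiD c2 (g x) a in
  (forall eps x : R, 0 < eps -> 0 < x ->
     cintegrable `[0, +oo[ (f_integrand psi1 psi2 a eps x)) /\
  (forall x : R, 0 < x ->
     cvgn (psiD_partial c1 (g x) a) /\ cvgn (DpsiD_partial c2 (g x) a)) /\
  forall s : R[i], 0 < complex.Re s ->
    (forall eps : R, 0 < eps ->
       cintegrable `]0, +oo[ (mellin_weighted s (f_eps psi1 psi2 a eps))) /\
    cintegrable `]0, +oo[ (mellin_weighted s G) /\
    (fun eps : R =>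
       cintegral `]0, +oo[ (mellin_weighted s (f_eps psi1 psi2 a eps)))
      @ 0^'+ --> (pi / 2)%:C * cintegral `]0, +oo[ (mellin_weighted s G).
Proof.
move=> g G.
have sin01 : 0 <= sin a < 1.
  have [a0 api] := andP ha; apply/andP; split.
    apply: sin_ge0_pi; rewrite a0/=; apply: (le_trans (ltW api)).
    by have := pi_ge0 R; lra.
  have pi0 := pi_gt0 R; rewrite -(@sin_pihalf R) ltr_sin// !in_itv /=; apply/andP; split; lra.
(* [b] exceeds both types strictly, so that [r = e b] bounds both coefficient sequences, and [dl] is
   the common margin. *)
have [b [dl [b1b b2b dl0 rdl]]] := type_margin sin01 hb1 hb2.
have [b10 _] := andP hb1; have [b20 _] := andP hb2.
pose r := expR 1 * b.
have r0 : 0 < r by apply: mulr_gt0; [exact: expR_gt0|exact: le_lt_trans b1b].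
have [|K1 K10 c1K] := @exponential_type_coef _ psi1 c1 b1 b _ coeff1 type1; first by rewrite b10.
have [|K2 K20 c2K] := @exponential_type_coef _ psi2 c2 b2 b _ coeff2 type2; first by rewrite b20.
(* Interleaving with the zero sequence makes psi1(D_a) and D_a psi2(D_a) instances of the combined
   operator; this gives the convergence of each series separately. *)
have c0K (n : nat) : Normc.normc (0 : R[i]) <= 0 * (r ^+ n.+1 / n.+1`!%:R).
  by rewrite Normc.normc0 mul0r.
have eC := interleave_le K10 K20 r0 c1K c2K.
have e1C := interleave_le K10 (lexx _) r0 c1K c0K.
have e2C := interleave_le (lexx _) K20 r0 c0K c2K.
have psiE (tau : R) :
    psi1 tau%:C * (cosh ((pi / 2 + a) * tau))%:C +
    psi2 tau%:C * tau%:C * (sinh ((pi / 2 + a) * tau))%:C =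
    opsum (fun n => complex.Re (interleave c1 c2 n)) a tau +i*
    opsum (fun n => complex.Im (interleave c1 c2 n)) a tau.
  have := cvg_subseq_double (@copsum_cvg R a r dl _ _ ha r0 dl0 rdl eC tau).
  apply: cvgC_unique.
  rewrite -mulrA -rmorphM/=.
  rewrite (_ : (fun N => _) = (fun N =>
    (\sum_(m < N) c1 m.*2 * (tau ^+ m.*2)%:C) * (cosh ((pi / 2 + a) * tau))%:C +
    (\sum_(m < N) c2 m.*2 * (tau ^+ m.*2)%:C) * (tau * sinh ((pi / 2 + a) * tau))%:C)).
    by apply: cvgC_lin; exact: even_taylor_cvg.
  apply/funext => N /=.
  rewrite (interleave_sum c1 c2 (fun n => tau ^+ n * hyp n ((pi / 2 + a) * tau))).
  rewrite !mulr_suml; congr (_ + _); apply: eq_bigr => m _; rewrite /hyp /= odd_double /=.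
    by rewrite rmorphM mulrA.
  by rewrite -mulrA -rmorphM/=; congr (_ * _%:C); rewrite exprSr; ring.
(* The first 2 N terms of an interleaved series are exactly the first N terms of each of the two
   series, so limits are compared along even indices. *)
have D1 x (x0 : 0 < x) := cvg_subseq_double (@copD_cvg R a r dl _ _ r0 dl0 rdl e1C x x0).
have D2 x (x0 : 0 < x) := cvg_subseq_double (@copD_cvg R a r dl _ _ r0 dl0 rdl e2C x x0).
have D x (x0 : 0 < x) := cvg_subseq_double (@copD_cvg R a r dl _ _ r0 dl0 rdl eC x x0).
have P1 x (x0 : 0 < x) : cvgn (psiD_partial c1 (g x) a).
  suff -> : psiD_partial c1 (g x) a =
      (fun N => \sum_(n < N.*2) interleave c1 (fun=> 0) n * (dexpsin n x a)%:C).
    by apply/cvg_ex; eexists; exact: (D1 x x0).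
  apply/funext => N /=.
  rewrite (interleave_sum c1 _ (fun n => dexpsin n x a)) [X in _ + X]big1 ?addr0 => [|i _].
    by rewrite /psiD_partial seriesEord.
  by rewrite mul0r.
have P2 x (x0 : 0 < x) : cvgn (DpsiD_partial c2 (g x) a).
  suff -> : DpsiD_partial c2 (g x) a =
      (fun N => \sum_(n < N.*2) interleave (fun=> 0) c2 n * (dexpsin n x a)%:C).
    by apply/cvg_ex; eexists; exact: (D2 x x0).
  apply/funext => N /=.
  rewrite (interleave_sum _ c2 (fun n => dexpsin n x a)) [X in X + _]big1 ?add0r => [|i _].
    by rewrite /DpsiD_partial seriesEord.
  by rewrite mul0r.
have GE x : 0 < x -> G x =
    opD (fun n => complex.Re (interleave c1 c2 n)) a x +i*
    opD (fun n => complex.Im (interleave c1 c2 n)) a x.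
  move=> x0; have := D x x0; apply: cvgC_unique.
  have -> : (fun N => \sum_(n < N.*2) interleave c1 c2 n * (dexpsin n x a)%:C) =
      (fun N => psiD_partial c1 (g x) a N + DpsiD_partial c2 (g x) a N).
    apply/funext => N /=; rewrite (interleave_sum c1 c2 (fun n => dexpsin n x a)).
    by rewrite /psiD_partial /DpsiD_partial !seriesEord.
  by apply: cvgD; [exact: P1|exact: P2].
split; first by move=> eps x; exact: (cintegrable_f_integrand ha r0 dl0 rdl eC psiE).
split; first by move=> x x0; split; [exact: P1|exact: P2].
by move=> s s0; exact: (cvg_mellin_f_eps ha r0 dl0 rdl eC psiE s0 GE).
Qed.
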